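(* Let $n \ge 5$. Any finite dimensional complex representation of $SL_n(\mathbb{Z})$ of dimension less than $2^n - 2$ extends (not just virtually) to an algebraic representation of $SL_n(\mathbb{C})$; that is, for every $N < 2^n-2$ and every homomorphism $\phi: SL_n(\mathbb{Z}) \to GL_N(\mathbb{C})$ there is an algebraic (rational) representation $\tilde\phi: SL_n(\mathbb{C}) \to GL_N(\mathbb{C})$ with $\phi(g) = \tilde\phi(g)$ for all $g \in SL_n(\mathbb{Z})$.
   Context: An algebraic (a.k.a. rational) representation of $SL_n(\mathbb{C})$ is a homomorphism $SL_n(\mathbb{C}) \to GL_N(\mathbb{C})$ which is a morphism of algebraic groups. *)

(* Defs.v *)
From HB Require Import structures.
From mathcomp Require Import all_boot all_order all_algebra.
From mathcomp Require Import complex mpoly.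

Set Implicit Arguments.
Unset Strict Implicit.
Unset Printing Implicit Defensive.

Import GRing.Theory.
Local Open Scope ring_scope.

Record SL (n : nat) (A : comUnitRingType) :=
  MkSL { sl_mx :> 'M[A]_n; sl_det : \det sl_mx == 1 }.

HB.instance Definition _ n A := [isSub for @sl_mx n A].
HB.instance Definition _ n A := [Choice of SL n A by <:].

Record GL (n : nat) (A : comUnitRingType) :=
  MkGL { gl_mx :> 'M[A]_n; gl_unit : gl_mx \in unitmx }.

HB.instance Definition _ n A := [isSub for @gl_mx n A].
HB.instance Definition _ n A := [Choice of GL n A by <:].

Section SLGroup.
Variables (n : nat) (A : comUnitRingType).
Implicit Types g h k : SL n A.

Fact sl_one_subproof : \det (1%:M : 'M[A]_n) == 1.
Proof. by rewrite det1. Qed.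

Fact sl_mul_subproof g h : \det (sl_mx g *m sl_mx h) == 1.
Proof. by rewrite det_mulmx (eqP (sl_det g)) (eqP (sl_det h)) mul1r. Qed.

Fact sl_inv_subproof g : \det (invmx (sl_mx g)) == 1.
Proof. by rewrite det_inv (eqP (sl_det g)) invr1. Qed.

Definition sl_one := MkSL sl_one_subproof.
Definition sl_mul g h := MkSL (sl_mul_subproof g h).
Definition sl_inv g := MkSL (sl_inv_subproof g).

Fact sl_unitmx g : sl_mx g \in unitmx.
Proof. by rewrite unitmxE (eqP (sl_det g)) unitr1. Qed.

Fact sl_mulA : associative sl_mul.
Proof. by move=> g h k; apply: val_inj; rewrite /= mulmxA. Qed.

Fact sl_mul1 : left_id sl_one sl_mul.
Proof. by move=> g; apply: val_inj; rewrite /= mul1mx. Qed.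

Fact sl_mulr1 : right_id sl_one sl_mul.
Proof. by move=> g; apply: val_inj; rewrite /= mulmx1. Qed.

Fact sl_mulV : left_inverse sl_one sl_inv sl_mul.
Proof. by move=> g; apply: val_inj; rewrite /= mulVmx ?sl_unitmx. Qed.

Fact sl_mulrV : right_inverse sl_one sl_inv sl_mul.
Proof. by move=> g; apply: val_inj; rewrite /= mulmxV ?sl_unitmx. Qed.

HB.instance Definition _ :=
  isGroup.Build (SL n A) sl_mulA sl_mul1 sl_mulr1 sl_mulV sl_mulrV.

End SLGroup.

Section GLGroup.
Variables (n : nat) (A : comUnitRingType).
Implicit Types g h k : GL n A.

Fact gl_mul_subproof g h : gl_mx g *m gl_mx h \in unitmx.
Proof. by rewrite unitmx_mul !gl_unit. Qed.

Fact gl_inv_subproof g : invmx (gl_mx g) \in unitmx.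
Proof. by rewrite unitmx_inv gl_unit. Qed.

Definition gl_one := MkGL (unitmx1 A n).
Definition gl_mul g h := MkGL (gl_mul_subproof g h).
Definition gl_inv g := MkGL (gl_inv_subproof g).

Fact gl_mulA : associative gl_mul.
Proof. by move=> g h k; apply: val_inj; rewrite /= mulmxA. Qed.

Fact gl_mul1 : left_id gl_one gl_mul.
Proof. by move=> g; apply: val_inj; rewrite /= mul1mx. Qed.

Fact gl_mulr1 : right_id gl_one gl_mul.
Proof. by move=> g; apply: val_inj; rewrite /= mulmx1. Qed.

Fact gl_mulV : left_inverse gl_one gl_inv gl_mul.
Proof. by move=> g; apply: val_inj; rewrite /= mulVmx ?gl_unit. Qed.

Fact gl_mulrV : right_inverse gl_one gl_inv gl_mul.
Proof. by move=> g; apply: val_inj; rewrite /= mulmxV ?gl_unit. Qed.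

HB.instance Definition _ :=
  isGroup.Build (GL n A) gl_mulA gl_mul1 gl_mulr1 gl_mulV gl_mulrV.

End GLGroup.

Fact sl_of_int_subproof (n : nat) (A : comUnitRingType) (g : SL n int) :
  \det (map_mx intr (sl_mx g) : 'M[A]_n) == 1.
Proof. by rewrite det_map_mx (eqP (sl_det g)). Qed.

Definition sl_of_int (n : nat) (A : comUnitRingType) (g : SL n int) : SL n A :=
  MkSL (sl_of_int_subproof A g).

Section Algebraic.
Variables (F : closedFieldType) (n N : nat).

(* SL_n is closed in the affine space of n x n matrices, so its coordinate ring
   consists of the restrictions of polynomials in the matrix entries. *)
Definition sl_regular (f : SL n F -> F) : Prop :=
  exists p : {mpoly F[n * n]}, forall g, f g = p.@[mxvec (sl_mx g) 0].

(* GL_N is the principal open subset where det is nonzero, so its coordinate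
   ring is the localization of the polynomial ring at det. *)
Definition gl_regular (f : GL N F -> F) : Prop :=
  exists (p : {mpoly F[N * N]}) (m : nat),
    forall g, f g = p.@[mxvec (gl_mx g) 0] / \det (gl_mx g) ^+ m.

(* A map of affine varieties, given on points over the algebraically closed
   field F, is a morphism when regular functions pull back to regular ones. *)
Definition is_variety_morphism (rho : SL n F -> GL N F) : Prop :=
  forall f : GL N F -> F, gl_regular f -> sl_regular (f \o rho).

End Algebraic.

Record algebraic_representation (F : closedFieldType) (n N : nat) := AlgRep {
  algrep_hom :> {multiplicative SL n F -> GL N F};
  algrep_morphism : is_variety_morphism algrep_hom
}.

(* Main.v *)
Require Import Defs.
From HB Require Import structures.
From mathcomp Require Import all_boot all_order all_algebra.
From mathcomp Require Import reals complex mpoly.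
From mathcomp Require Import separable cyclotomic zify ring.
From Stdlib Require Import Classical_Prop.

(** Write X_ij(a) = 1 + a e_ij for the elementary matrices ([xe i j a]) and
    X_ij for X_ij(1). Given a representation phi of SL_n(Z) of dimension N, the
    proof builds an algebraic representation [alg] of SL_n, shows that
    sigma(g) = phi(g) alg(g)^-1 is again a representation of SL_n(Z), now with
    sigma(X_ij)^(N!) = 1, and then that a representation of this kind and of
    dimension less than 2^n - 2 is trivial, so that phi is the restriction of
    [alg].

    The algebraic part. The matrix X_ij is the commutator of X_ik and X_kj and
    commutes with both; taking determinants on an eigenspace of phi(X_ij) shows
    that every eigenvalue of phi(X_ij) is an N!-th root of unity
    ([central_commutator_eigenvalue]). Hence phi(X_ij)^(N!) is unipotent and has
    a nilpotent logarithm, which yields nilpotent matrices L_ij such that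
    phi(X_ij(a)) = exp(a L_ij) for all multiples a of N! ([log_family]). An
    identity that is polynomial in a and holds for these a holds identically, so
    the commutation relations of the elementary matrices turn into the brackets
    [L_ij, L_jk] = L_ik and [L_ij, L_kl] = 0 (j <> k, i <> l) of sl_n ([log_bracket],
    [log_comm]); suitable diagonal elements complete them to a representation of
    gl_n, whose brackets with off-diagonal matrix units are given by [lie_extP].

    This Lie algebra representation integrates to a polynomial representation of
    SL_n ([wordrep_polynomial]). Attach to a word of elementary matrices the
    product of the exponentials of its letters. If the letters depend on a
    parameter s, the logarithmic derivative of this product is the image of the
    logarithmic derivative of the product of the word; so if the latter is
    constantly 1, the former does not depend on s ([wordrep_const]). Gaussian
    elimination writes a matrix g as a word whose coefficients are rational
    functions of g, with a denominator q, and joining two words of the same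
    matrix by a path where q is not identically zero shows that the product of
    exponentials is a rational function of g with a power of q as denominator
    ([extends_path]). The denominators that occur generate the unit ideal
    ([radext1]), so the rational function is a polynomial.

    The products phi(X_ij(a)) exp(-a L_ij) commute with all the L_kl, because
    both factors act on the L_kl as X_ij(a) acts on matrices by conjugation.
    Therefore sigma takes its values in the commutant of [alg], and is
    multiplicative ([algebraic_part]).

    The finite part. Let sigma have dimension less than 2^n - 2 and kill all
    X_ij(N!). The commuting matrices sigma(X_jo), for fixed o, have simultaneous
    eigenvectors. If one of the eigenvalues has a square different from 1, then
    conjugation by other elementary matrices produces at least
    3^(n-2) + 3^(n-3) different systems of eigenvalues, which is too many; so
    sigma(X_ij)^2 = 1 ([sg_square]). It follows that sigma(g) depends on g
    modulo 2 only, and sigma comes from a representation of GL_n(F_2)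
    ([reduction]).

    Suppose that it is not trivial. For a nonzero row vector d, the transvections
    1 + l d with d l = 0 form an elementary abelian 2-group, whose characters are
    given by the row vectors a modulo d. The group GL_n(F_2) permutes
    transitively the eigenspaces for the nontrivial characters, and counting
    shows that they are lines. The stabiliser of the pair (d, a) acts trivially
    on its line, because it is generated by commutators ([stab]); this yields a
    family of vectors u(a, b), one in the line of (a + b, a) for each pair of
    distinct nonzero a and b, permuted by GL_n(F_2) ([u_exists]). They satisfy
    u(b, a) = - u(a, b) and, by a weight argument, u(a, b) + u(b, c) = u(a, c)
    ([u_cocycle], [utot_cocycle]): the family looks like the differences
    v_a - v_b in the permutation module on the 2^n - 1 nonzero vectors. Indeed
    the 2^n - 2 vectors u(x, z), with z fixed, are linearly independent
    ([dim_bound]), which contradicts the bound on the dimension. *)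

Set Implicit Arguments.
Unset Strict Implicit.
Unset Printing Implicit Defensive.

Import Order.TTheory GRing.Theory Num.Theory.
Local Open Scope ring_scope.

(** * Elementary matrices and generation of SL_n(Z) and its congruence subgroups *)

Definition xe (A : pzRingType) n (i j : 'I_n) (a : A) : 'M[A]_n :=
  1%:M + a *: delta_mx i j.

Section Elementary.
Variables (A : comNzRingType) (n : nat).
Implicit Types (i j k l : 'I_n) (a b : A).

Lemma mul_xeE p (g : 'M[A]_(p, n)) i j a r c :
  (g *m xe i j a) r c = g r c + (c == j)%:R * (a * g r i).
Proof.
rewrite /xe mulmxDr mulmx1 -scalemxAr !mxE; congr (_ + _).
rewrite (bigD1 i) //= big1 ?addr0 => [|s /negPf si]; last by rewrite !mxE si mulr0.
by rewrite !mxE eqxx /=; case: (c == j); rewrite ?mul0r ?mulr0 // mulr1 mul1r.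
Qed.

Lemma xe_mulE p i j a (g : 'M[A]_(n, p)) r c :
  (xe i j a *m g) r c = g r c + (r == i)%:R * (a * g j c).
Proof.
rewrite /xe mulmxDl mul1mx -scalemxAl !mxE; congr (_ + _).
rewrite (bigD1 j) //= big1 ?addr0 => [|s /negPf si]; last by rewrite !mxE si andbF mul0r.
by rewrite !mxE eqxx andbT; case: (r == i); rewrite ?mul0r ?mulr0 // !mul1r.
Qed.

Lemma xe0 i j : xe i j (0 : A) = 1%:M.
Proof. by rewrite /xe scale0r addr0. Qed.

Lemma xeD i j a b : i != j -> xe i j a *m xe i j b = xe i j (a + b).
Proof.
move=> nij; rewrite /xe mulmxDl mul1mx mulmxDr mulmx1 -scalemxAl -scalemxAr.
by rewrite mul_delta_mx_cond eq_sym (negPf nij) mulr0n !scaler0 addr0 scalerDl addrA addrAC.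
Qed.

Lemma xeK i j a : i != j -> xe i j a *m xe i j (- a) = 1%:M.
Proof. by move=> nij; rewrite xeD // subrr xe0. Qed.

Lemma xeNK i j a : i != j -> xe i j (- a) *m xe i j a = 1%:M.
Proof. by move=> nij; rewrite xeD // addNr xe0. Qed.

Lemma det_xe i j a : i != j -> \det (xe i j a) = 1.
Proof.
move=> nij.
pose C : 'M[A]_n := \matrix_(r, c) if r == i then (c == j)%:R else (r == c)%:R.
rewrite (@determinant_multilinear _ _ _ 1%:M C i 1 a).
- rewrite det1 mulr1 (determinant_alternate nij) ?mulr0 ?addr0 // => c.
  by rewrite !mxE eqxx [j == i]eq_sym (negPf nij) eq_sym.
- by apply/rowP=> c; rewrite !mxE !eqxx mul1r.
- by apply/matrixP=> r c; rewrite !mxE [_ == i]eq_sym (negPf (neq_lift _ _)) mulr0 addr0.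
- by apply/matrixP=> r c; rewrite !mxE [_ == i]eq_sym (negPf (neq_lift _ _)) mulr0 addr0.
Qed.

Lemma xe_comm i j k l a b : j != k -> i != l ->
  xe i j a *m xe k l b = xe k l b *m xe i j a.
Proof.
move=> njk nil; rewrite /xe !mulmxDl !mulmxDr !mulmx1 !mul1mx -!scalemxAl -!scalemxAr.
rewrite !mul_delta_mx_cond (negPf njk) [l == i]eq_sym (negPf nil) !mulr0n !scaler0 !addr0.
by rewrite -!addrA; congr (_ + _); rewrite addrC.
Qed.

Lemma xe_steinberg i j k a b : i != j -> j != k -> i != k ->
  xe i j a *m xe j k b = xe i k (a * b) *m xe j k b *m xe i j a.
Proof.
move=> nij njk nik; have [nji nkj nki] : [/\ j != i, k != j & k != i].
  by rewrite ![_ == i]eq_sym [k == j]eq_sym nij njk nik.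
rewrite /xe !mulmxDl !mulmxDr !mulmx1 !mul1mx -!scalemxAl -!scalemxAr.
rewrite !mulmxDl !mul1mx -!scalemxAl !mul_delta_mx_cond eqxx.
rewrite ?(negPf nij) ?(negPf njk) ?(negPf nik) ?(negPf nji) ?(negPf nkj) ?(negPf nki).
rewrite !mulr1n !mulr0n !scaler0 ?addr0 !scalerA -!addrA; congr (_ + _).
by rewrite mul0mx !(scaler0, addr0).
Qed.

Lemma map_xe (B : comNzRingType) (f : {rmorphism A -> B}) i j a :
  map_mx f (xe i j a) = xe i j (f a).
Proof. by rewrite map_mxD map_mx1 map_mxZ map_delta_mx. Qed.

End Elementary.

Lemma dvd2z_add_odd (x y : int) : ~~ (2 %| x)%Z -> ~~ (2 %| y)%Z -> (2 %| x + y)%Z.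
Proof. lia. Qed.

(** The diagonal matrix with entry -1 at [i] and [j]; it corrects the sign of a pivot in
    situations where only even multiples of some columns may be added. *)
Definition sgm n (i j : 'I_n) : 'M[int]_n :=
  \matrix_(r, c) ((r == c)%:R * (if (r == i) || (r == j) then -1 else 1)).

Section Generation.
Variables (n t : nat) (P : 'M[int]_n -> Prop).
Hypothesis P1 : P 1%:M.
Hypothesis Px : forall g (i j : 'I_n) a, i != j -> (t <= i)%N || (2 %| a)%Z ->
  \det g = 1 -> P g -> P (g *m xe i j a).
Hypothesis Ps : forall g (i j : 'I_n), i != j -> \det g = 1 -> P g -> P (g *m sgm i j).

Lemma mul_sgmE p (g : 'M[int]_(p,n)) i j r c :
  (g *m sgm i j) r c = g r c * (if (c == i) || (c == j) then -1 else 1).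
Proof.
rewrite !mxE (bigD1 c) //= big1 ?addr0 => [|s /negPf si]; rewrite !mxE ?eqxx ?mul1r //.
by rewrite si mul0r mulr0.
Qed.

Lemma sgmK (i j : 'I_n) : sgm i j *m sgm i j = 1%:M.
Proof.
apply/matrixP=> r c; rewrite mul_sgmE !mxE; case: eqP => [->|_]; last by rewrite !mul0r.
by rewrite mul1r; case: ifP.
Qed.

Lemma det_sgm (i j : 'I_n) : i != j -> \det (sgm i j) = 1.
Proof.
move=> nij.
have -> : sgm i j = diag_mx (\row_c (if (c == i) || (c == j) then -1 else 1)).
  by apply/matrixP=> r c; rewrite !mxE mulr_natl mulrb; case: eqP=> // ->.
rewrite det_diag (bigD1 i) //= (bigD1 j) 1?eq_sym //= big1.
  by rewrite !mxE !eqxx ?orbT.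
by move=> s /andP[/negPf si /negPf sj]; rewrite !mxE si sj.
Qed.

(** The state of the row-by-row reduction of a matrix whose first [t] rows are congruent to
    those of the identity modulo 2: the rows before [k] are already standard. *)
Definition reduced_upto (k : nat) (g : 'M[int]_n) := [/\ \det g = 1,
  forall r c : 'I_n, (r < k)%N -> g r c = (r == c)%:R &
  forall r c : 'I_n, (r < t)%N -> (2 %| g r c - (r == c)%:R)%Z].

Lemma reduced_xe k g (i j : 'I_n) a : i != j -> (k <= i)%N ->
  (t <= i)%N || (2 %| a)%Z -> reduced_upto k g -> reduced_upto k (g *m xe i j a).
Proof.
move=> nij ki ok [d r1 r2]; split.
- by rewrite det_mulmx det_xe // d mulr1.
- move=> r c rk; rewrite mul_xeE !r1 // (_ : (r == i) = false); first by rewrite !mulr0 addr0.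
  by apply/eqP=> E; move: ki rk; rewrite E; lia.
- move=> r c rt; rewrite mul_xeE addrAC rpredD ?r2 //.
  apply: dvdz_mull; case/orP: ok => [ti|da]; last exact: dvdz_mulr.
  apply: dvdz_mull; have := r2 r i rt; rewrite (_ : (r == i) = false) ?subr0 //.
  by apply/eqP=> E; move: ti rt; rewrite E; lia.
Qed.

(** Since [xe i j (- a)] is an allowed step too, the target property may be proved after a
    column operation. *)
Lemma pull_xe g (i j : 'I_n) a : i != j -> (t <= i)%N || (2 %| a)%Z -> \det g = 1 ->
  P (g *m xe i j a) -> P g.
Proof.
move=> nij ok d Pg; have := @Px _ i j (- a) nij _ _ Pg.
rewrite -mulmxA xeK // mulmx1; apply; last by rewrite det_mulmx det_xe // mulr1.
by rewrite rpredN.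
Qed.

(** The entries of the row [kk] from column [k] on generate the unit ideal: expand
    g adj(g) = 1 and use that the rows before [k] are standard. *)
Lemma reduced_sum k g (kk : 'I_n) : reduced_upto k g -> kk = k :> nat ->
  exists h : 'I_n -> int, \sum_(j : 'I_n | (k <= j)%N) g kk j * h j = 1.
Proof.
move=> [d r1 _] kkE; exists (fun j => \adj g j kk).
have : (g *m \adj g) kk kk = 1 by rewrite mul_mx_adj d !mxE eqxx.
rewrite mxE (bigID (fun j : 'I_n => (k <= j)%N)) /= [X in _ + X]big1 ?addr0 // => j jk.
have jltk : (j < k)%N by rewrite ltnNge.
have njk : (j == kk) = false by apply/eqP=> E; move: jltk; rewrite E kkE ltnn.
have : (g *m \adj g) j kk = 0 by rewrite mul_mx_adj d !mxE njk.
rewrite mxE (bigD1 j) //= big1 => [|s /negPf sj]; last by rewrite r1 // eq_sym sj mul0r.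
by rewrite r1 // eqxx mul1r addr0 => ->; rewrite mulr0.
Qed.

Lemma reduced_sgm k g (i j : 'I_n) : i != j -> (k <= i)%N -> (k <= j)%N ->
  reduced_upto k g -> reduced_upto k (g *m sgm i j).
Proof.
move=> nij ki kj [d r1 r2]; split.
- by rewrite det_mulmx det_sgm // d mulr1.
- move=> r c rk; rewrite mul_sgmE !r1 //; case: eqP => [<-|_]; last by rewrite mul0r.
  case: ifP; rewrite ?mulr1 // => /orP[]/eqP E; move: rk; rewrite E; lia.
- move=> r c rt; rewrite mul_sgmE; have := r2 r c rt; case: ifP => _; rewrite ?mulr1 //; lia.
Qed.

Section Step.
Variables (k : nat) (kk : 'I_n).
Hypothesis kkE : kk = k :> nat.
Hypothesis IH : forall g, reduced_upto k.+1 g -> P g.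

(** With a pivot equal to 1 and zeros on its right, the entries on its left are removed one
    by one. In a constrained row these entries are even, so that the steps are allowed. *)
Lemma clear_left g : reduced_upto k g -> g kk kk = 1 ->
  (forall j : 'I_n, (k < j)%N -> g kk j = 0) -> P g.
Proof.
have [m] := ubnP #|[set j : 'I_n | (j < k)%N && (g kk j != 0)]|.
elim: m g => // m IHm g lem Rg g1 g0.
case: (set_0Vmem [set j : 'I_n | (j < k)%N && (g kk j != 0)]) => [E|[j]].
  apply: IH; case: Rg => d r1 r2; split=> // r c; rewrite ltnS leq_eqVlt => /orP[/eqP rk|]; last exact: r1.
  have -> : r = kk by apply/val_inj; rewrite /= rk kkE.
  have [<-|nkc] := eqVneq kk c; first exact: g1.
  case: (ltngtP c k) => ck; last 1 first.
  - by case/eqP: nkc; apply/val_inj; rewrite /= kkE ck.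
  - by move/setP/(_ c): E; rewrite !inE ck /= => /negbFE/eqP.
  - exact: g0.
rewrite inE => /andP[jk gj].
have nkj : kk != j by apply/eqP=> E; move: jk; rewrite -E kkE ltnn.
have ok : (t <= kk)%N || (2 %| - g kk j)%Z.
  case: leqP => //= kt; rewrite rpredN; case: Rg => _ _ /(_ kk j kt).
  by rewrite (negPf nkj) subr0.
have R' := reduced_xe nkj (eq_leq (esym kkE)) ok Rg.
case: (Rg) => d _ _; apply: (pull_xe nkj ok d); apply: IHm R' _ _.
- rewrite ltnS in lem; apply: leq_trans lem; apply: proper_card.
  apply/properP; split; last first.
    by exists j; rewrite inE jk //= mul_xeE eqxx g1 mulr1 mul1r subrr eqxx.
  apply/subsetP=> c; rewrite !inE mul_xeE; case: (c =P j) => [->|_]; first by rewrite jk gj.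
  by rewrite mul0r addr0.
- by rewrite mul_xeE (negPf nkj) mul0r addr0.
- move=> c kc; rewrite mul_xeE (g0 c) // (_ : (c == j) = false) ?mul0r ?addr0 //.
  by apply/eqP=> E; move: jk kc; rewrite E; lia.
Qed.

(** A single nonzero entry among the last ones must be 1 or -1. The sign can be moved to a
    later column, unless the row is the last one, where the determinant forces the sign. *)
Lemma fix_sign g : reduced_upto k g ->
  (forall j : 'I_n, (k < j)%N -> g kk j = 0) -> P g.
Proof.
move=> Rg g0; have [h] := reduced_sum Rg kkE.
rewrite (bigD1 kk) /= ?kkE // big1 => [|j /andP[kj jk]]; last first.
  rewrite g0 ?mul0r // ltn_neqAle kj andbT; apply: contraNneq jk => E.
  by apply/eqP/val_inj; rewrite /= kkE E.
rewrite addr0 => gh.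
have [g1|g1] : g kk kk = 1 \/ g kk kk = -1.
  have /eqP : (`|g kk kk| * `|h kk|)%N = 1%N by lia.
  rewrite muln_eq1 => /andP[/eqP ? _]; lia.
  exact: clear_left.
have [lt|] := ltnP k.+1 n.
  pose j := Ordinal lt.
  have nkj : kk != j by apply/eqP=> /(congr1 val) /=; rewrite kkE; lia.
  have R' : reduced_upto k (g *m sgm kk j) by apply: reduced_sgm => //=; lia.
  have Pg' : P (g *m sgm kk j).
    apply: clear_left => // [|c kc]; rewrite mul_sgmE ?eqxx ?g1 //.
    by rewrite g0 // mul0r.
  have [d' _ _] := R'.
  by have := Ps nkj d' Pg'; rewrite -mulmxA sgmK mulmx1.
move=> nk; have nE : n = k.+1 by have := ltn_ord kk; lia.
(* in the last row the determinant is the pivot *)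
have [d r1 _] := Rg; move: d; rewrite det_trig.
  rewrite (bigD1 kk) //= big1 => [|j jk]; first by rewrite g1.
  rewrite r1 ?eqxx //; have := ltn_ord j; move/eqP: jk => jk.
  have : j <> k :> nat by move=> E; apply: jk; apply/val_inj; rewrite /= kkE.
  lia.
apply/is_trig_mxP=> i j ij; rewrite r1; last by have := ltn_ord j; lia.
by rewrite (_ : (i == j) = false) //; apply/eqP=> E; move: ij; rewrite E ltnn.
Qed.

(** Termination measure of the Euclidean algorithm on the row [kk]. *)
Definition absum (g : 'M[int]_n) := (\sum_(j : 'I_n | (k <= j)%N) `|g kk j|)%N.

Lemma absum_xe (g : 'M[int]_n) (i j : 'I_n) a : (k <= j)%N ->
  (`|(g kk j + a * g kk i)%R| < `|g kk j|)%N -> (absum (g *m xe i j a) < absum g)%N.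
Proof.
move=> kj lt; rewrite /absum (bigD1 j) // [X in (_ < X)%N](bigD1 j) //=.
rewrite mul_xeE eqxx mul1r.
set S := (X in (_ + X < _)%N); set S' := (X in (_ < _ + X)%N).
suff -> : S = S' by rewrite ltn_add2r.
by apply: eq_bigr => c /andP[_ /negPf cj]; rewrite mul_xeE cj mul0r addr0.
Qed.

(** The Euclidean algorithm with even quotients only. An odd pivot and an even entry have
    different absolute values, and adding or subtracting twice the smaller one decreases the
    larger one; parities are preserved, so the process ends with zeros next to the pivot. *)
Lemma euclid g : reduced_upto k g -> ~~ (2 %| g kk kk)%Z ->
  (forall j : 'I_n, (k < j)%N -> (2 %| g kk j)%Z) -> P g.
Proof.
have [m] := ubnP (absum g); elim: m g => // m IHm g lem Rg od ev.
case: (pickP (fun j : 'I_n => (k < j)%N && (g kk j != 0))) => [j /andP[kj gj]|all0]; last first.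
  by apply: fix_sign => // j kj; have := all0 j; rewrite kj /= => /negbFE/eqP.
have nkj : kk != j by apply/eqP=> E; move: kj; rewrite -E kkE ltnn.
have njk : j != kk by rewrite eq_sym.
have [d _ _] := Rg; have evj := ev j kj.
(* parities differ, so one of the two entries strictly dominates the other *)
have [lt|le] := ltnP `|g kk j| `|g kk kk|.
  have [a [da la]] : exists a : int, (2 %| a)%Z /\ (`|(g kk kk + a * g kk j)%R| < `|g kk kk|)%N.
    case: (leP 0 (g kk kk * g kk j)) => sg; [exists (-2)|exists 2]; split=> //; nia.
  have ok : (t <= j)%N || (2 %| a)%Z by rewrite da orbT.
  apply: (pull_xe njk ok d); apply: IHm.
  - by rewrite ltnS in lem; apply: leq_trans lem; apply: absum_xe la; rewrite kkE.
  - by apply: reduced_xe => //; lia.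
  - by rewrite mul_xeE eqxx mul1r rpredDr ?dvdz_mulr.
  - move=> c kc; rewrite mul_xeE (_ : (c == kk) = false) ?mul0r ?addr0 ?ev //.
    by apply/eqP=> E; move: kc; rewrite E kkE ltnn.
have [a [da la]] : exists a : int, (2 %| a)%Z /\ (`|(g kk j + a * g kk kk)%R| < `|g kk j|)%N.
  case: (leP 0 (g kk kk * g kk j)) => sg; [exists (-2)|exists 2]; split=> //; nia.
have ok : (t <= kk)%N || (2 %| a)%Z by rewrite da orbT.
apply: (pull_xe nkj ok d); apply: IHm.
- by rewrite ltnS in lem; apply: leq_trans lem; apply: absum_xe la; lia.
- by apply: reduced_xe => //; lia.
- by rewrite mul_xeE (negPf nkj) mul0r addr0.
- by move=> c kc; rewrite mul_xeE rpredD ?ev //; rewrite dvdz_mull ?dvdz_mulr.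
Qed.

(** Adding once an odd pivot makes an odd entry even. This step is allowed: an odd entry
    outside the diagonal can only occur in a row without congruence condition. *)
Lemma make_even g : reduced_upto k g -> ~~ (2 %| g kk kk)%Z -> P g.
Proof.
have [m] := ubnP #|[set j : 'I_n | (k < j)%N && ~~ (2 %| g kk j)%Z]|.
elim: m g => // m IHm g lem Rg od.
case: (set_0Vmem [set j : 'I_n | (k < j)%N && ~~ (2 %| g kk j)%Z]) => [E|[j]].
  apply: euclid => // j kj; move/setP/(_ j): E; rewrite !inE kj /=.
  by move/negbFE.
rewrite inE => /andP[kj oj].
have nkj : kk != j by apply/eqP=> E; move: kj; rewrite -E kkE ltnn.
have ok : (t <= kk)%N || (2 %| 1)%Z.
  case: leqP => //= kt; case: Rg => _ _ /(_ kk j kt).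
  by rewrite (negPf nkj) subr0 (negPf oj).
case: (Rg) => d _ _; apply: (pull_xe nkj ok d); apply: IHm.
- rewrite ltnS in lem; apply: leq_trans lem; apply: proper_card; apply/properP; split; last first.
    by exists j; rewrite !inE kj //= mul_xeE eqxx !mul1r negbK dvd2z_add_odd.
  apply/subsetP=> c; rewrite !inE mul_xeE; case: (c =P j) => [->|_]; first by rewrite kj oj.
  by rewrite mul0r addr0.
- by apply: reduced_xe => //; lia.
- by rewrite mul_xeE (negPf nkj) mul0r addr0.
Qed.

(** In a row with even pivot some other entry is odd, as the entries generate the unit ideal;
    such a row has no congruence condition, and adding the odd entry makes the pivot odd. *)
Lemma reduce_row g : reduced_upto k g -> P g.
Proof.
move=> Rg; case: (boolP (2 %| g kk kk)%Z) => [ev|]; last exact: make_even.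
have kt : (t <= kk)%N.
  case: leqP => //= kt; case: Rg => _ _ /(_ kk kk kt); rewrite eqxx /=; lia.
case: (pickP (fun j : 'I_n => (k <= j)%N && ~~ (2 %| g kk j)%Z)) => [j /andP[kj oj]|all0].
  have njk : j != kk by apply: contraNneq oj => ->.
  have ok : (t <= j)%N || (2 %| 1)%Z by rewrite (leq_trans kt) // kkE.
  case: (Rg) => d _ _; apply: (pull_xe njk ok d); apply: make_even.
    exact: reduced_xe.
  by rewrite mul_xeE eqxx !mul1r rpredDl.
have [h] := reduced_sum Rg kkE => sum1.
have : (2 %| \sum_(j : 'I_n | (k <= j)%N) g kk j * h j)%Z.
  apply: (big_ind (fun x : int => (2 %| x)%Z)) => [//|x y|j kj]; first exact: rpredD.
  by apply: dvdz_mulr; have := all0 j; rewrite kj => /negbFE.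
by rewrite sum1.
Qed.
End Step.

(** Generators of the group of integer matrices of determinant 1 whose first [t] rows are those
    of the identity modulo 2. The extreme cases are SL_n(Z) and the congruence subgroup of
    level 2; the case of two rows is needed for the stabiliser of two vectors over F_2. *)
Lemma sl_int_ind g : \det g = 1 ->
  (forall r c : 'I_n, (r < t)%N -> (2 %| g r c - (r == c)%:R)%Z) -> P g.
Proof.
move=> d ev; have : reduced_upto 0 g by [].
suff: forall k, (k <= n)%N -> forall g', reduced_upto (n - k) g' -> P g'.
  by move/(_ n (leqnn n)); rewrite subnn; apply.
elim=> [_ g' [_ r1 _]|k IHk kn g' Rg].
  suff -> : g' = 1%:M by [].
  by apply/matrixP=> r c; rewrite r1 ?mxE // subn0.
have lt : (n - k.+1 < n)%N by lia.
apply: (@reduce_row _ (Ordinal lt)) Rg => // g''.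
by rewrite -subSn // subSS; apply: IHk; lia.
Qed.
End Generation.

(** The square of a rotation by a quarter turn in the plane of [i] and [j]. *)
Lemma sgm_word n (i j : 'I_n) : i != j ->
  let w := xe i j 1 *m xe j i (-1) *m xe i j 1 : 'M[int]_n in sgm i j = w *m w.
Proof.
move=> nij w; rewrite -[LHS]mul1mx -[RHS]mul1mx; apply/matrixP=> r c; rewrite mul_sgmE.
have nji : j != i by rewrite eq_sym.
rewrite /w !mulmxA !mul_xeE !eqxx (negPf nij) (negPf nji) !mxE.
have [->|nci] := eqVneq c i; first by rewrite ?eqxx (negPf nij) /=; ring.
have [->|ncj] := eqVneq c j; first by rewrite ?eqxx /=; ring.
by rewrite /=; ring.
Qed.

Lemma sl_int_gen n (P : 'M[int]_n -> Prop) : P 1%:M ->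
  (forall g (i j : 'I_n) a, i != j -> \det g = 1 -> P g -> P (g *m xe i j a)) ->
  forall g, \det g = 1 -> P g.
Proof.
move=> P1 Px g dg; apply: (@sl_int_ind n 0 P P1 _ _ g dg) => // [h i j a nij _|h i j nij].
  exact: Px.
have nji : j != i by rewrite eq_sym.
by move=> dh Ph; rewrite sgm_word // !mulmxA; do 6!(apply: (Px); rewrite ?det_mulmx ?det_xe ?dh ?mulr1 //).
Qed.

(** * The derivative of rational functions *)

(** The derivative of a fraction does not depend on the representative: a', d', p', q' stand for
    the derivatives of a, d, p, q, and the second hypothesis is the derivative of the first one. *)
Lemma quotient_rule_wd (R : comPzRingType) (a d a' d' p q p' q' : R) :
  a * q = p * d -> a' * q + a * q' = p' * d + p * d' ->
  (a' * d - a * d') * q ^+ 2 = (p' * q - p * q') * d ^+ 2.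
Proof.
move=> E E'; apply/eqP; rewrite -subr_eq0; apply/eqP.
transitivity (d * q * ((a' * q + a * q') - (p' * d + p * d')) - (a * q - p * d) * (q * d' + d * q')).
  by ring.
by rewrite E E' !subrr mul0r mulr0 subr0.
Qed.

Lemma quotient_ruleD (L : fieldType) (a b c d a' b' c' d' : L) : c != 0 -> d != 0 ->
  ((a' * d + a * d' + (b' * c + b * c')) * (c * d) - (a * d + b * c) * (c' * d + c * d'))
    / (c * d) ^+ 2 = (a' * c - a * c') / c ^+ 2 + (b' * d - b * d') / d ^+ 2.
Proof. by move=> c0 d0; field; rewrite c0 d0. Qed.

Lemma quotient_ruleM (L : fieldType) (a b c d a' b' c' d' : L) : c != 0 -> d != 0 ->
  ((a' * b + a * b') * (c * d) - (a * b) * (c' * d + c * d'))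
    / (c * d) ^+ 2 = (a' * c - a * c') / c ^+ 2 * (b / d) + a / c * ((b' * d - b * d') / d ^+ 2).
Proof. by move=> c0 d0; field; rewrite c0 d0. Qed.

Section FracDeriv.
Variable F : numFieldType.
Local Notation K := {fraction {poly F}}.
Local Notation "x %:F" := (@FracField.tofrac {poly F} x).

Definition fnum (x : K) : {poly F} := (repr x).1.
Definition fden (x : K) : {poly F} := (repr x).2.

Lemma fden_neq0 x : fden x != 0. Proof. exact: denom_ratioP. Qed.

Lemma fracE x : x = (fnum x)%:F / (fden x)%:F.
Proof.
apply: (canRL (mulfK _)); first by rewrite tofrac_eq0 fden_neq0.
rewrite /fnum /fden; unlock FracField.tofrac; rewrite -[X in X * _]reprK.
rewrite -[LHS]FracField.pi_mul; apply/eqmodP; rewrite /= FracField.equivfE /FracField.mulf.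
rewrite !numden_Ratio ?mulf_neq0 ?oner_neq0 ?denom_ratioP //.
by rewrite !mulr1 mulrC.
Qed.

Definition fderiv (x : K) : K :=
  (((fnum x)^`() * fden x - fnum x * (fden x)^`())%R)%:F / ((fden x)%:F ^+ 2).

Lemma fderiv_div p q : q != 0 -> fderiv (p%:F / q%:F) = (p^`() * q - p * q^`())%:F / (q%:F ^+ 2).
Proof.
move=> q0; set x := p%:F / q%:F; have d0 := fden_neq0 x.
have E : fnum x * q = p * fden x.
  apply/eqP; rewrite -(tofrac_eq (_ * _)) !tofracM -eqr_div ?tofrac_eq0 //.
  by rewrite -fracE.
have E' : (fnum x)^`() * q + fnum x * q^`() = p^`() * fden x + p * (fden x)^`().
  by rewrite -!derivM E.
apply/eqP; rewrite /fderiv eqr_div ?expf_neq0 ?tofrac_eq0 // -!tofracXn -!tofracM tofrac_eq.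
apply/eqP; exact: quotient_rule_wd.
Qed.

Lemma fderiv_tofrac p : fderiv p%:F = p^`()%:F.
Proof.
rewrite -[p%:F]divr1 -tofrac1 fderiv_div ?oner_neq0 //.
by rewrite derivC mulr0 subr0 mulr1 tofrac1 expr1n divr1.
Qed.

Lemma fderivD : {morph fderiv : x y / x + y}.
Proof.
move=> x y; rewrite (fracE x) (fracE y).
have [dx dy] := (fden_neq0 x, fden_neq0 y).
move: (fnum x) (fnum y) (fden x) (fden y) dx dy => a b c d c0 d0.
have [C0 D0] : c%:F != 0 /\ d%:F != 0 by rewrite !tofrac_eq0.
have cd0 : c * d != 0 by exact: mulf_neq0.
rewrite (addf_div _ _ C0 D0) -!tofracM -tofracD.
rewrite (fderiv_div _ cd0) (fderiv_div _ c0) (fderiv_div _ d0).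
rewrite !derivD !derivM !(tofracB, tofracD, tofracM).
exact: (@quotient_ruleD K a%:F b%:F c%:F d%:F _ _ _ _ C0 D0).
Qed.

Lemma fderivM x y : fderiv (x * y) = fderiv x * y + x * fderiv y.
Proof.
rewrite (fracE x) (fracE y).
have [dx dy] := (fden_neq0 x, fden_neq0 y).
move: (fnum x) (fnum y) (fden x) (fden y) dx dy => a b c d c0 d0.
have [C0 D0] : c%:F != 0 /\ d%:F != 0 by rewrite !tofrac_eq0.
have cd0 : c * d != 0 by exact: mulf_neq0.
rewrite mulf_div -!tofracM (fderiv_div _ cd0) (fderiv_div _ c0) (fderiv_div _ d0).
rewrite !derivM !(tofracB, tofracD, tofracM).
exact: (@quotient_ruleM K a%:F b%:F c%:F d%:F _ _ _ _ C0 D0).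
Qed.

Lemma fderiv_is_zmod_morphism : zmod_morphism fderiv.
Proof.
move=> x y; have := fderivD (x - y) y; rewrite subrK => ->.
by rewrite addrK.
Qed.

HB.instance Definition _ := GRing.isZmodMorphism.Build K K fderiv fderiv_is_zmod_morphism.

Lemma deriv_eq0_const (p : {poly F}) : p^`() = 0 -> p = (p`_0)%:P.
Proof.
move=> dp; apply/polyP => -[|i]; rewrite coefC //=.
by have /eqP := coef_deriv p i; rewrite dp coef0 eq_sym mulrn_eq0 => /orP[//|/eqP].
Qed.

(** In lowest terms p / q, a vanishing derivative means p' q = p q'; then q divides q', whose
    degree is smaller, so q' = 0 and p' = 0, and in characteristic zero p and q are constant. *)
Lemma fderiv_eq0 x : fderiv x = 0 -> exists c : F, x = (c%:P)%:F.
Proof.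
pose g := gcdp (fnum x) (fden x).
have d0 := fden_neq0 x; have g0 : g != 0 by rewrite gcdp_eq0 negb_and d0 orbT.
pose p := fnum x %/ g; pose q := fden x %/ g.
have [Ep Eq] : fnum x = p * g /\ fden x = q * g by rewrite !divpK ?dvdp_gcdl ?dvdp_gcdr.
have q0 : q != 0 by apply: contraNneq d0 => q0; rewrite Eq q0 mul0r.
have cop : coprimep q p.
  by rewrite coprimep_sym; apply: coprimep_div_gcd; rewrite d0 orbT.
have -> : x = p%:F / q%:F.
  by rewrite (fracE x) Ep Eq !tofracM -mulf_div divff ?mulr1 // tofrac_eq0.
rewrite (fderiv_div _ q0) => /eqP; rewrite mulf_eq0 invr_eq0 expf_eq0 /= !tofrac_eq0 (negPf q0) orbF.
rewrite subr_eq0 => /eqP E.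
have q'0 : q^`() = 0.
  have : q %| q^`() by rewrite -(Gauss_dvdpr _ cop) -E dvdp_mulIr.
  by move=> dv; apply/eqP/negPn/negP => n0; have := dvdp_leq n0 dv; rewrite leqNgt lt_size_deriv.
have p'0 : p^`() = 0.
  by apply/eqP; move: E; rewrite q'0 mulr0 => /eqP; rewrite mulf_eq0 (negPf q0) orbF.
have [-> ->] := (deriv_eq0_const p'0, deriv_eq0_const q'0).
have c0 : q`_0 != 0 by rewrite -polyC_eq0 -(deriv_eq0_const q'0).
exists (p`_0 / q`_0); apply: (canLR (mulfK _)); first by rewrite tofrac_eq0 polyC_eq0.
by rewrite -tofracM -polyCM divfK.
Qed.
End FracDeriv.

(** * Exponentials of nilpotent matrices *)

Section TruncExp.
Variables (F : numFieldType) (N' : nat).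
Local Notation N := N'.+1.

Definition dpow (T : 'M[F]_N) k : 'M[F]_N := (k`!%:R^-1) *: T ^+ k.

Lemma dpow0 T : dpow T 0 = 1.
Proof. by rewrite /dpow invr1 scale1r expr0. Qed.

Lemma factS_neq0 k : k`!%:R != 0 :> F.
Proof. by rewrite pnatr_eq0 -lt0n fact_gt0. Qed.

Lemma dpowS T k : T * dpow T k = dpow T k.+1 *+ k.+1.
Proof.
rewrite /dpow -scalerAr -exprS -scaler_nat scalerA; congr (_ *: _).
by rewrite factS natrM invfM mulrA divff ?mul1r // pnatr_eq0.
Qed.

Lemma dpowSr T k : dpow T k * T = dpow T k.+1 *+ k.+1.
Proof. by rewrite -dpowS /dpow -scalerAl -scalerAr -exprS -exprSr. Qed.

Lemma dpow_nil T m k : T ^+ m = 0 -> (m <= k)%N -> dpow T k = 0.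
Proof. by move=> Tm mk; rewrite /dpow -(subnK mk) exprD Tm mulr0 scaler0. Qed.

Lemma dpowM T i j : dpow T i * dpow T j = dpow T (i + j) *+ 'C(i + j, i).
Proof.
rewrite /dpow -scalerAl -scalerAr -exprD scalerA -scaler_nat scalerA; congr (_ *: _).
rewrite -(@bin_fact (i + j) i) ?leq_addr // addKn !natrM.
by rewrite !invfM [RHS]mulrA divff ?mul1r // pnatr_eq0 -lt0n bin_gt0 leq_addr.
Qed.

Variables (A : comNzRingType) (io : {rmorphism F -> A}).
Local Notation "M ^io" := (map_mx io M) (at level 2, format "M ^io").

(** The sum stops at [m], which is harmless when [T ^+ m = 0]. The parameter [r] lives in an
    arbitrary algebra over the field, so that one lemma serves for numbers, polynomials and
    rational functions. *)
Definition texp m (T : 'M[F]_N) (r : A) : 'M[A]_N := \sum_(k < m) r ^+ k *: (dpow T k)^io.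

(** Freedom in the truncation order allows one to shift the summation index when two
    exponential sums are compared term by term. *)
Lemma texp_widen m m' T r : T ^+ m = 0 -> (m <= m')%N -> texp m' T r = texp m T r.
Proof.
move=> Tm /subnK <-; rewrite addnC /texp big_split_ord /= [X in _ + X]big1 ?addr0 // => k _.
by rewrite (dpow_nil Tm) ?leq_addr // map_mx0 scaler0.
Qed.

Lemma texp0 m T : T ^+ m = 0 -> texp m T 0 = 1.
Proof.
move=> Tm; rewrite -(texp_widen _ Tm (leqnSn m)) /texp big_ord_recl expr0 scale1r dpow0 map_mx1 big1 ?addr0 //.
by move=> k _; rewrite expr0n scale0r.
Qed.

(** The product of the two sums contains more terms than the truncated sum, but those with
    i + j >= m vanish because T^m = 0. *)
Lemma texpD m T r s : T ^+ m = 0 -> texp m T (r + s) = texp m T r *m texp m T s.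
Proof.
move=> Tm.
pose c k := \sum_(i < k.+1) r ^+ i * s ^+ (k - i) *: ((dpow T i)^io *m (dpow T (k - i))^io).
have E k : (r + s) ^+ k *: (dpow T k)^io = c k.
  rewrite addrC exprDn scaler_suml; apply: eq_bigr => i _.
  rewrite -map_mxM -[_ *m _]/(_ * _) dpowM subnKC -1?ltnS // raddfMn /= -scalerMnl scalerMnr.
  by congr (_ *: _); rewrite mulrC.
rewrite /texp (eq_bigr (fun k : 'I_m => c k)) // mulmx_suml.
pose f i j := r ^+ i * s ^+ j *: ((dpow T i)^io *m (dpow T j)^io).
have f0 i j : (m <= i + j)%N -> f i j = 0.
  by move=> mij; rewrite /f -map_mxM -[_ *m _]/(_ * _) dpowM (dpow_nil Tm mij) mul0rn map_mx0 scaler0.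
transitivity (\sum_(i < m) \sum_(j < m) f i j); last first.
  apply: eq_bigr => i _; rewrite mulmx_sumr; apply: eq_bigr => j _.
  by rewrite -scalemxAl -scalemxAr scalerA.
transitivity (\sum_(k < m) \sum_(i < m | (i <= k)%N) f i (k - i)%N).
  apply: eq_bigr => k _; rewrite /c.
  rewrite (big_ord_widen m (fun i => f i (k - i)%N)) //.
rewrite (exchange_big_dep xpredT) //=; apply: eq_bigr => i _.
have im : (i <= m)%N by apply: ltnW.
rewrite -(big_mkord (fun k => (i <= k)%N) (fun k => f i (k - i)%N)).
rewrite -(big_mkord xpredT (fun j => f i j)).
rewrite (big_cat_nat (leq0n i) im) //= big_nat_cond big_pred0 ?add0r => [|k]; last first.
  by apply/negP=> /andP[/andP[_ ki] ik]; move: (leq_trans ki ik); rewrite ltnn.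
rewrite -{1}[i : nat]add0n big_addn [RHS](big_cat_nat (leq0n _) (leq_subr i m)) //=.
rewrite [X in _ = _ + X]big_nat_cond [X in _ = _ + X]big1 ?addr0 => [|j]; last first.
  by rewrite andbT => /andP[ij _]; apply: f0; lia.
by apply: eq_big => [j|j _]; rewrite ?leq_addl ?addnK.
Qed.

Lemma texpK m T r : T ^+ m = 0 -> texp m T r *m texp m T (- r) = 1%:M.
Proof. by move=> Tm; rewrite -texpD // subrr texp0. Qed.

End TruncExp.

Section TruncExpMap.
Variables (F : numFieldType) (N' : nat) (A B : comNzRingType).
Variables (ia : {rmorphism F -> A}) (ib : {rmorphism F -> B}) (h : {rmorphism A -> B}).
Hypothesis hE : forall x, h (ia x) = ib x.

Lemma map_io p q (M : 'M[F]_(p, q)) : map_mx h (map_mx ia M) = map_mx ib M.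
Proof. by apply/matrixP=> i j; rewrite !mxE hE. Qed.

Lemma map_texp m (T : 'M[F]_N'.+1) r : map_mx h (texp ia m T r) = texp ib m T (h r).
Proof.
rewrite raddf_sum; apply: eq_bigr => k _.
by rewrite /= map_mxZ map_io rmorphXn.
Qed.
End TruncExpMap.

Section DerivMx.
Variables (F : numFieldType) (K : comNzRingType) (io : {rmorphism F -> K}) (d : {additive K -> K}).
Hypothesis dM : forall x y, d (x * y) = d x * y + x * d y.
Hypothesis dC : forall c, d (io c) = 0.
Local Notation "M ^io" := (map_mx io M) (at level 2, format "M ^io").

Lemma map_d_mul p q s (X : 'M[K]_(p, q)) (Y : 'M[K]_(q, s)) :
  map_mx d (X *m Y) = map_mx d X *m Y + X *m map_mx d Y.
Proof.
apply/matrixP=> i j; rewrite !mxE raddf_sum -big_split; apply: eq_bigr => k _.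
by rewrite dM !mxE.
Qed.

Lemma map_d_scale p q a (X : 'M[K]_(p, q)) : map_mx d (a *: X) = d a *: X + a *: map_mx d X.
Proof. by apply/matrixP=> i j; rewrite !mxE dM. Qed.

Lemma map_d_io p q (X : 'M[F]_(p, q)) : map_mx d X^io = 0.
Proof. by apply/matrixP=> i j; rewrite !mxE dC. Qed.

Lemma map_d_delta p q (i : 'I_p) (j : 'I_q) : map_mx d (delta_mx i j) = 0.
Proof. by rewrite -(map_delta_mx io) map_d_io. Qed.

Lemma map_d_1 p : map_mx d (1%:M : 'M[K]_p) = 0.
Proof. by rewrite -(map_mx1 io) map_d_io. Qed.

Lemma dX r k : d (r ^+ k.+1) = (r ^+ k * d r) *+ k.+1.
Proof.
elim: k => [|k IH]; first by rewrite expr0 mul1r expr1.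
by rewrite exprS dM IH mulrnAr mulrA -exprS [d r * _]mulrC -mulrS.
Qed.

Lemma map_d_texp m N' (T : 'M[F]_N'.+1) r : T ^+ m = 0 ->
  map_mx d (texp io m T r) = d r *: (T^io *m texp io m T r).
Proof.
move=> tm.
rewrite -{1}(texp_widen io r tm (leqnSn m)) /texp raddf_sum big_ord_recl /=.
rewrite expr0 scale1r map_d_io add0r mulmx_sumr scaler_sumr; apply: eq_bigr => k _.
rewrite map_d_scale map_d_io scaler0 addr0 dX.
rewrite -scalemxAr scalerA [d r * _]mulrC -scalerMnl scalerMnr; congr (_ *: _).
by rewrite -raddfMn -map_mxM /= -dpowS.
Qed.
End DerivMx.

(** * Words of elementary matrices and their representatives *)

Section LieRep.
Variables (F : numFieldType) (n N' m : nat).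
Local Notation N := N'.+1.
Variable (T : 'I_n -> 'I_n -> 'M[F]_N).

Section Coef.
Variables (A : comNzRingType) (io : {rmorphism F -> A}).
Local Notation "M ^io" := (map_mx io M) (at level 2, format "M ^io").

(** The linear map that sends the matrix unit at (i, j) to [T i j], with coefficients extended
    along [io]. *)
Definition lrho (Y : 'M[A]_n) : 'M[A]_N := \sum_i \sum_j Y i j *: (T i j)^io.

Lemma lrho_linear a Y Z : lrho (a *: Y + Z) = a *: lrho Y + lrho Z.
Proof.
rewrite scaler_sumr -big_split; apply: eq_bigr => i _.
rewrite scaler_sumr -big_split; apply: eq_bigr => j _.
by rewrite !mxE scalerDl scalerA.
Qed.

Lemma lrhoD Y Z : lrho (Y + Z) = lrho Y + lrho Z.
Proof. by rewrite -[Y]scale1r lrho_linear !scale1r. Qed.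

Lemma lrho0 : lrho 0 = 0.
Proof. by apply: (@addrI _ (lrho 0)); rewrite -lrhoD !addr0. Qed.

Lemma lrhoZ a Y : lrho (a *: Y) = a *: lrho Y.
Proof. by rewrite -[_ *: Y]addr0 lrho_linear lrho0 addr0. Qed.

Lemma lrhoN Y : lrho (- Y) = - lrho Y.
Proof. by rewrite -scaleN1r lrhoZ scaleN1r. Qed.

Lemma lrho_delta i j : lrho (delta_mx i j) = (T i j)^io.
Proof.
rewrite /lrho (bigD1 i) //= (bigD1 j) //= mxE !eqxx scale1r big1 ?addr0 => [|l /negPf lj].
  rewrite big1 ?addr0 // => k /negPf ki; rewrite big1 // => l _.
  by rewrite mxE ki scale0r.
by rewrite mxE lj andbF scale0r.
Qed.

(** A word is a sequence of triples (i, j, r), each standing for the letter [xe i j r].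
    [wordmx] is its product in SL_n, [wordrep] the product of the exponentials attached to its
    letters; the point of this part is that the second depends on the first only. *)
Definition wordmx (w : seq ('I_n * 'I_n * A)) : 'M[A]_n :=
  foldr (fun x M => xe x.1.1 x.1.2 x.2 *m M) 1%:M w.
Definition wordrep (w : seq ('I_n * 'I_n * A)) : 'M[A]_N :=
  foldr (fun x M => texp io m (T x.1.1 x.1.2) x.2 *m M) 1%:M w.
Definition winv (w : seq ('I_n * 'I_n * A)) := rev [seq (x.1, - x.2) | x <- w].

Lemma wordmx_cat w1 w2 : wordmx (w1 ++ w2) = wordmx w1 *m wordmx w2.
Proof. by elim: w1 => [|x w1 IH] /=; rewrite ?mul1mx // IH mulmxA. Qed.

Lemma wordrep_cat w1 w2 : wordrep (w1 ++ w2) = wordrep w1 *m wordrep w2.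
Proof. by elim: w1 => [|x w1 IH] /=; rewrite ?mul1mx // IH mulmxA. Qed.
End Coef.

(** The letters of a word must be off-diagonal, since [xe i i r] has determinant 1 + r. *)
Definition wf (A : Type) (w : seq ('I_n * 'I_n * A)) := all (fun x => x.1.1 != x.1.2) w.

Lemma wf_cat A (w1 w2 : seq ('I_n * 'I_n * A)) : wf (w1 ++ w2) = wf w1 && wf w2.
Proof. exact: all_cat. Qed.

Lemma wf_inv (A : comNzRingType) (w : seq ('I_n * 'I_n * A)) : wf (winv w) = wf w.
Proof. by rewrite /wf all_rev all_map. Qed.

Hypothesis nilT : forall i j, i != j -> T i j ^+ m = 0.

Section Coef2.
Variables (A : comNzRingType) (io : {rmorphism F -> A}).
Local Notation "M ^io" := (map_mx io M) (at level 2, format "M ^io").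
Local Notation wordrep := (wordrep io).

Lemma wordmxK (w : seq ('I_n * 'I_n * A)) : wf w -> wordmx w *m wordmx (winv w) = 1%:M.
Proof.
elim: w => [|x w IH] /=; first by rewrite mulmx1.
case/andP=> nx /IH E; rewrite /winv /= rev_cons -cats1 wordmx_cat.
by rewrite -mulmxA (mulmxA (wordmx w)) E mul1mx /= mulmx1 xeK.
Qed.

Lemma wordmxVK (w : seq ('I_n * 'I_n * A)) : wf w -> wordmx (winv w) *m wordmx w = 1%:M.
Proof. by move/wordmxK => /mulmx1C. Qed.

Lemma det_wordmx (w : seq ('I_n * 'I_n * A)) : wf w -> \det (wordmx w) = 1.
Proof.
elim: w => [|x w IH] /=; first by rewrite det1.
by case/andP=> nx /IH E; rewrite det_mulmx E mulr1 det_xe.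
Qed.

Lemma wordrepK w : wf w -> wordrep w *m wordrep (winv w) = 1%:M.
Proof.
elim: w => [|x w IH] /=; first by rewrite mulmx1.
case/andP=> nx /IH E; rewrite /winv /= rev_cons -cats1 wordrep_cat.
by rewrite -mulmxA (mulmxA (wordrep w)) E mul1mx /= mulmx1 texpK ?nilT.
Qed.
Lemma wordrepVK w : wf w -> wordrep (winv w) *m wordrep w = 1%:M.
Proof. by move/wordrepK => /mulmx1C. Qed.
End Coef2.

Hypothesis lieT : forall i j k l, i != j ->
  T i j *m T k l - T k l *m T i j = (j == k)%:R *: T i l - (l == i)%:R *: T k j.

Section Ad.
Variables (A : comNzRingType) (io : {rmorphism F -> A}).
Local Notation "M ^io" := (map_mx io M) (at level 2, format "M ^io").
Local Notation lrho := (lrho io).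

Definition adD i j (Y : 'M[A]_n) := delta_mx i j *m Y - Y *m delta_mx i j.

(** The bracket relations of the family [T] say that [lrho] is a Lie algebra homomorphism,
    at least for brackets with off-diagonal matrix units. *)
Lemma lrho_lie i j Y : i != j -> (T i j)^io *m lrho Y = lrho Y *m (T i j)^io + lrho (adD i j Y).
Proof.
move=> nij; apply/eqP; rewrite addrC -subr_eq; apply/eqP.
rewrite mulmx_sumr mulmx_suml -sumrB.
transitivity (\sum_k \sum_l Y k l *: ((j == k)%:R *: (T i l)^io - (l == i)%:R *: (T k j)^io)).
  apply: eq_bigr => k _; rewrite mulmx_sumr mulmx_suml -sumrB; apply: eq_bigr => l _.
  rewrite -scalemxAr -scalemxAl -scalerBr; congr (_ *: _).
  by rewrite -!map_mxM -map_mxB lieT // map_mxB !map_mxZ !rmorph_nat.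
rewrite /adD lrhoD lrhoN.
have -> : lrho (delta_mx i j *m Y) = \sum_l Y j l *: (T i l)^io.
  rewrite /lrho (bigD1 i) //= [X in _ + X]big1 ?addr0 => [|k /negPf ki].
    apply: eq_bigr => l _; rewrite mxE (bigD1 j) //= big1 ?addr0 => [|k /negPf kj].
      by rewrite mxE !eqxx mul1r.
    by rewrite mxE kj andbF mul0r.
  by rewrite big1 // => l _; rewrite mxE big1 ?scale0r // => p _; rewrite mxE ki mul0r.
have -> : lrho (Y *m delta_mx i j) = \sum_k Y k i *: (T k j)^io.
  apply: eq_bigr => k _; rewrite (bigD1 j) //= [X in _ + X]big1 ?addr0 => [|l /negPf lj].
    rewrite mxE (bigD1 i) //= big1 ?addr0 => [|p /negPf pi].
      by rewrite mxE !eqxx mulr1.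
    by rewrite mxE pi mulr0.
  by rewrite mxE big1 ?scale0r // => p _; rewrite mxE lj andbF mulr0.
transitivity (\sum_k \sum_l (j == k)%:R *: (Y k l *: (T i l)^io) - \sum_k \sum_l (l == i)%:R *: (Y k l *: (T k j)^io)).
  rewrite -sumrB; apply: eq_bigr => k _; rewrite -sumrB; apply: eq_bigr => l _.
  by rewrite scalerBr !scalerA ![Y k l * _]mulrC.
congr (_ - _).
  rewrite (bigD1 j) //= [X in _ + X]big1 ?addr0 => [|k /negPf kj].
    by apply: eq_bigr => l _; rewrite eqxx scale1r.
  by rewrite big1 // => l _; rewrite eq_sym kj scale0r.
apply: eq_bigr => k _; rewrite (bigD1 i) //= [X in _ + X]big1 ?addr0 => [|l /negPf li].
  by rewrite eqxx scale1r.
by rewrite li scale0r.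
Qed.

(** As e^2 = 0 for e = e_ij, applying ad(e) three times gives zero. Hence conjugation by
    exp(r e) is the polynomial 1 + r ad(e) + r^2/2 ad(e)^2. *)
Lemma adD3 i j Y : i != j -> adD i j (adD i j (adD i j Y)) = 0.
Proof.
move=> nij; pose e : 'M[A]_n := delta_mx i j.
have ee : e *m e = 0 by rewrite /e mul_delta_mx_cond eq_sym (negPf nij).
have -> : adD i j (adD i j Y) = - ((e *m Y *m e) *+ 2).
  rewrite /adD -/e !mulmxBr !mulmxBl !mulmxA ee mul0mx sub0r -!mulmxA ee mulmx0 subr0.
  by rewrite mulr2n opprD.
rewrite /adD -/e mulmxN mulNmx mulr2n mulmxDr mulmxDl !mulmxA ee !mul0mx.
by rewrite -!mulmxA ee !mulmx0 !(addr0, oppr0).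
Qed.

Lemma xe_conj i j r Y : i != j -> let half := io 2^-1 in
  xe i j r *m Y = (Y + r *: adD i j Y + (r ^+ 2 * half) *: adD i j (adD i j Y)) *m xe i j r.
Proof.
move=> nij half; pose e : 'M[A]_n := delta_mx i j.
have ee : e *m e = 0 by rewrite /e mul_delta_mx_cond eq_sym (negPf nij).
have h2 : half + half = 1.
  by rewrite -rmorphD -[2^-1]mul1r -splitr rmorph1.
have D2 : adD i j (adD i j Y) = - (e *m Y *m e + e *m Y *m e).
  rewrite /adD -/e !mulmxBr !mulmxBl !mulmxA ee mul0mx sub0r -!mulmxA ee mulmx0 subr0.
  by rewrite opprD.
have {}D2 : (r ^+ 2 * half) *: adD i j (adD i j Y) = - (r ^+ 2 *: (e *m Y *m e)).
  by rewrite D2 scalerN scalerDr -scalerDl -mulrDr h2 mulr1.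
have ZZ : (r *: e) *m (r *: e) = 0 by rewrite -scalemxAl -scalemxAr ee !scaler0.
have -> : r *: adD i j Y = (r *: e) *m Y - Y *m (r *: e).
  by rewrite /adD -/e scalerBr -scalemxAl -scalemxAr.
have -> : (r ^+ 2 * half) *: adD i j (adD i j Y) = - ((r *: e) *m Y *m (r *: e)).
  by rewrite D2 -!scalemxAl -scalemxAr scalerA.
rewrite /xe -/e; move: (r *: e) ZZ => Z ZZ.
rewrite mulmxDl mul1mx mulmxDr mulmx1 !mulmxDl !mulNmx -!mulmxA ZZ !mulmx0 oppr0 !addr0.
by rewrite [Y *m Z + _]addrC addrA subrK -addrA subrK.
Qed.

Lemma mulrn_io_inj (p q k : nat) : injective (fun X : 'M[A]_(p, q) => X *+ k.+1).
Proof.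
move=> X Y /= /(congr1 (fun Z => io (k.+1%:R^-1) *: Z)).
by rewrite -!scaler_nat !scalerA -(rmorph_nat io) -rmorphM mulVf ?pnatr_eq0 // rmorph1 !scale1r.
Qed.

(** Moving T^k / k! to the right past lrho(Y): only two correction terms appear since ad(e)^3 = 0.
    This is the coefficient of r^(k+2) in the relation exp(r T) lrho(Y) = lrho(Z) exp(r T). *)
Lemma dpow_rho i j k Y : i != j -> let a l : 'M[A]_N := (dpow (T i j) l)^io in
  a k.+2 * lrho Y = lrho Y * a k.+2 + lrho (adD i j Y) * a k.+1
                     + io 2^-1 *: (lrho (adD i j (adD i j Y)) * a k).
Proof.
move=> nij a; pose t : 'M[A]_N := (T i j)^io.
have aS l : a l.+1 *+ l.+1 = t * a l.
  by rewrite /a /t -[RHS]map_mxM -raddfMn -dpowS.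
have a0 : a 0%N = 1 by rewrite /a dpow0 map_mx1.
have a1 : a 1%N = t by have := aS 0%N; rewrite mulr1n a0 mulr1.
have lie Z : t * lrho Z = lrho Z * t + lrho (adD i j Z) by exact: lrho_lie.
have h2 (X : 'M[A]_N) : (io 2^-1 *: X) *+ 2 = X.
  by rewrite -scaler_nat scalerA -(rmorph_nat io) -rmorphM divff ?pnatr_eq0 // rmorph1 scale1r.
set R0 := lrho Y; set R1 := lrho (adD i j Y); set R2 := lrho _.
have lie0 : t * R0 = R0 * t + R1 by exact: lie.
have lie1 : t * R1 = R1 * t + R2 by exact: lie.
have lie2 : t * R2 = R2 * t by rewrite lie adD3 // lrho0 addr0.
elim: k => [|k IH].
  apply: (@mulrn_io_inj _ _ 1) => /=.
  rewrite 2!mulrnDl h2 a0 a1 mulr1 -mulrnAl -(mulrnAr R0) aS a1 -mulrA lie0 mulrDr lie1.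
  by rewrite mulrA lie0 mulrDl mulr2n mulrA !addrA.
apply: (@mulrn_io_inj _ _ k.+2) => /=.
rewrite 2!mulrnDl -mulrnAl -(mulrnAr R0) aS -mulrA IH !mulrDr -scalerAr.
rewrite (mulrA t R0) lie0 (mulrA t R1) lie1 (mulrA t R2) lie2 !mulrDl.
rewrite -(mulrA R0 t) -(mulrA R1 t) -(mulrA R2 t) -!aS !mulrnAr.
rewrite [in RHS]mulrSr [(io _ *: _) *+ k.+3](mulrnDr _ 2 k.+1) h2.
rewrite [R1 * _ *+ _ + R1 * _]addrC -scalerMnr -!addrA; congr (_ + (_ + _)).
Qed.

(** The exponential acts on the image of the Lie algebra by conjugation as the elementary
    matrix does on the Lie algebra itself, since both actions are exp(r ad). *)
Lemma texp_conj i j r Y : i != j -> exists2 Z,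
  texp io m (T i j) r *m lrho Y = lrho Z *m texp io m (T i j) r &
  xe i j r *m Y = Z *m xe i j r.
Proof.
move=> nij; pose Z := Y + r *: adD i j Y + (r ^+ 2 * io 2^-1) *: adD i j (adD i j Y).
exists Z; last exact: xe_conj.
have tm := nilT nij; pose a l : 'M[A]_N := (dpow (T i j) l)^io.
rewrite /Z !lrhoD !lrhoZ; set R0 := lrho Y; set R1 := lrho _; set R2 := lrho _.
have a0 : a 0%N = 1 by rewrite /a dpow0 map_mx1.
have a1 : a 1%N = (T i j)^io.
  by rewrite /a /dpow invr1 scale1r expr1.
rewrite -{1}(texp_widen io r tm (leqW (leqnSn m))) /texp 2!big_ord_recl /=.
rewrite -/(a 0%N) -/(a 1%N) expr0 scale1r expr1 a0.
rewrite mulmxDl mul1mx mulmxDl mulmx_suml.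
rewrite (eq_bigr (fun k : 'I_m => r ^+ k.+2 *: (R0 * a k.+2) + r ^+ k.+2 *: (R1 * a k.+1)
   + r ^+ k.+2 *: (io 2^-1 *: (R2 * a k)))); last first.
  by move=> k _; rewrite -scalemxAl [_ *m _]dpow_rho // !scalerDr.
(* the two first terms of the exponential are treated apart, the others by [dpow_rho] *)
rewrite !big_split /=.
rewrite -scalemxAl a1 lrho_lie // scalerDr -a1.
rewrite !mulmxDl -!scalemxAl.
have E0 : R0 *m texp io m (T i j) r = R0 + r *: (R0 *m a 1%N) + \sum_(k < m) r ^+ k.+2 *: (R0 * a k.+2).
  rewrite -{1}(texp_widen io r tm (leqW (leqnSn m))) /texp 2!big_ord_recl /=.
  rewrite -/(a 0%N) -/(a 1%N) expr0 scale1r expr1 a0 mulmxDr mulmx1 mulmxDr -scalemxAr addrA.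
  by congr (_ + _); rewrite mulmx_sumr; apply: eq_bigr => k _; rewrite -scalemxAr.
have E1 : r *: (R1 *m texp io m (T i j) r) = r *: R1 + \sum_(k < m) r ^+ k.+2 *: (R1 * a k.+1).
  rewrite -{1}(texp_widen io r tm (leqnSn m)) /texp big_ord_recl /=.
  rewrite -/(a 0%N) expr0 scale1r a0 mulmxDr mulmx1 scalerDr; congr (_ + _).
  rewrite mulmx_sumr scaler_sumr; apply: eq_bigr => k _.
  by rewrite -scalemxAr scalerA -exprS.
have E2 : (r ^+ 2 * io 2^-1) *: (R2 *m texp io m (T i j) r) = \sum_(k < m) r ^+ k.+2 *: (io 2^-1 *: (R2 * a k)).
  rewrite mulmx_sumr scaler_sumr; apply: eq_bigr => k _.
  by rewrite -scalemxAr !scalerA mulrAC -exprD.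
rewrite E0 E1 E2 -/R0 -/R1 !addrA; congr (_ + _).
by congr (_ + _); rewrite addrAC.
Qed.
End Ad.

Section Deriv.
Variables (K : comNzRingType) (io : {rmorphism F -> K}) (d : {additive K -> K}).
Hypothesis dM : forall x y, d (x * y) = d x * y + x * d y.
Hypothesis dC : forall c, d (io c) = 0.
Local Notation "M ^io" := (map_mx io M) (at level 2, format "M ^io").

(** By induction on the word: the derivative of a letter contributes its own multiple of T_ij,
    and conjugation by the letters in front transforms both sides in the same way. *)
Lemma wordrep_flat w : wf w -> exists2 Y,
  map_mx d (wordmx w) = Y *m wordmx w & map_mx d (wordrep io w) = lrho io Y *m wordrep io w.
Proof.
elim: w => [_|[[i j] r] w IH /=]; first by exists 0; rewrite ?lrho0 mul0mx (map_d_1 dC).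
case/andP=> nij /IH [Y E1 E2].
have [Z C1 C2] := texp_conj io r Y nij.
exists (d r *: delta_mx i j + Z).
  rewrite (map_d_mul dM) E1 mulmxA C2 mulmxDl -mulmxA; congr (_ + _).
  rewrite mulmxA; congr (_ *m _).
  rewrite {1}/xe map_mxD (map_d_1 dC) add0r (map_d_scale dM) (map_d_delta dC) scaler0 addr0.
  rewrite -scalemxAl; congr (_ *: _).
  rewrite /xe mulmxDr mulmx1 -scalemxAr mul_delta_mx_cond eq_sym (negPf nij) mulr0n scaler0.
  by rewrite addr0.
rewrite (map_d_mul dM) E2 (map_d_texp dM dC) ?nilT // mulmxA C1 lrhoD lrhoZ lrho_delta mulmxDl.
by rewrite -!scalemxAl !mulmxA.
Qed.

Lemma wordrep_const w : wf w -> wordmx w = 1%:M -> map_mx d (wordrep io w) = 0.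
Proof.
move=> /wordrep_flat[Y E1 E2] w1; rewrite E2.
by move: E1; rewrite w1 mulmx1 (map_d_1 dC) => <-; rewrite lrho0 mul0mx.
Qed.
End Deriv.
End LieRep.

(** * Polynomial functions on matrices and rational extensions *)

Section Ev.
Variables (F : numFieldType) (n : nat).
Local Notation MP := {mpoly F[n * n]}.

(** The matrix may have entries in any algebra, since matrices over polynomial rings and fields of
    rational functions occur below. *)
Definition evm (A : comNzRingType) (io : {rmorphism F -> A}) (g : 'M[A]_n) (p : MP) : A :=
  mmap io (fun k => mxvec g 0 k) p.

HB.instance Definition _ A io g := GRing.RMorphism.copy (@evm A io g) (mmap io (fun k => mxvec g 0 k)).

Lemma evmC A io g c : @evm A io g c%:MP = io c.
Proof. exact: mmapC. Qed.

Lemma evm_map (A B : comNzRingType) (ia : {rmorphism F -> A}) (ib : {rmorphism F -> B})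
  (h : {rmorphism A -> B}) g p : (forall x, h (ia x) = ib x) ->
  h (evm ia g p) = evm ib (map_mx h g) p.
Proof.
move=> hE; rewrite /evm /mmap rmorph_sum; apply: eq_bigr => k _ /=.
rewrite rmorphM hE; congr (_ * _); rewrite /mmap1 rmorph_prod; apply: eq_bigr => i _ /=.
by rewrite rmorphXn -map_mxvec mxE.
Qed.

Definition genmx : 'M[MP]_n := vec_mx (\row_k 'X_k).

Lemma evm_gen (A : comNzRingType) io (g : 'M[A]_n) : map_mx (evm io g) genmx = g.
Proof.
rewrite /genmx map_vec_mx; apply: (can_inj mxvecK); rewrite vec_mxK.
by apply/rowP=> k; rewrite !mxE /evm mmapX mmap1U.
Qed.
End Ev.

Section Path.
Variables (F : numFieldType) (n N' m : nat).
Local Notation N := N'.+1.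
Local Notation MP := {mpoly F[n * n]}.
Variable (T : 'I_n -> 'I_n -> 'M[F]_N).
Hypothesis nilT : forall i j, i != j -> T i j ^+ m = 0.
Hypothesis lieT : forall i j k l, i != j ->
  T i j *m T k l - T k l *m T i j = (j == k)%:R *: T i l - (l == i)%:R *: T k j.

(** The word obtained from a list [l] of polynomial numerators and a common denominator [q] by
    substituting the entries of [g]. *)
Definition evw (K : fieldType) (io : {rmorphism F -> K}) (q : MP) g
    (l : seq ('I_n * 'I_n * MP)) := [seq (x.1, evm io g x.2 / evm io g q) | x <- l].

(** On the locus where [q] does not vanish, the list [l] factors [g] into elementary matrices
    uniformly. All field extensions are included in order to apply it to a matrix that moves
    along a path. *)
Definition factors_over (q : MP) l := forall (K : fieldType) (io : {rmorphism F -> K}) (g : 'M[K]_n),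
  \det g = 1 -> evm io g q != 0 -> wordmx (evw io q g l) = g.

(** [f] is a possible denominator of the extension: [f] times the representative of a word is
    a polynomial function of the product of the word. The first clause says that the extension is
    defined at all points where [f] does not vanish. *)
Definition extends_over (f : MP) :=
  (forall g : 'M[F]_n, \det g = 1 -> evm idfun g f != 0 -> exists2 w, wf w & wordmx w = g) /\
  exists Q : 'M[MP]_N, forall w, wf w ->
    evm idfun (wordmx w) f *: wordrep m T idfun w = map_mx (evm idfun (wordmx w)) Q.

(** The representative of the factorisation [(q, l)], with the denominators cleared. *)
Definition num_rep (q : MP) l : 'M[MP]_N :=
  foldr (fun x M => (\sum_(k < m) (x.2 ^+ k * q ^+ (m - k)) *:
                       map_mx (@mpolyC _ _) (dpow (T x.1.1 x.1.2) k)) *m M) 1%:M l.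

Lemma num_repE (K : fieldType) (io : {rmorphism F -> K}) q g l : evm io g q != 0 ->
  map_mx (evm io g) (num_rep q l) =
  evm io g q ^+ (m * size l) *: wordrep m T io (evw io q g l).
Proof.
move=> q0; elim: l => [|x l IH] /=; first by rewrite muln0 expr0 scale1r map_mx1.
rewrite map_mxM IH mulnS exprD -scalerA scalemxAr scalemxAl; congr (_ *m _).
rewrite raddf_sum scaler_sumr; apply: eq_bigr => k _ /=.
  rewrite map_mxZ (@map_io _ _ _ _ io) => [|c]; last exact: evmC.
  rewrite scalerA rmorphM !rmorphXn /=; congr (_ *: _).
  by rewrite exprMn exprVn mulrCA -expfB_cond // ?(negPf q0) ?add0n // ltnW.
Qed.

Lemma wf_evw (K : fieldType) (io : {rmorphism F -> K}) q g l : wf (evw io q g l) = wf l.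
Proof. by rewrite /wf all_map. Qed.

Section NatWords.
Variables (A B : comNzRingType) (ia : {rmorphism F -> A}) (ib : {rmorphism F -> B}) (h : {rmorphism A -> B}).
Hypothesis hE : forall x, h (ia x) = ib x.
Local Notation hw w := [seq (x.1, h x.2) | x <- w].

Lemma map_wordmx (w : seq ('I_n * 'I_n * A)) : map_mx h (wordmx w) = wordmx (hw w).
Proof. by elim: w => [|x w IH] /=; rewrite ?map_mx1 // map_mxM IH map_xe. Qed.

Lemma map_wordrep w : map_mx h (wordrep m T ia w) = wordrep m T ib (hw w).
Proof. by elim: w => [|x w IH] /=; rewrite ?map_mx1 // map_mxM IH (map_texp hE). Qed.
End NatWords.

(** The derivative of the representative vanishes by flatness, and a rational function with
    zero derivative is constant. *)
Lemma constant_word_rep w : wf w -> wordmx w = 1%:M ->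
  exists C : 'M[F]_N, wordrep m T (@FracField.tofrac {poly F} \o polyC) w =
      map_mx (@FracField.tofrac {poly F} \o polyC) C.
Proof.
move=> wfw w1.
have dC c : fderiv (FracField.tofrac c%:P) = 0 :> {fraction {poly F}}.
  by rewrite fderiv_tofrac derivC tofrac0.
have /matrixP D0 := @wordrep_const F n N' m T nilT lieT _
  (@FracField.tofrac {poly F} \o polyC) (@fderiv F) (@fderivM F) dC w wfw w1.
have /fin_all_exists[f fE] : forall i : 'I_N, exists f : 'I_N -> F, forall j,
    wordrep m T (@FracField.tofrac {poly F} \o polyC) w i j = FracField.tofrac (f j)%:P.
  move=> i; apply: (@fin_all_exists _ _ (fun j c => _ = FracField.tofrac c%:P)) => j.
  by apply: fderiv_eq0; have := D0 i j; rewrite !mxE.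
by exists (\matrix_(i, j) f i j); apply/matrixP=> i j; rewrite !mxE fE.
Qed.

Lemma wordmx0 (A : comNzRingType) (w : seq ('I_n * 'I_n * A)) : wordmx [seq (x.1, 0 : A) | x <- w] = 1%:M.
Proof. by elim: w => //= x w ->; rewrite xe0 mulmx1. Qed.

Lemma wordrep0 (w : seq ('I_n * 'I_n * F)) : wf w -> wordrep m T idfun [seq (x.1, 0 : F) | x <- w] = 1%:M.
Proof. by elim: w => //= x w IH /andP[nx /IH ->]; rewrite texp0 ?nilT ?mulmx1. Qed.

(** Given a word [w], a path of words leads from a fixed matrix [gam] with q(gam) <> 0 to the
    product of [w]. Over the field of rational functions in the parameter, the matrix on the path
    has two words: the path itself and the one that [l] provides. Their representatives differ by
    a constant factor, which is 1 at the beginning of the path, hence also at its end. Clearing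
    denominators makes it possible to specialise the parameter even where q vanishes. If q
    vanishes on all of SL_n there is nothing to prove. *)
Lemma extends_path q l : wf l -> factors_over q l -> extends_over (q ^+ (m * size l).+1).
Proof.
move=> wfl dec; set E := (m * size l)%N; split.
  move=> g dg; rewrite rmorphXn /= expf_eq0 /= => q0.
  by exists (evw idfun q g l); rewrite ?wf_evw //; apply: dec.
have [[gam [dgam qgam]]|none] := classic (exists gam : 'M[F]_n, \det gam = 1 /\ evm idfun gam q != 0);
  last first.
  exists 0 => w wfw; rewrite rmorphXn /=.
  have [->|q0] := eqVneq (evm idfun (wordmx w) q) 0; last first.
    by case: none; exists (wordmx w); rewrite det_wordmx.
  by rewrite expr0n scale0r map_mx0.
exists (q *: num_rep q l) => w wfw.
rewrite map_mxZ rmorphXn /= exprS -scalerA; congr (_ *: _).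
pose ioK := @FracField.tofrac {poly F} \o polyC.
pose wg := evw idfun q gam l.
have wfg : wf wg by rewrite wf_evw.
have wgE : wordmx wg = gam by exact: dec.
pose w1 := winv wg ++ w.
have wf1 : wf w1 by rewrite wf_cat wf_inv wfg.
pose Ws : seq ('I_n * 'I_n * {poly F}) := [seq (x.1, x.2%:P) | x <- wg] ++ [seq (x.1, 'X * x.2%:P) | x <- w1].
have wfs : wf Ws by rewrite wf_cat /wf !all_map; apply/andP; split.
(* Ws joins gam, at parameter 0, to the matrix of w, at parameter 1. *)
have at0 : [seq (x.1, horner_eval 0 x.2) | x <- Ws] = wg ++ [seq (x.1, 0) | x <- w1].
  rewrite map_cat; congr (_ ++ _); last by rewrite -map_comp; apply: eq_map => x /=; rewrite /horner_eval !hornerE.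
  rewrite -map_comp; apply: etrans (map_id _); apply: eq_map => -[x y] /=.
  by rewrite /horner_eval hornerC.
have at1 : [seq (x.1, horner_eval 1 x.2) | x <- Ws] = wg ++ w1.
  rewrite map_cat; congr (_ ++ _); rewrite -map_comp; apply: etrans (map_id _); apply: eq_map => -[x y] /=;
  by rewrite /horner_eval !hornerE.
have hE (c x : F) : horner_eval c x%:P = idfun x by rewrite /horner_eval hornerC.
have g0 : map_mx (horner_eval 0) (wordmx Ws) = gam.
  by rewrite map_wordmx at0 wordmx_cat wordmx0 mulmx1.
have g1 : map_mx (horner_eval 1) (wordmx Ws) = wordmx w.
  by rewrite map_wordmx at1 !wordmx_cat mulmxA wordmxK // mul1mx.
have r0 : map_mx (horner_eval 0) (wordrep m T polyC Ws) = wordrep m T idfun wg.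
  by rewrite (map_wordrep (hE 0)) at0 wordrep_cat wordrep0 // mulmx1.
have r1 : map_mx (horner_eval 1) (wordrep m T polyC Ws) = wordrep m T idfun w.
  by rewrite (map_wordrep (hE 1)) at1 !wordrep_cat mulmxA (wordrepK nilT) // mul1mx.
pose WK := [seq (x.1, @FracField.tofrac {poly F} x.2) | x <- Ws].
have wfK : wf WK by rewrite /wf all_map.
have gKE : wordmx WK = map_mx (@FracField.tofrac {poly F}) (wordmx Ws) by rewrite map_wordmx.
have tE x : FracField.tofrac x%:P = ioK x by [].
have qKE : evm ioK (wordmx WK) q = FracField.tofrac (evm polyC (wordmx Ws) q).
  by rewrite gKE (evm_map _ _ tE).
have qK0 : evm ioK (wordmx WK) q != 0.
  rewrite qKE tofrac_eq0; apply: contraNneq qgam => q0.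
  by rewrite -g0 -(evm_map (ia := polyC) _ _ (hE 0)) q0 rmorph0.
have dK : \det (wordmx WK) = 1 by exact: det_wordmx.
pose W' := evw ioK q (wordmx WK) l.
have wf' : wf W' by rewrite wf_evw.
have W'E : wordmx W' = wordmx WK by exact: dec.
have wfc : wf (WK ++ winv W') by rewrite wf_cat wfK wf_inv.
have [|C CE] := constant_word_rep wfc; first by rewrite wordmx_cat -W'E wordmxK.
have {}CE : wordrep m T ioK WK = map_mx ioK C *m wordrep m T ioK W'.
  by rewrite -CE wordrep_cat -mulmxA (wordrepVK nilT) // mulmx1.
pose G := wordmx Ws.
have key : evm polyC G q ^+ E *: wordrep m T polyC Ws =
           map_mx polyC C *m map_mx (evm polyC G) (num_rep q l).
  have inj (A B : 'M[{poly F}]_N) : map_mx (@FracField.tofrac _) A = map_mx (@FracField.tofrac _) B -> A = B.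
    move/matrixP=> AB; apply/matrixP=> i j; apply/eqP.
    by have /eqP := AB i j; rewrite !mxE tofrac_eq.
  apply: inj; rewrite map_mxZ rmorphXn /= -qKE (map_wordrep tE) -/WK CE map_mxM (map_io tE).
  rewrite scalemxAr -num_repE // gKE; congr (_ *m _).
  by apply/matrixP=> i j; rewrite !mxE (evm_map _ _ tE).
have key' c : evm idfun (map_mx (horner_eval c) G) q ^+ E *: map_mx (horner_eval c) (wordrep m T polyC Ws)
    = C *m map_mx (evm idfun (map_mx (horner_eval c) G)) (num_rep q l).
  have /(congr1 (map_mx (horner_eval c))) := key.
  rewrite map_mxZ rmorphXn /= (evm_map _ _ (hE c)) => ->.
  rewrite map_mxM (map_io (hE c)) map_mx_id //; congr (_ *m _).
  by apply/matrixP=> i j; rewrite !mxE (evm_map _ _ (hE c)).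
have C1 : C = 1%:M.
  have := key' 0; rewrite g0 r0 num_repE // -/wg -scalemxAr => /(scalerI (expf_neq0 E qgam)).
  move=> /(congr1 (mulmx^~ (wordrep m T idfun (winv wg)))).
  by rewrite -mulmxA (wordrepK nilT) // mulmx1 => ->.
by have := key' 1; rewrite g1 r1 C1 mul1mx.
Qed.
End Path.

(** * Gaussian elimination and the polynomial extension *)

Section Elim.
Variables (F : numFieldType) (n N' m : nat).
Local Notation N := N'.+1.
Local Notation MP := {mpoly F[n * n]}.
Variable (T : 'I_n -> 'I_n -> 'M[F]_N).
Hypothesis nilT : forall i j, i != j -> T i j ^+ m = 0.
Hypothesis lieT : forall i j k l, i != j ->
  T i j *m T k l - T k l *m T i j = (j == k)%:R *: T i l - (l == i)%:R *: T k j.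
Local Notation ext := (extends_over m T).
Local Notation ev g p := (evm idfun g p).

Definition eq_on_SL (f f' : MP) := forall g : 'M[F]_n, \det g = 1 -> ev g f = ev g f'.

Lemma ext_eq f f' : eq_on_SL f f' -> ext f -> ext f'.
Proof.
move=> E [H1 [Q H2]]; split=> [g dg|]; first by rewrite -E //; apply: H1.
by exists Q => w wfw; rewrite -E ?H2 // det_wordmx.
Qed.

Lemma extM c f : ext f -> ext (c * f).
Proof.
move=> [H1 [Q H2]]; split=> [g dg|].
  by rewrite rmorphM mulf_eq0 negb_or => /andP[_]; apply: H1.
exists (c *: Q) => w wfw.
by rewrite rmorphM -scalerA H2 // map_mxZ.
Qed.

(** The denominators form an ideal. *)
Lemma extD f f' : ext f -> ext f' -> ext (f + f').
Proof.
move=> [H1 [Q H2]] [H1' [Q' H2']]; split=> [g dg|].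
  rewrite rmorphD /= => s0; have [f0|] := eqVneq (ev g f) 0; last exact: H1.
  by apply: H1' => //; apply: contraNneq s0 => f'0; rewrite f0 f'0 addr0.
exists (Q + Q') => w wfw.
by rewrite rmorphD scalerDl H2 // H2' // map_mxD.
Qed.

Lemma ext0 : ext 0.
Proof.
split=> [g dg|]; first by rewrite rmorph0 eqxx.
by exists 0 => w wfw; rewrite rmorph0 scale0r map_mx0.
Qed.

(** Membership in the radical of the ideal of denominators; it is to be shown that 1 belongs to it. *)
Definition radext (f : MP) := exists e, ext (f ^+ e).

Lemma radext_eq f f' : eq_on_SL f f' -> radext f -> radext f'.
Proof.
move=> E [e He]; exists e; apply: ext_eq He => g dg.
by rewrite !rmorphXn /= E.
Qed.

Lemma radextM c f : radext f -> radext (c * f).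
Proof. by case=> e He; exists e; rewrite exprMn; apply: extM. Qed.

Lemma radextX f e : radext (f ^+ e) -> radext f.
Proof. by case=> e' He; exists (e * e')%N; rewrite exprM. Qed.

Lemma radextD f f' : radext f -> radext f' -> radext (f + f').
Proof.
move=> [e He] [e' He']; exists (e + e')%N; rewrite exprDn.
apply: (big_ind ext); [exact: ext0 | exact: extD | move=> i _].
rewrite -mulr_natl; apply: extM; case: (leqP e (e + e' - i)) => le.
  by rewrite -(subnK le) exprD mulrC mulrA; apply: extM.
have le' : (e' <= i)%N by lia.
by rewrite -(subnK le') exprD mulrA; apply: extM.
Qed.

Lemma radext_sum (I : finType) (P : pred I) (f : I -> MP) :
  (forall i, P i -> radext (f i)) -> radext (\sum_(i | P i) f i).
Proof.
move=> H; apply: (big_ind radext) => //; last exact: radextD.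
by exists 1%N; exact: ext0.
Qed.

Local Notation lw := (seq ('I_n * 'I_n * MP)).

(** The matrix that results from [g] by the row operations [l], with coefficients over the
    common denominator [q]. *)
Definition redmx (K : fieldType) (io : {rmorphism F -> K}) (q : MP) (l : lw) (g : 'M[K]_n) :=
  wordmx (evw io q g l) *m g.

(** The numerator of [redmx], as a matrix of polynomials. *)
Definition rednum (q : MP) (l : lw) : 'M[MP]_n :=
  foldr (fun x M => (q%:M + x.2 *: delta_mx x.1.1 x.1.2) *m M) (genmx F n) l.

Lemma rednumE (K : fieldType) (io : {rmorphism F -> K}) q l g : @evm F n K io g q != 0 ->
  map_mx (evm io g) (rednum q l) = evm io g q ^+ size l *: redmx io q l g.
Proof.
move=> q0; rewrite /redmx; elim: l => [|x l IH] /=; first by rewrite expr0 scale1r mul1mx evm_gen.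
rewrite map_mxM IH exprS -scalerA -(mulmxA _ _ g).
rewrite (scalemxAr _ (xe _ _ _)) (scalemxAl _ (xe _ _ _)); congr (_ *m _).
rewrite map_mxD map_mxZ map_delta_mx map_scalar_mx /= /xe scalerDr scalerA.
by rewrite scale_scalar_mx mulr1 mulrC divfK.
Qed.

Lemma rednumEij (K : fieldType) (io : {rmorphism F -> K}) q l g i j : @evm F n K io g q != 0 ->
  redmx io q l g i j = evm io g (rednum q l i j) / evm io g q ^+ size l.
Proof.
move=> q0; have /matrixP/(_ i j) := rednumE l q0; rewrite !mxE => ->.
by rewrite mulrC mulKf // expf_neq0.
Qed.

(** One more row operation, with coefficient t / d; the common denominator becomes q * d. *)
Definition addop q (l : lw) a b (t d : MP) : lw := (a, b, t * q) :: [seq (x.1, x.2 * d) | x <- l].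

Lemma redmx_addop (K : fieldType) (io : {rmorphism F -> K}) q l a b t d g : @evm F n K io g (q * d) != 0 ->
  redmx io (q * d) (addop q l a b t d) g = xe a b (evm io g t / evm io g d) *m redmx io q l g.
Proof.
rewrite rmorphM mulf_eq0 negb_or => /andP[/= q0 d0].
rewrite /redmx /= mulmxA; congr (_ *m _ *m _).
  by rewrite !rmorphM /= [X in _ / X]mulrC -mulf_div divff // mulr1.
congr (wordmx _); rewrite /evw -map_comp; apply: eq_map => x /=.
by rewrite !rmorphM /= -mulf_div mulfV // mulr1.
Qed.

Lemma wf_addop q l a b t d : a != b -> wf l -> wf (addop q l a b t d).
Proof. by move=> nab wfl; rewrite /wf /= nab all_map. Qed.

Definition on_red (q : MP) l (P : forall K : fieldType, 'M[K]_n -> Prop) :=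
  forall (K : fieldType) (io : {rmorphism F -> K}) (g : 'M[K]_n), \det g = 1 ->
    evm io g q != 0 -> P K (redmx io q l g).

Definition cols_ok k (K : fieldType) (M : 'M[K]_n) :=
  forall r c : 'I_n, (c < k)%N -> M r c = (r == c)%:R.

Lemma det_redmx (K : fieldType) (io : {rmorphism F -> K}) q l g :
  wf l -> \det g = 1 -> \det (redmx io q l g) = 1.
Proof. by move=> wfl dg; rewrite det_mulmx dg mulr1 det_wordmx ?wf_evw. Qed.

(** If row operations reduce [g] to the identity wherever q is not zero, then their inverses
    factor [g], and [extends_path] applies. *)
Lemma radext_full q l : wf l -> on_red q l (cols_ok n) -> radext q.
Proof.
move=> wfl H; pose l' : lw := rev [seq (x.1, - x.2) | x <- l].
exists (m * size l').+1; apply: (extends_path nilT lieT); first by rewrite /wf all_rev all_map.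
move=> K io g dg q0.
have -> : evw io q g l' = winv (evw io q g l).
  rewrite /l' /winv /evw map_rev -!map_comp; congr rev; apply: eq_map => x /=.
  by rewrite rmorphN mulNr.
have E : redmx io q l g = 1%:M by apply/matrixP=> r c; rewrite (H K io g dg q0) ?mxE.
have := congr1 (mulmx (wordmx (winv (evw io q g l)))) E.
by rewrite /redmx mulmxA wordmxVK ?wf_evw // mul1mx mulmx1.
Qed.

Section Step.
Variables (k : nat) (kk : 'I_n).
Hypothesis kkE : kk = k :> nat.
Hypothesis IH : forall q l, wf l -> on_red q l (cols_ok k.+1) -> radext q.

Lemma cols_ok_xe (K : fieldType) (M : 'M[K]_n) (a b : 'I_n) t : (k <= b)%N ->
  cols_ok k M -> cols_ok k (xe a b t *m M).
Proof.
move=> kb ok r c ck; rewrite xe_mulE !ok // (_ : (b == c) = false) ?mulr0 ?addr0 //.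
by apply/eqP=> E; move: ck; rewrite -E ltnNge kb.
Qed.

(** With a pivot 1, the other entries of the column are removed one after the other.
    This multiplies q by a power of itself, which the radical absorbs. *)
Lemma radext_clear (s : seq 'I_n) q l : wf l ->
  on_red q l (fun K M => [/\ cols_ok k M, M kk kk = 1 &
     forall j, j \notin s -> j != kk -> M j kk = 0]) -> radext q.
Proof.
elim: s q l => [|j s IHs] q l wfl H.
  apply: (IH wfl) => K io g dg q0; have [ok M1 M0] := H K io g dg q0 => r c.
  rewrite ltnS leq_eqVlt => /orP[/eqP ck|]; last exact: ok.
  have -> : c = kk by apply/val_inj; rewrite /= ck kkE.
  by case: eqP => [->//|/eqP rk]; rewrite M0.
have [jk|njk] := eqVneq j kk.
  apply: (IHs q l wfl) => K io g dg q0; have [ok M1 M0] := H K io g dg q0; split=> // i is' nik.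
  by apply: M0; rewrite // inE negb_or is' jk nik.
pose d := q ^+ size l; pose t := - rednum q l j kk.
apply: (@radextX _ (size l).+1); rewrite exprS.
apply: (IHs _ (addop q l j kk t d)); first exact: wf_addop.
move=> K io g dg qd0; rewrite redmx_addop //.
have q0 : evm io g q != 0 by move: qd0; rewrite rmorphM mulf_eq0 negb_or => /andP[].
have [ok M1 M0] := H K io g dg q0.
split; first by apply: cols_ok_xe => //; rewrite kkE.
  by rewrite xe_mulE eq_sym (negPf njk) mul0r addr0.
move=> i is' nik; rewrite xe_mulE M1 mulr1.
have [->|nij] := eqVneq i j; last by rewrite mul0r addr0 M0 // inE negb_or nij.
by rewrite mul1r rednumEij // /t /d rmorphN rmorphXn mulNr subrr.
Qed.

Lemma radext_pivot1 q l : wf l ->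
  on_red q l (fun K M => cols_ok k M /\ M kk kk = 1) -> radext q.
Proof.
move=> wfl H; apply: (@radext_clear (enum 'I_n) q l wfl) => K io g dg q0.
by have [ok M1] := H K io g dg q0; split=> // j; rewrite mem_enum.
Qed.

(** An entry 1 in another row makes the pivot equal to 1; only powers of q are
    added to the denominator. *)
Lemma radext_pivot_from q l (j : 'I_n) : wf l -> j != kk -> (k <= j)%N ->
  on_red q l (fun K M => cols_ok k M /\ M j kk = 1) -> radext q.
Proof.
move=> wfl njk kj H; pose d := q ^+ size l; pose t := d - rednum q l kk kk.
apply: (@radextX _ (size l).+1); rewrite exprS.
apply: (@radext_pivot1 _ (addop q l kk j t d)); first by apply: wf_addop; rewrite // eq_sym.
move=> K io g dg qd0; rewrite redmx_addop //.
have q0 : evm io g q != 0 by move: qd0; rewrite rmorphM mulf_eq0 negb_or => /andP[].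
have [ok M1] := H K io g dg q0; split; first exact: cols_ok_xe.
rewrite xe_mulE M1 eqxx mul1r mulr1 rednumEij // /t rmorphB mulrBl /d !rmorphXn /=.
by rewrite divff ?expf_neq0 // addrC subrK.
Qed.

(** Where the entry [p] at row [i] is not zero, dividing by it produces an entry 1 in some row
    other than [i], hence a pivot 1. If [i] is the pivot row this needs a later row; if there is
    none, the pivot is already 1 because the determinant is 1. *)
Lemma radext_mul_entry q l (i : 'I_n) : wf l -> (k <= i)%N -> on_red q l (cols_ok k) ->
  radext (q * rednum q l i kk).
Proof.
move=> wfl ki H; set p := rednum q l i kk; pose D := q ^+ size l.
have make1 (j : 'I_n) : j != i -> (k <= j)%N ->
  on_red (q * p) (addop q l j i (D - rednum q l j kk) p) (fun K M => cols_ok k M /\ M j kk = 1).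
  move=> nji kj K io g dg qp0; rewrite redmx_addop //.
  move: (qp0); rewrite rmorphM mulf_eq0 negb_or => /andP[q0 p0].
  have ok := H K io g dg q0; split; first exact: cols_ok_xe.
  rewrite xe_mulE eqxx mul1r !rednumEij // -/p rmorphB /D rmorphXn mulrA divfK //.
  by rewrite mulrBl divff ?expf_neq0 // addrC subrK.
have [ik|nik] := eqVneq i kk; last first.
  apply: radext_pivot1 (make1 kk _ _); rewrite ?kkE //; last by rewrite eq_sym.
  by apply: wf_addop; rewrite // eq_sym.
have [lt|ge] := ltnP k.+1 n.
  pose j := Ordinal lt.
  have njk : j != kk by apply/eqP=> /(congr1 val) /=; rewrite kkE; lia.
  have nji : j != i by rewrite ik.
  have kj : (k <= j)%N by rewrite /j /=; lia.
  apply: (radext_pivot_from _ njk kj (make1 j nji kj)).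
  exact: wf_addop.
(* last column: the pivot is the determinant *)
rewrite mulrC; apply/radextM/(radext_pivot1 wfl) => K io g dg q0.
have ok := H K io g dg q0; split=> //.
have := det_redmx io q wfl dg; rewrite -det_tr det_trig.
  rewrite (bigD1 kk) //= big1 ?mulr1 ?mxE // => j njk; rewrite mxE ok ?eqxx //.
  have := ltn_ord j; move/eqP: njk => njk.
  have : j <> k :> nat by move=> E; apply: njk; apply/val_inj; rewrite /= kkE.
  lia.
apply/is_trig_mxP=> a b ab; rewrite mxE ok; last by have := ltn_ord b; lia.
by rewrite (_ : (b == a) = false) //; apply/eqP=> E; move: ab; rewrite E ltnn.
Qed.

(** The entries of the column [kk] from row [k] on have no common zero on the locus where q is
    not zero. Explicitly, the expansion of the determinant along this column writes a power of q
    as a combination of the elements q * p of [radext_mul_entry]. *)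
Lemma radext_step q l : wf l -> on_red q l (cols_ok k) -> radext q.
Proof.
move=> wfl H; set G := rednum q l.
have R : radext (\sum_(i : 'I_n | (k <= i)%N) \adj G kk i * (q * G i kk)).
  by apply: radext_sum => i ki; apply/radextM/radext_mul_entry.
apply: (@radextX _ (size l * n).+1); apply: radext_eq R => g dg.
have [q0|q0] := eqVneq (ev g q) 0.
  rewrite rmorphXn /= q0 expr0n rmorph_sum big1 // => i _.
  by rewrite !rmorphM /= q0 mul0r mulr0.
have ok := H F idfun g dg q0.
set M := redmx idfun q l g in ok; set c := ev g q ^+ size l.
have GE : map_mx (evm idfun g) G = c *: M by rewrite rednumE.
have adjG0 (i : 'I_n) : (i < k)%N -> ev g (\adj G kk i) = 0.
  move=> ik; have : (\adj (c *: M) *m (c *: M)) kk i = 0.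
    rewrite mul_adj_mx mxE (_ : (kk == i) = false) //.
    by apply/eqP=> E; move: ik; rewrite -E kkE ltnn.
  rewrite mxE (bigD1 i) //= big1 ?addr0 => [|j /negPf ji]; last by rewrite [X in _ * X]mxE ok // ji !mulr0.
  rewrite [X in _ * X]mxE ok // eqxx mulr1 => /eqP; rewrite mulf_eq0 expf_eq0 (negPf q0) andbF orbF.
  by rewrite -GE -map_mx_adj mxE => /eqP.
have : ev g ((\adj G *m G) kk kk) = c ^+ n.
  rewrite mul_adj_mx mxE eqxx mulr1n -det_map_mx GE detZ det_redmx // mulr1.
  by [].
rewrite mxE rmorph_sum (bigID (fun i : 'I_n => (k <= i)%N)) /= [X in _ + X]big1 ?addr0 => [E|i]; last first.
  by rewrite -ltnNge => ik; rewrite rmorphM /= adjG0 // mul0r.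
rewrite rmorphXn /= exprS exprM -/c -E mulr_sumr rmorph_sum; apply: eq_bigr => i _.
by rewrite !rmorphM /= mulrCA.
Qed.
End Step.

Lemma radext1 : radext 1.
Proof.
suff H : forall k, (k <= n)%N -> forall q l, wf l -> on_red q l (cols_ok (n - k)) -> radext q.
  by apply: (H n (leqnn n) _ [::]) => // K io g dg q0 r c; rewrite subnn.
elim=> [_ q l wfl|k IHk kn q l wfl]; first by rewrite subn0; apply: radext_full.
have lt : (n - k.+1 < n)%N by lia.
apply: (@radext_step _ (Ordinal lt)) => // q' l' wfl'.
by rewrite -subSn // subSS; apply: IHk => //; lia.
Qed.

(** By [radext1] the polynomial 1 is an admissible denominator. *)
Lemma wordrep_polynomial : exists2 Q : 'M[MP]_N,
  (forall w, wf w -> wordrep m T idfun w = map_mx (evm idfun (wordmx w)) Q) &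
  forall g : 'M[F]_n, \det g = 1 -> exists2 w, wf w & wordmx w = g.
Proof.
have [e] := radext1; rewrite expr1n => -[gen [Q HQ]].
exists Q => [w wfw|g dg]; first by rewrite -HQ // rmorph1 scale1r.
by apply: gen; rewrite ?rmorph1 ?oner_neq0.
Qed.
End Elim.

(** * Logarithms of unipotent matrices *)

Section Interpolation.
Variable F : numFieldType.

(** A polynomial has finitely many roots; the multiples of [c] are infinitely many. *)
Lemma poly_eq_nat (c : nat) (p q : {poly F}) : (0 < c)%N ->
  (forall a : nat, p.[(c * a)%:R] = q.[(c * a)%:R]) -> p = q.
Proof.
move=> c0 E; apply/eqP; rewrite -subr_eq0; apply/negPn/negP => nz.
have := @max_poly_roots _ (p - q) [seq (c * i)%:R | i <- iota 0 (size (p - q))] nz.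
rewrite size_map size_iota ltnn => H; suff: false by []; apply: H.
  by apply/allP=> x /mapP[i _ ->]; rewrite rootE !hornerE E subrr.
rewrite map_inj_uniq ?iota_uniq // => i j /eqP; rewrite eqr_nat eqn_pmul2l //.
by move/eqP.
Qed.

(** Polynomial matrices serve as one-parameter families: [mxev c] is the value at [c], and
    [lincoef] below the first-order term at 0, used to extract Lie algebra identities from group
    identities. *)
Definition mxev p q (c : F) (A : 'M[{poly F}]_(p, q)) : 'M[F]_(p, q) := map_mx (horner_eval c) A.
Definition mxder p q (A : 'M[{poly F}]_(p, q)) := map_mx (deriv : {poly F} -> {poly F}) A.

Lemma mxpoly_eq_nat p q (c : nat) (A B : 'M[{poly F}]_(p, q)) : (0 < c)%N ->
  (forall a : nat, mxev (c * a)%:R A = mxev (c * a)%:R B) -> A = B.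
Proof.
move=> c0 E; apply/matrixP=> i j; apply: (poly_eq_nat c0) => a.
by have /matrixP/(_ i j) := E a; rewrite !mxE.
Qed.

Lemma mxev_mul p q r c (A : 'M_(p, q)) (B : 'M_(q, r)) : mxev c (A *m B) = mxev c A *m mxev c B.
Proof. exact: map_mxM. Qed.
Lemma mxevD p q c (A B : 'M_(p, q)) : mxev c (A + B) = mxev c A + mxev c B.
Proof. exact: map_mxD. Qed.
Lemma mxevC p q c (A : 'M_(p, q)) : mxev c (map_mx polyC A) = A.
Proof. by apply/matrixP=> i j; rewrite !mxE /horner_eval hornerC. Qed.

Let derivM' (x y : {poly F}) : deriv (x * y) = deriv x * y + x * deriv y.
Proof. exact: derivM. Qed.
Let dC (c : F) : deriv c%:P = 0.
Proof. exact: derivC. Qed.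

Definition lincoef p q (A : 'M[{poly F}]_(p, q)) := mxev 0 (mxder A).
Lemma lincoef_mul p q r (A : 'M_(p, q)) (B : 'M_(q, r)) :
  lincoef (A *m B) = lincoef A *m mxev 0 B + mxev 0 A *m lincoef B.
Proof. by rewrite /lincoef /mxder (map_d_mul derivM') mxevD !mxev_mul. Qed.
Lemma lincoefD p q (A B : 'M_(p, q)) : lincoef (A + B) = lincoef A + lincoef B.
Proof. by rewrite /lincoef /mxder map_mxD mxevD. Qed.
Lemma lincoefC p q (A : 'M_(p, q)) : lincoef (map_mx polyC A) = 0.
Proof. by rewrite /lincoef /mxder (map_d_io dC) /mxev map_mx0. Qed.
Lemma lincoefXZ p q c (A : 'M_(p, q)) : lincoef ((c%:P * 'X) *: map_mx polyC A) = c *: A.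
Proof.
rewrite /lincoef /mxder (map_d_scale derivM') (map_d_io dC) scaler0 addr0.
rewrite /= derivM derivC mul0r add0r derivX mulr1 /mxev map_mxZ.
by rewrite /= /horner_eval hornerC -[map_mx _ _]/(mxev 0 _) mxevC.
Qed.

Variables (N' : nat).
Local Notation N := N'.+1.

Lemma texp_mxev m (T : 'M[F]_N) r c :
  mxev c (texp polyC m T r) = texp idfun m T r.[c].
Proof. by apply: map_texp => x; rewrite /= /horner_eval hornerC. Qed.

Lemma texp_ev0 m (T : 'M[F]_N) c : T ^+ m = 0 -> mxev 0 (texp polyC m T (c%:P * 'X)) = 1%:M.
Proof. by move=> Tm; rewrite texp_mxev !hornerE texp0. Qed.

Lemma texp_lincoef m (T : 'M[F]_N) c : T ^+ m = 0 -> lincoef (texp polyC m T (c%:P * 'X)) = c *: T.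
Proof.
move=> Tm; rewrite /lincoef /mxder (map_d_texp derivM' dC _ Tm).
rewrite /= derivM derivC mul0r add0r derivX mulr1 /mxev map_mxZ /= {1}/horner_eval hornerC map_mxM.
congr (_ *: _); rewrite -[RHS]mulmx1; congr (_ *m _); first exact: mxevC.
exact: texp_ev0.
Qed.

(** The polynomial whose values at natural numbers are the binomial coefficients. *)
Definition binpoly k : {poly F} := (k`!%:R^-1) *: \prod_(i < k) ('X - i%:R%:P).

Lemma binpolyE k (a : nat) : (binpoly k).[a%:R] = 'C(a, k)%:R.
Proof.
rewrite hornerZ horner_prod.
have -> : \prod_(i < k) ('X - i%:R%:P).[a%:R] = (a ^_ k)%:R :> F.
  elim: k => [|k IH]; first by rewrite big_ord0 ffactn0.
  rewrite big_ord_recr /= IH ffactnSr natrM hornerXsubC.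
  by case: (leqP k a) => ka; [rewrite natrB | rewrite ffact_small // !mul0r].
by rewrite -bin_ffact natrM mulrC mulfK // pnatr_eq0 -lt0n fact_gt0.
Qed.

Lemma size_binpoly k : (size (binpoly k) <= k.+1)%N.
Proof.
apply: leq_trans (size_scale_leq _ _) _.
by rewrite size_prod_XsubC /index_enum -enumT size_enum_ord.
Qed.

(** Put Z = Y - 1. Then Q(t) = sum_k binom(t, k) Z^k is a polynomial family with Q(a) = Y^a for
    natural a, hence Q(t + a) = Y^a Q(t). Its derivative at 0 is the logarithm L: the relation
    implies Q' = Q L, so the coefficients of Q are those of exp(t L), and L^m = 0 because the
    degree of Q is less than m. *)
Lemma unipotent_log m (Y : 'M[F]_N) : (Y - 1) ^+ m = 0 ->
  exists2 L : 'M[F]_N, L ^+ m = 0 & forall a : nat, Y ^+ a = texp idfun m L a%:R.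
Proof.
set Z := Y - 1 => Zm.
pose Q : 'M[{poly F}]_N := \sum_(k < m) binpoly k *: map_mx polyC (Z ^+ k).
have QE (a : nat) : mxev a%:R Q = Y ^+ a.
  transitivity (\sum_(k < m + a.+1) Z ^+ k *+ 'C(a, k)).
    rewrite /mxev /Q raddf_sum big_split_ord /= [X in _ = _ + X]big1 ?addr0 => [|k _]; last first.
      by rewrite exprD Zm mul0r mul0rn.
    apply: eq_bigr => k _; rewrite map_mxZ -[map_mx _ (map_mx _ _)]/(mxev _ _) mxevC.
    by rewrite /= /horner_eval binpolyE scaler_nat.
  rewrite addnC big_split_ord /= [X in _ + X]big1 ?addr0 => [|k _]; last first.
    by rewrite bin_small ?mulr0n // leq_addr.
  by rewrite -[Y](subrK 1) -/Z exprD1n.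
pose L := lincoef Q.
have shift (a : nat) : map_mx (comp_poly ('X + a%:R%:P)) Q = map_mx polyC (Y ^+ a) *m Q.
  apply: (@mxpoly_eq_nat _ _ 1) => // b; rewrite mul1n.
  transitivity (mxev (b + a)%:R Q).
    by apply/matrixP=> i j; rewrite !mxE /horner_eval horner_comp !hornerE natrD.
  by rewrite QE mxev_mul mxevC QE addnC exprD.
have ode : mxder Q = Q *m map_mx polyC L.
  apply: (@mxpoly_eq_nat _ _ 1) => // a; rewrite mul1n mxev_mul QE mxevC.
  have := congr1 (@lincoef _ _) (shift a); rewrite lincoef_mul lincoefC mul0mx add0r mxevC => <-.
  apply/matrixP=> i j; rewrite !mxE /horner_eval deriv_comp derivD derivX derivC addr0 mulr1.
  by rewrite horner_comp !hornerE.
pose cf k : 'M[F]_N := map_mx (fun p : {poly F} => p`_k) Q.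
have cfE k : cf k = dpow L k.
  elim: k => [|k IH].
    rewrite dpow0 -[1](expr0 Y) -QE; apply/matrixP=> i j.
    by rewrite !mxE /horner_eval horner_coef0.
  have E : cf k.+1 *+ k.+1 = cf k *m L.
    have /matrixP ode' := ode; apply/matrixP=> i j; have := congr1 (fun p : {poly F} => p`_k) (ode' i j).
    rewrite mulmxnE !mxE coef_deriv => ->; rewrite coef_sum; apply: eq_bigr => s _.
    by rewrite !mxE coefMC.
  have : cf k.+1 *+ k.+1 = dpow L k.+1 *+ k.+1 by rewrite E IH -dpowSr.
  move/(congr1 (fun X => (k.+1%:R^-1) *: X)) => /=.
  by rewrite -[cf _ *+ _]scaler_nat -[dpow _ _ *+ _]scaler_nat (scalerA _ _ (cf _)) (scalerA _ _ (dpow _ _)) mulVf ?pnatr_eq0 // !scale1r.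
have Lm : L ^+ m = 0.
  have : cf m = 0.
    apply/matrixP=> i j; rewrite !mxE nth_default // /Q summxE.
    apply: leq_trans (size_sum _ _ _) _; apply/bigmax_leqP=> k _; rewrite !mxE.
    by rewrite mulrC mul_polyC (leq_trans (size_scale_leq _ _)) // (leq_trans (size_binpoly k)).
  rewrite cfE /dpow => /(congr1 (fun X => m`!%:R *: X)) /=.
  by rewrite scalerA divff ?factS_neq0 // scale1r scaler0.
exists L => // a; rewrite -QE /texp; apply/matrixP=> i j.
rewrite !mxE /horner_eval (@horner_coef_wide _ m); last first.
  rewrite /Q summxE; apply: leq_trans (size_sum _ _ _) _; apply/bigmax_leqP=> k _; rewrite !mxE.
  by rewrite mulrC mul_polyC (leq_trans (size_scale_leq _ _)) // (leq_trans (size_binpoly k)).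
rewrite [RHS]summxE; apply: eq_bigr => k _.
by rewrite [RHS]mxE [X in _ = _ * X]mxE /= -cfE mxE mulrC.
Qed.

Lemma texp_scale m (T : 'M[F]_N) (c r : F) : texp idfun m (c *: T) r = texp idfun m T (c * r).
Proof.
apply: eq_bigr => k _; rewrite /dpow exprZn !map_mxZ /= !scalerA exprMn.
by congr (_ *: _); ring.
Qed.
End Interpolation.

Section Roots.
Variables (F : numClosedFieldType) (N' : nat).
Local Notation N := N'.+1.

(** On the eigenspace of X for lam, which P and Q preserve, P Q = lam Q P. Taking determinants,
    lam to the power of the dimension of the eigenspace is 1. *)
Lemma central_commutator_eigenvalue (X P Q : 'M[F]_N) lam : P \in unitmx -> Q \in unitmx ->
  P *m X = X *m P -> Q *m X = X *m Q -> P *m Q = X *m Q *m P ->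
  eigenvalue X lam -> lam ^+ N`! = 1.
Proof.
move=> uP uQ PX QX PQ ev; set E := eigenspace X lam.
have d0 : (0 < \rank E)%N by rewrite lt0n mxrank_eq0.
have [B [fB BX stab]] : exists B : 'M_(\rank E, N), [/\ row_free B, B *m X = lam *: B &
    forall R : 'M_N, R *m X = X *m R -> exists R', B *m R = R' *m B].
  exists (row_base E).
  have BX : row_base E *m X = lam *: row_base E by apply/eigenspaceP; rewrite eq_row_base.
  split=> // [|R RX]; first exact: row_base_free.
  apply/submxP; rewrite eq_row_base; apply/eigenspaceP.
  by rewrite -mulmxA RX mulmxA BX scalemxAl.
have [P' BP] := stab P PX; have [Q' BQ] := stab Q QX.
have inj := row_free_inj fB.
have PQ' : P' *m Q' = lam *: (Q' *m P').
  apply: inj; rewrite -mulmxA -BQ mulmxA -BP -mulmxA PQ !mulmxA BX.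
  by rewrite -!scalemxAl BQ -mulmxA BP mulmxA.
have unit (R : 'M_N) R' : R \in unitmx -> B *m R = R' *m B -> \det R' != 0.
  move=> uR BR; rewrite -unitfE -unitmxE -row_free_unit -kermx_eq0; apply/eqP/row_matrixP=> i.
  rewrite row0; apply: inj; rewrite mul0mx; apply: (row_free_inj (A := R)).
    by rewrite row_free_unit.
  by rewrite mul0mx -mulmxA BR mulmxA -row_mul mulmx_ker row0 mul0mx.
have := congr1 (@determinant _ _) PQ'; rewrite detZ !det_mulmx mulrC.
rewrite -{1}[_ * _]mul1r => /mulIf E1.
have lamd : lam ^+ \rank E = 1.
  by apply/esym/E1; rewrite mulf_neq0 ?(unit _ _ uP BP) ?(unit _ _ uQ BQ).
have /dvdnP[c ->] : (\rank E %| N`!)%N by rewrite dvdn_fact // d0 rank_leq_row.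
by rewrite mulnC exprM lamd expr1n.
Qed.

(** The characteristic polynomial divides (t^m - 1)^N; apply the theorem of Cayley and Hamilton. *)
Lemma unipotent_of_eigenvalues (X : 'M[F]_N) m : (forall lam, eigenvalue X lam -> lam ^+ m = 1) ->
  (X ^+ m - 1) ^+ N = 0.
Proof.
move=> H; have [rs rsE] := closed_field_poly_normal (char_poly X).
have lc : lead_coef (char_poly X) = 1 by apply/eqP/char_poly_monic.
rewrite lc scale1r in rsE.
have sz : size rs = N.
  by have := size_char_poly X; rewrite rsE size_prod_XsubC => -[].
have dv : char_poly X %| ('X^m - 1) ^+ N.
  rewrite rsE -sz.
  have : forall x, x \in rs -> 'X - x%:P %| 'X^m - 1.
    move=> x xr; rewrite dvdp_XsubCl rootE !hornerE subr_eq0; apply/eqP/H.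
    by rewrite eigenvalue_root_char rsE root_prod_XsubC.
  elim: rs {rsE sz} => [|x s IH] Hs; first by rewrite big_nil dvd1p.
  rewrite big_cons /= exprS dvdp_mul //; first by apply: Hs; rewrite mem_head.
  by apply: IH => y ys; apply: Hs; rewrite inE ys orbT.
have /dvdpP[q qE] := dv.
have := congr1 (horner_mx X) qE.
rewrite rmorphM /= Cayley_Hamilton mulr0 rmorphXn rmorphB rmorphXn rmorph1 /= horner_mx_X.
by [].
Qed.
End Roots.

(** * Logarithms of the images of elementary matrices *)

(** Commutator identities need auxiliary indices away from the given ones. *)
Lemma fresh_ord n (s : seq 'I_n) : (size s < n)%N -> exists p, p \notin s.
Proof.
move=> lt; apply/existsP; rewrite -negb_forall; apply/negP => /forallP H.
have : (#|'I_n| <= size s)%N.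
  by apply: leq_trans (card_size s); apply/subset_leq_card/subsetP => x _; apply: H.
by rewrite card_ord leqNgt lt.
Qed.

Section Multiplicative.
Variables (F : fieldType) (n N' : nat).
Local Notation N := N'.+1.
Variable ph : 'M[int]_n -> 'M[F]_N.
Hypothesis ph1 : ph 1%:M = 1%:M.
Hypothesis phM : forall g h, \det g = 1 -> \det h = 1 -> ph (g *m h) = ph g *m ph h.

Lemma ph_unit g : \det g = 1 -> ph g \in unitmx.
Proof.
move=> dg; have dg' : \det (invmx g) = 1 by rewrite det_inv dg invr1.
have : ph g *m ph (invmx g) = 1%:M.
  by rewrite -phM // mulmxV // unitmxE dg unitr1.
by case/mulmx1_unit.
Qed.

Lemma ph_xeM i j a b : i != j -> ph (xe i j (a + b)) = ph (xe i j a) *m ph (xe i j b).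
Proof. by move=> nij; rewrite -phM ?det_xe // xeD. Qed.

Lemma ph_xeX i j a (k : nat) : i != j -> ph (xe i j (a * k%:R)) = ph (xe i j a) ^+ k.
Proof.
move=> nij; elim: k => [|k IH]; first by rewrite mulr0 xe0 ph1 expr0.
by rewrite -natr1 mulrDr mulr1 ph_xeM // IH exprSr.
Qed.

Lemma ph_steinberg i j k a b : i != j -> j != k -> i != k ->
  ph (xe i j a) *m ph (xe j k b) = ph (xe i k (a * b)) *m ph (xe j k b) *m ph (xe i j a).
Proof.
move=> nij njk nik; rewrite -phM ?det_xe // xe_steinberg //.
by rewrite !phM ?det_mulmx ?det_xe ?mulr1.
Qed.

Lemma ph_comm i j k l a b : i != j -> k != l -> j != k -> i != l ->
  ph (xe i j a) *m ph (xe k l b) = ph (xe k l b) *m ph (xe i j a).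
Proof. by move=> nij nkl njk nil; rewrite -!phM ?det_xe // xe_comm. Qed.
End Multiplicative.

Section Logs.
Variables (F : numClosedFieldType) (n N' : nat).
Local Notation N := N'.+1.
Hypothesis n4 : (4 < n)%N.
Variable ph : 'M[int]_n -> 'M[F]_N.
Hypothesis ph1 : ph 1%:M = 1%:M.
Hypothesis phM : forall g h, \det g = 1 -> \det h = 1 -> ph (g *m h) = ph g *m ph h.

Lemma fresh3 (i j k : 'I_n) : exists p, [/\ p != i, p != j & p != k].
Proof.
have [|p] := @fresh_ord n [:: i; j; k]; first by rewrite /=; lia.
by rewrite !inE !negb_or => /and3P[]; exists p.
Qed.

Let m := N`!.
Lemma m_gt0 : (0 < m)%N. Proof. exact: fact_gt0. Qed.

(** [xe i j 1] is the commutator of [xe i k 1] and [xe k j 1], which commute with it. *)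
Lemma ph_xe_unipotent i j : i != j -> (ph (xe i j 1) ^+ m - 1) ^+ N = 0.
Proof.
move=> nij; apply: unipotent_of_eigenvalues => lam.
have [k [nki nkj _]] := fresh3 i j j.
have nik : i != k by rewrite eq_sym.
have nji : j != i by rewrite eq_sym.
apply: (@central_commutator_eigenvalue _ _ _ (ph (xe i k 1)) (ph (xe k j 1))).
- by apply: (ph_unit ph1 phM); rewrite det_xe.
- by apply: (ph_unit ph1 phM); rewrite det_xe.
- exact: (ph_comm phM).
- exact: (ph_comm phM).
- by rewrite (ph_steinberg phM) // mulr1.
Qed.

(** The logarithm of phi(X_ij)^(N!), divided by N!. *)
Lemma log_family : exists L : 'I_n -> 'I_n -> 'M[F]_N, forall i j, i != j ->
  L i j ^+ N = 0 /\ forall a : nat, ph (xe i j (m * a)%:R) = texp idfun N (L i j) (m * a)%:R.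
Proof.
apply: (@fin_all_exists _ _ (fun i (f : 'I_n -> 'M[F]_N) => forall j, i != j ->
  f j ^+ N = 0 /\ forall a : nat, ph (xe i j (m * a)%:R) = texp idfun N (f j) (m * a)%:R)) => i.
apply: (@fin_all_exists _ _ (fun j (T : 'M[F]_N) => i != j ->
  T ^+ N = 0 /\ forall a : nat, ph (xe i j (m * a)%:R) = texp idfun N T (m * a)%:R)) => j.
have [->|nij] := eqVneq i j; first by exists 0 => /eqP[].
have [L LN LE] := unipotent_log (ph_xe_unipotent nij).
exists (m%:R^-1 *: L) => _; split=> [|a]; first by rewrite exprZn LN scaler0.
have m0 : m%:R != 0 :> F by rewrite pnatr_eq0 -lt0n m_gt0.
rewrite texp_scale [in RHS]natrM mulKf // -LE -exprM -[X in xe i j X]mul1r.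
by rewrite (ph_xeX ph1 phM).
Qed.

Variable L : 'I_n -> 'I_n -> 'M[F]_N.
Hypothesis nilL : forall i j, i != j -> L i j ^+ N = 0.
Hypothesis expL : forall i j (a : nat), i != j ->
  ph (xe i j (m * a)%:R) = texp idfun N (L i j) (m * a)%:R.

Local Notation E i j c := (texp polyC N (L i j) (c%:P * 'X)).

Lemma mxev_E i j (c : F) (b : F) : mxev b (E i j c) = texp idfun N (L i j) (c * b).
Proof. by rewrite texp_mxev !hornerE. Qed.

(** Group commutation relations hold for the parameters that are multiples of N!, hence
    as polynomial identities in the parameter; the coefficient of degree 1 is the claim. The next
    lemmas follow in the same way, the last two by varying the remaining parameter as well. *)
Lemma conj_log i j k (a : nat) : i != j -> j != k -> i != k ->
  ph (xe i j a%:R) *m L j k = (L j k + a%:R *: L i k) *m ph (xe i j a%:R).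
Proof.
move=> nij njk nik; set X := ph _.
have key : map_mx polyC X *m E j k 1 = E i k a%:R *m E j k 1 *m map_mx polyC X.
  apply: (mxpoly_eq_nat m_gt0) => b; rewrite !mxev_mul !mxevC !mxev_E mul1r -!expL //.
  by rewrite -natrM mulnCA -expL // /X (ph_steinberg phM) // -natrM mulnCA.
have := congr1 (@lincoef _ _ _) key; rewrite !lincoef_mul !lincoefC !texp_lincoef ?nilL // !mxevC.
rewrite !texp_ev0 ?nilL // !scale1r mul0mx add0r mul1mx mulmx1 mulmx0 addr0 => ->.
by rewrite addrC.
Qed.

Lemma comm_log i j k l (a : nat) : i != j -> k != l -> j != k -> i != l ->
  ph (xe i j a%:R) *m L k l = L k l *m ph (xe i j a%:R).
Proof.
move=> nij nkl njk nil; set X := ph _.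
have key : map_mx polyC X *m E k l 1 = E k l 1 *m map_mx polyC X.
  apply: (mxpoly_eq_nat m_gt0) => b; rewrite !mxev_mul !mxevC !mxev_E mul1r -!expL //.
  by rewrite /X (ph_comm phM).
have := congr1 (@lincoef _ _ _) key; rewrite !lincoef_mul !lincoefC !texp_lincoef ?nilL // !mxevC.
by rewrite !scale1r mul0mx add0r mulmx0 addr0.
Qed.

Lemma conj_log' i j k (a : nat) : i != j -> k != i -> k != j ->
  L k i *m ph (xe i j a%:R) = ph (xe i j a%:R) *m L k i + a%:R *: (L k j *m ph (xe i j a%:R)).
Proof.
move=> nij nki nkj; set X := ph _.
have key : E k i 1 *m map_mx polyC X = E k j a%:R *m map_mx polyC X *m E k i 1.
  apply: (mxpoly_eq_nat m_gt0) => b; rewrite !mxev_mul !mxevC !mxev_E mul1r -!expL //.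
  rewrite -natrM mulnCA -expL // /X (ph_steinberg phM) // -natrM -mulnA (mulnC b a).
  by [].
have := congr1 (@lincoef _ _ _) key; rewrite !lincoef_mul !lincoefC !texp_lincoef ?nilL // !mxevC.
rewrite mxev_mul mxevC !texp_ev0 ?nilL // !scale1r !mulmx0 !addr0 mulmx1 mul1mx => ->.
by rewrite addrC -scalemxAl.
Qed.

Lemma log_bracket i j k : i != j -> j != k -> i != k ->
  L i j *m L j k - L j k *m L i j = L i k.
Proof.
move=> nij njk nik.
have key : E i j 1 *m map_mx polyC (L j k) =
   (map_mx polyC (L j k) + (1%:P * 'X) *: map_mx polyC (L i k)) *m E i j 1.
  apply: (mxpoly_eq_nat m_gt0) => b; rewrite !mxev_mul mxevD !mxevC !mxev_E mul1r -expL // conj_log //.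
  by congr ((_ + _) *m _); apply/matrixP=> r c; rewrite !mxE /horner_eval !hornerE.
have := congr1 (@lincoef _ _ _) key; rewrite !lincoef_mul lincoefD !lincoefC lincoefXZ !texp_lincoef ?nilL //.
rewrite mxevD !mxevC !texp_ev0 ?nilL // !scale1r mulmx0 !addr0 add0r mulmx1.
rewrite (_ : mxev 0 (_ *: _) = 0) ?addr0 => [->|].
  by rewrite addrK.
by apply/matrixP=> r c; rewrite !mxE /horner_eval !hornerE ?mulr0 ?mul0r.
Qed.

Lemma log_comm i j k l : i != j -> k != l -> j != k -> i != l ->
  L i j *m L k l = L k l *m L i j.
Proof.
move=> nij nkl njk nil.
have key : E i j 1 *m map_mx polyC (L k l) = map_mx polyC (L k l) *m E i j 1.
  by apply: (mxpoly_eq_nat m_gt0) => b; rewrite !mxev_mul !mxevC !mxev_E mul1r -expL // comm_log.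
have := congr1 (@lincoef _ _ _) key; rewrite !lincoef_mul !lincoefC !texp_lincoef ?nilL // !mxevC.
by rewrite !scale1r mul0mx add0r mulmx0 addr0.
Qed.
End Logs.

(** * From the brackets of root vectors to a representation of gl_n *)

Section Brackets.
Variables (F : numFieldType) (n N : nat).
Hypothesis n4 : (4 < n)%N.
Variable L : 'I_n -> 'I_n -> 'M[F]_N.

Definition br (A B : 'M[F]_N) := A *m B - B *m A.

Hypothesis brL : forall i j k, i != j -> j != k -> i != k -> br (L i j) (L j k) = L i k.
Hypothesis brC : forall i j k l, i != j -> k != l -> j != k -> i != l -> br (L i j) (L k l) = 0.

Lemma br_anti A B : br A B = - br B A.
Proof. by rewrite /br opprB. Qed.

Lemma jacobi A B C : br A (br B C) = br (br A B) C + br B (br A C).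
Proof.
rewrite /br !mulmxBl !mulmxBr !mulmxA.
set a := A *m B *m C; set b := A *m C *m B; set c := B *m C *m A.
set d := C *m B *m A; set e := B *m A *m C; set f := C *m A *m B.
rewrite !opprB !addrA.
by apply/matrixP=> x y; rewrite !mxE; ring.
Qed.

Lemma brDr A B C : br A (B + C) = br A B + br A C.
Proof. by rewrite /br mulmxDr mulmxDl opprD addrACA. Qed.
Lemma brNr A B : br A (- B) = - br A B.
Proof. by rewrite /br mulmxN mulNmx opprD opprK. Qed.
Lemma br0r A : br A 0 = 0. Proof. by rewrite /br mulmx0 mul0mx subrr. Qed.
Lemma br0l A : br 0 A = 0. Proof. by rewrite /br mulmx0 mul0mx subrr. Qed.
Lemma brZr A c B : br A (c *: B) = c *: br A B.
Proof. by rewrite /br -scalemxAr -scalemxAl scalerBr. Qed.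
Lemma br_sumr (I : finType) A (f : I -> 'M[F]_N) : br A (\sum_i f i) = \sum_i br A (f i).
Proof. by rewrite /br mulmx_sumr mulmx_suml sumrB. Qed.

(** The image of e_ii - e_jj. *)
Definition coroot i j := if i == j then 0 else br (L i j) (L j i).

Lemma coroot_anti i j : coroot j i = - coroot i j.
Proof. by rewrite /coroot eq_sym; case: eqP => [|_]; rewrite ?oppr0 // -br_anti. Qed.

(** Write L_ji as the bracket of L_jk and L_ki, and use the Jacobi identity. *)
Lemma coroot_cocycle i j k : coroot i j = coroot i k - coroot j k.
Proof.
have [->|nij] := eqVneq i j; first by rewrite subrr /coroot eqxx.
have [->|nik] := eqVneq i k; first by rewrite {2}/coroot eqxx sub0r -coroot_anti.
have [->|njk] := eqVneq j k; first by rewrite {3}/coroot eqxx subr0.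
have [nji nki nkj] : [/\ j != i, k != i & k != j] by rewrite ![_ == i]eq_sym [k == j]eq_sym.
rewrite /coroot (negPf nij) (negPf nik) (negPf njk).
by rewrite -{1}(@brL j k i) // jacobi (@brL i j k) // (br_anti (L i j)) (@brL k i j) // brNr.
Qed.

(** The auxiliary index [p] avoids [i] and [j], so that all brackets in the Jacobi identity are
    given. [br_cartan] reduces the general case to this one. *)
Lemma br_coroot_fresh i j k p : i != j -> p != i -> p != j -> p != k ->
  br (L i j) (coroot k p) = ((j == k)%:R - (i == k)%:R) *: L i j.
Proof.
move=> nij npi npj npk.
have [nji nip njp nkp] : [/\ j != i, i != p, j != p & k != p] by rewrite ![_ == p]eq_sym eq_sym.
rewrite /coroot (negPf nkp) jacobi.
have [jk|njk] := eqVneq j k.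
  rewrite -jk (negPf nij) subr0 scale1r (@brL i j p) // (@brL i p j) // (@brC i j p j) //.
  by rewrite br0r addr0.
have [ik|nik] := eqVneq i k.
  by rewrite sub0r scaleN1r -ik (@brC i j i p) // br0l add0r (br_anti _ (L p i)) (@brL p i j) // brNr (@brL i p j) .
by rewrite subrr scale0r !brC ?br0l ?br0r ?addr0 // eq_sym.
Qed.

(** The image of e_ii minus the n-th part of the identity: its differences are the coroots, and
    averaging over k makes it independent of choices. *)
Definition cartan i := n%:R^-1 *: \sum_k coroot i k.

Lemma n_neq0 : n%:R != 0 :> F.
Proof. by rewrite pnatr_eq0; case: n n4. Qed.

Lemma cartanB i j : cartan i - cartan j = coroot i j.
Proof.
rewrite /cartan -scalerBr -sumrB (eq_bigr (fun _ => coroot i j)) => [|k _]; last first.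
  by rewrite -coroot_cocycle.
by rewrite sumr_const card_ord -scaler_nat scalerA mulVf ?n_neq0 // scale1r.
Qed.

Lemma br_cartan i j k : i != j -> br (L i j) (cartan k) = ((j == k)%:R - (i == k)%:R) *: L i j.
Proof.
move=> nij; have [p [npi npj npk]] := fresh3 n4 i j k.
have -> : cartan k = cartan p + coroot k p by rewrite -cartanB addrC subrK.
rewrite brDr br_coroot_fresh // /cartan brZr br_sumr.
rewrite (eq_bigr (fun l => (- ((j == l)%:R - (i == l)%:R)) *: L i j)) => [|l _]; last first.
  have [<-|npl] := eqVneq p l.
    rewrite /coroot eqxx br0r [j == p]eq_sym [i == p]eq_sym (negPf npj) (negPf npi).
    by rewrite subrr oppr0 scale0r.
  by rewrite coroot_anti brNr br_coroot_fresh // scaleNr.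
rewrite -scaler_suml sumrN sumrB.
have s1 (x : 'I_n) : \sum_l (x == l)%:R = 1 :> F.
  by rewrite (bigD1 x) //= eqxx big1 ?addr0 // => l /negPf; rewrite eq_sym => ->.
by rewrite !s1 subrr oppr0 scale0r scaler0 add0r.
Qed.

(** A representation of gl_n whose restriction to sl_n is the given one; the full set of matrix
    units makes the bracket formula uniform. *)
Definition lie_ext i j := if i == j then cartan i else L i j.

Lemma lie_extP i j k l : i != j ->
  lie_ext i j *m lie_ext k l - lie_ext k l *m lie_ext i j =
  (j == k)%:R *: lie_ext i l - (l == i)%:R *: lie_ext k j.
Proof.
move=> nij; rewrite -/(br _ _) {1}/lie_ext (negPf nij).
have [->|nkl] := eqVneq k l.
  rewrite {1}/lie_ext eqxx br_cartan // scalerBl [l == i]eq_sym /lie_ext; congr (_ - _).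
    by case: (j =P l) => [<-|_]; rewrite ?scale0r // (negPf nij).
  by case: (i =P l) => [<-|_]; rewrite ?scale0r // (negPf nij).
rewrite {1}/lie_ext (negPf nkl).
have [jk|njk] := eqVneq j k; have [li|nli] := eqVneq l i.
- by rewrite -jk li !scale1r /lie_ext !eqxx cartanB /coroot (negPf nij).
- rewrite -jk scale1r scale0r subr0 /lie_ext [i == l]eq_sym (negPf nli) brL //.
    by rewrite jk.
  by rewrite eq_sym.
- rewrite li scale0r scale1r sub0r /lie_ext [k == j]eq_sym (negPf njk) br_anti brL //.
    by rewrite -li.
  by rewrite eq_sym.
by rewrite !scale0r subrr brC // eq_sym.
Qed.
End Brackets.

(** * Splitting off the algebraic part *)

Section Decompose.
Variables (F : numClosedFieldType) (n N' : nat).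
Local Notation N := N'.+1.
Local Notation MP := {mpoly F[n * n]}.
Hypothesis n4 : (4 < n)%N.
Variable ph : 'M[int]_n -> 'M[F]_N.
Hypothesis ph1 : ph 1%:M = 1%:M.
Hypothesis phM : forall g h, \det g = 1 -> \det h = 1 -> ph (g *m h) = ph g *m ph h.
Variable L : 'I_n -> 'I_n -> 'M[F]_N.
Hypothesis nilL : forall i j, i != j -> L i j ^+ N = 0.
Hypothesis expL : forall i j (a : nat), i != j ->
  ph (xe i j (N`! * a)%:R) = texp idfun N (L i j) (N`! * a)%:R.

Let T := lie_ext L.
Let TE i j : i != j -> T i j = L i j.
Proof. by move=> nij; rewrite /T /lie_ext (negPf nij). Qed.
Let nilT i j : i != j -> T i j ^+ N = 0.
Proof. by move=> nij; rewrite TE ?nilL. Qed.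
Let brL i j k : i != j -> j != k -> i != k -> br (L i j) (L j k) = L i k.
Proof. by move=> nij njk nik; apply: (log_bracket phM nilL expL). Qed.
Let lieT i j k l : i != j ->
  T i j *m T k l - T k l *m T i j = (j == k)%:R *: T i l - (l == i)%:R *: T k j.
Proof.
apply: lie_extP => // {}i {}j {}k {}l nij nkl njk nil.
by rewrite /br (log_comm phM nilL expL nij nkl njk nil) subrr.
Qed.

Local Notation U i j r := (texp idfun N (L i j) r).

(** The L_kl generate the image of the Lie algebra, so this is the commutant of the algebraic part. *)
Definition in_commutant (M : 'M[F]_N) := forall k l, k != l -> M *m L k l = L k l *m M.

Lemma texp_conj_log i j r Y Z : i != j -> xe i j r *m Y = Z *m xe i j r ->
  U i j r *m lrho T idfun Y = lrho T idfun Z *m U i j r.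
Proof.
move=> nij E; have [Z' E1 E2] := texp_conj nilT lieT idfun r Y nij.
rewrite TE // in E1; rewrite E1; congr (lrho _ _ _ *m _).
have : Z' *m xe i j r = Z *m xe i j r by rewrite -E2 -E.
by move/(congr1 (mulmx^~ (xe i j (- r)))); rewrite -!mulmxA !xeK // !mulmx1.
Qed.

(** phi(X_ij(a)) acts on the L_kl as X_ij(a) acts on matrix units. The case of the matrix
    unit opposite to (i, j), where the result would involve the diagonal, is left out. *)
Lemma ph_conj_log i j k l (a : nat) : i != j -> k != l -> ~~ ((k == j) && (l == i)) ->
  exists2 Z, xe i j a%:R *m delta_mx k l = Z *m xe i j a%:R &
   ph (xe i j a%:R) *m L k l = lrho T idfun Z *m ph (xe i j a%:R).
Proof.
move=> nij nkl nkjli.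
have [nji nlk] : j != i /\ l != k by rewrite ![_ == i]eq_sym [l == k]eq_sym.
have [kj|nkj] := eqVneq k j.
  have li : l != i by move: nkjli; rewrite kj eqxx.
  exists (delta_mx k l + a%:R *: delta_mx i l).
    rewrite /xe mulmxDl mul1mx mulmxDr mulmx1 -scalemxAl mulmxDl -!scalemxAr -scalemxAl.
    rewrite !mul_delta_mx_cond (negPf li) !mulr0n !(scaler0, addr0).
    by rewrite kj eqxx.
  rewrite lrhoD lrhoZ !lrho_delta !map_mx_id // !TE //; last by rewrite eq_sym.
  by rewrite kj (conj_log phM nilL expL) // -?kj // eq_sym.
have njk : j != k by rewrite eq_sym.
have [li|nli] := eqVneq l i.
  exists (delta_mx k l - a%:R *: delta_mx k j).
    rewrite /xe mulmxDl mul1mx mulmxBl.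
    rewrite !mulmxDr !mulmx1 -!scalemxAl -!scalemxAr !mul_delta_mx_cond (negPf nji) (negPf njk) li eqxx.
    rewrite !mulr0n !(scaler0, addr0, subr0) mulr1n.
    by rewrite addrK.
  rewrite lrhoD lrhoN lrhoZ !lrho_delta !map_mx_id // !TE // mulmxBl -scalemxAl.
  by rewrite li (conj_log' phM nilL expL) // -?li ?addrK // .
exists (delta_mx k l).
  rewrite /xe mulmxDl mul1mx mulmxDr mulmx1 -scalemxAl -scalemxAr.
  by rewrite !mul_delta_mx_cond (negPf nli) (negPf njk) !mulr0n !scaler0.
rewrite lrho_delta map_mx_id // TE //.
by apply: (comm_log phM nilL expL) => //; rewrite eq_sym.
Qed.

(** The excluded L_ji is the bracket of L_jp and L_pi for any third index p. *)
Lemma commutant_full M i j : i != j ->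
  (forall k l, k != l -> ~~ ((k == j) && (l == i)) -> M *m L k l = L k l *m M) -> in_commutant M.
Proof.
move=> nij H k l nkl; case: (boolP ((k == j) && (l == i))) => [/andP[/eqP-> /eqP->]|]; last exact: H.
have [p [npi npj _]] := fresh3 n4 i j j.
have [njp nji] : j != p /\ j != i by rewrite eq_sym npj eq_sym nij.
have H1 : M *m L j p = L j p *m M by apply: H; rewrite // (negPf npi) andbF.
have H2 : M *m L p i = L p i *m M by apply: H; rewrite // (negPf npj).
rewrite -(brL njp npi nji) /br mulmxBr mulmxBl.
by rewrite mulmxA H1 -mulmxA H2 mulmxA (mulmxA M) H2 -!mulmxA H1.
Qed.

Lemma in_commutant_texp M i j r : in_commutant M -> i != j -> M *m U i j r = U i j r *m M.
Proof.
move=> cM nij; rewrite mulmx_sumr mulmx_suml; apply: eq_bigr => k _.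
rewrite -scalemxAl -scalemxAr map_mx_id // /dpow -!scalemxAl -!scalemxAr; congr (_ *: (_ *: _)).
elim: (k : nat) => [|s IH]; first by rewrite expr0 mulmx1 mul1mx.
by rewrite exprS -[_ * _]/(_ *m _) mulmxA cM // -mulmxA IH mulmxA.
Qed.

(** Both factors act on the L_kl by conjugation in the same way. *)
Lemma commutant_xe_nat i j (a : nat) : i != j -> in_commutant (U i j (- a%:R) *m ph (xe i j a%:R)).
Proof.
move=> nij; apply: (commutant_full nij) => k l nkl nn.
have [Z E1 E2] := ph_conj_log a nij nkl nn.
rewrite -mulmxA E2 !mulmxA; congr (_ *m _).
have E3 := texp_conj_log nij (r := a%:R) _.
have {}E1 : xe i j (a%:R : F) *m delta_mx k l = Z *m xe i j a%:R.
  by [].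
have := E3 _ _ E1; rewrite lrho_delta map_mx_id // TE // => E4.
have := congr1 (fun M => U i j (- a%:R) *m M *m U i j (- a%:R)) E4.
have K := texpK idfun a%:R (nilL nij).
have K' : U i j (- a%:R) *m U i j a%:R = 1%:M by apply: mulmx1C.
by rewrite mulmxA K' mul1mx -!mulmxA K mulmx1 => ->.
Qed.

Lemma commutant_xe i j (a : int) : i != j -> in_commutant (U i j (- a%:~R) *m ph (xe i j a)).
Proof.
move=> nij; case: (intP a) => [|b|b].
- by rewrite mulr0z; apply: (commutant_xe_nat 0).
- by have := commutant_xe_nat b.+1 nij; rewrite natz.
set s := U i j (- b.+1%:R) *m ph (xe i j b.+1%:R).
have cs : in_commutant s := commutant_xe_nat b.+1 nij.
have K := texpK idfun b.+1%:R (nilL nij).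
have sE : ph (xe i j b.+1%:R) *m U i j (- b.+1%:R) = s.
  have : U i j b.+1%:R *m s *m U i j (- b.+1%:R) = s.
    by rewrite -in_commutant_texp // -mulmxA K mulmx1.
  by rewrite /s !mulmxA K mul1mx.
rewrite mulrNz opprK; set s' := _ *m _.
have s'E : s' = U i j b.+1%:R *m ph (xe i j (- b.+1%:R)) by rewrite /s' natz.
have ss' : s' *m s = 1%:M.
  rewrite s'E -sE mulmxA -(mulmxA (U _ _ _)) -(phM) ?det_xe // xeNK // ph1 mulmx1.
  exact: K.
have s's := mulmx1C ss'.
clearbody s' s.
move=> k l nkl; have /= := congr1 (fun M => s' *m M *m s') (cs k l nkl).
by rewrite !mulmxA ss' mul1mx -!mulmxA s's mulmx1 => ->.
Qed.

(** The values of sigma commute with [alg]: this holds on elementary matrices and is preserved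
    by products, which at the same time yields multiplicativity. On X_ij(N!) the factors of sigma
    cancel, as phi(X_ij(N!)) is the exponential. *)
Lemma algebraic_part : exists Q : 'M[MP]_N,
  let alg (K : 'M[F]_n) : 'M[F]_N := map_mx (evm idfun K) Q in
  let sigma g := ph g *m alg (map_mx intr (invmx g)) in
  [/\ alg 1%:M = 1%:M,
      forall g h, \det g = 1 -> \det h = 1 -> alg (g *m h) = alg g *m alg h,
      forall g, \det g = 1 -> sigma g *m alg (map_mx intr g) = ph g,
      forall g h, \det g = 1 -> \det h = 1 -> sigma (g *m h) = sigma g *m sigma h &
      forall i j, i != j -> sigma (xe i j (N`!)%:R) = 1%:M].
Proof.
have [Q QE gen] := wordrep_polynomial nilT lieT.
exists Q => alg sigma.
have algW w : wf w -> alg (wordmx w) = wordrep N T idfun w by move/QE ->.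
have alg1 : alg 1%:M = 1%:M by rewrite -[1%:M]/(wordmx [::]) algW.
have algM g h : \det g = 1 -> \det h = 1 -> alg (g *m h) = alg g *m alg h.
  move=> /gen[w wfw <-] /gen[w' wfw' <-].
  by rewrite -wordmx_cat !algW ?wf_cat ?wfw // wordrep_cat.
have algx i j r : i != j -> alg (xe i j r) = U i j r.
  by move=> nij; have := algW [:: (i, j, r)]; rewrite /= !mulmx1 nij TE //; apply.
have dmap g : \det g = 1 -> \det (map_mx intr g : 'M[F]_n) = 1 by rewrite det_map_mx => ->; rewrite rmorph1.
have dinv (g : 'M[int]_n) : \det g = 1 -> \det (invmx g) = 1 by rewrite det_inv => ->; rewrite invr1.
have uni (g : 'M[int]_n) : \det g = 1 -> g \in unitmx by move=> dg; rewrite unitmxE dg unitr1.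
have invmxM (g h : 'M[int]_n) : g \in unitmx -> h \in unitmx -> invmx (g *m h) = invmx h *m invmx g.
  move=> ug uh; have ugh : g *m h \in unitmx by rewrite unitmx_mul ug.
  apply: (can_inj (mulKmx ugh)); rewrite mulmxV // -mulmxA (mulmxA h) mulmxV // mul1mx mulmxV //.
have algK g : \det g = 1 -> alg (map_mx intr (invmx g)) *m alg (map_mx intr g) = 1%:M.
  by move=> dg; rewrite -algM ?dmap ?dinv // -map_mxM mulVmx ?uni // map_mx1.
have algKr g : \det g = 1 -> alg (map_mx intr g) *m alg (map_mx intr (invmx g)) = 1%:M.
  by move/algK/mulmx1C.
have comm_alg M g : in_commutant M -> \det g = 1 -> M *m alg g = alg g *m M.
  move=> cM /gen[w wfw <-]; rewrite algW //; elim: w wfw => [|x w IH] /=; first by rewrite mulmx1 mul1mx.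
  case/andP=> nx /IH E; rewrite TE // mulmxA in_commutant_texp // -mulmxA E.
  by rewrite mulmxA.
have sigmaK g : \det g = 1 -> sigma g *m alg (map_mx intr g) = ph g.
  by move=> dg; rewrite /sigma -mulmxA algK // mulmx1.
have comm_sigma g : \det g = 1 -> in_commutant (sigma g).
  move=> dg; suff [] : \det g = 1 /\ in_commutant (sigma g) by [].
  move: g dg; apply: sl_int_gen => [|g i j a nij _ [dg cg]].
    split; first exact: det1.
    by rewrite /sigma ph1 invmx1 map_mx1 alg1 mulmx1 => k l _; rewrite mul1mx mulmx1.
  have dx : \det (xe i j a : 'M[int]_n) = 1 by rewrite det_xe.
  split; first by rewrite det_mulmx dg dx mulr1.
  have [s cs phx] : exists2 s, in_commutant s & ph (xe i j a) = s *m alg (map_mx intr (xe i j a)).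
    exists (U i j (- a%:~R) *m ph (xe i j a)); first exact: commutant_xe.
    rewrite comm_alg ?dmap //; last exact: commutant_xe.
    by rewrite map_xe algx // mulmxA texpK ?nilL // mul1mx.
  have -> : sigma (g *m xe i j a) = sigma g *m s.
    rewrite /sigma invmxM ?uni // phM // map_mxM algM ?dmap ?dinv //.
    rewrite phx -!mulmxA (mulmxA (alg (map_mx intr (xe i j a)))) algKr // mul1mx.
    by rewrite comm_alg ?dmap ?dinv.
  by move=> k l nkl; rewrite -mulmxA cs // mulmxA cg // -mulmxA.
have sigmaM g h : \det g = 1 -> \det h = 1 -> sigma (g *m h) = sigma g *m sigma h.
  move=> dg dh; rewrite {1}/sigma invmxM ?uni // phM // map_mxM algM ?dmap ?dinv //.
  rewrite -mulmxA (mulmxA (ph h)) -/(sigma h) comm_alg ?dmap ?dinv //; last exact: comm_sigma.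
  by rewrite mulmxA.
split=> // i j nij.
have E : invmx (xe i j (N`!%:R : int)) = xe i j (- N`!%:R).
  have /(congr1 (mulmx (invmx (xe i j N`!%:R)))) := xeK (N`!%:R : int) nij.
  by rewrite mulmxA mulVmx ?uni ?det_xe // mul1mx mulmx1.
rewrite /sigma E map_xe algx // rmorphN /= rmorph_nat -[N`!]muln1 expL // texpK ?nilL //.
Qed.
End Decompose.

(** * Simultaneous eigenvectors of commuting matrices of finite order *)

Section Weights.
Variables (F : numClosedFieldType) (N' : nat).
Local Notation N := N'.+1.

Lemma finite_order_diagonalizable (X : 'M[F]_N) m : (0 < m)%N -> X ^+ m = 1 -> diagonalizable X.
Proof.
move=> m0 Xm; apply/diagonalizableP.
pose p : {poly F} := 'X^m - 1.
have [rs rsE] := closed_field_poly_normal p.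
have pm : p \is monic by exact: monic_Xn_sub_1.
rewrite (monicP pm) scale1r in rsE.
exists rs; last by rewrite -rsE; apply: mxminpoly_min; rewrite rmorphB rmorphXn rmorph1 /= horner_mx_X Xm subrr.
rewrite -separable_prod_XsubC -rsE; apply: separable_Xn_sub_1.
by rewrite pnatr_eq0 -lt0n.
Qed.

Variables (I : finType) (Xs : I -> 'M[F]_N) (m : nat).
Hypothesis m0 : (0 < m)%N.
Hypothesis Xm : forall i, Xs i ^+ m = 1.
Hypothesis Xcomm : forall i j, Xs i *m Xs j = Xs j *m Xs i.

Definition weight_vector (chi : {ffun I -> F}) (v : 'rV[F]_N) := forall i, v *m Xs i = chi i *: v.

(** Matrices of finite order are diagonalisable in characteristic zero, and commuting ones
    simultaneously. *)
Lemma weight_basis : exists (Q : 'M[F]_N) (D : I -> 'rV[F]_N), Q \in unitmx /\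
  forall i, Xs i *m Q = Q *m diag_mx (D i).
Proof.
have [|P uP /allP H] := (@codiagonalizableP F N (codom Xs)).1.
  split=> [_ _ /codomP[i ->] /codomP[j ->]|_ /codomP[i ->]]; first exact: Xcomm.
  exact: finite_order_diagonalizable (Xm i).
have /fin_all_exists[D DE] : forall i, exists d : 'rV_N, P *m Xs i = diag_mx d *m P.
  move=> i; have /diagonalizable_forPex[d /(simmxP uP) E] := H (Xs i) (codom_f Xs i).
  by exists d.
exists (invmx P), D; rewrite unitmx_inv; split=> // i.
by rewrite -[Xs i](mulKmx uP) DE !mulmxA mulmxK.
Qed.

Lemma coord_neq0 (Q : 'M[F]_N) (v : 'rV[F]_N) : Q \in unitmx -> v != 0 -> exists k, (v *m Q) 0 k != 0.
Proof.
move=> uQ v0; apply/existsP; rewrite -negb_forall; apply: contraNN v0 => /forallP H.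
apply/eqP; rewrite -[v](mulmxK uQ) (_ : v *m Q = 0) ?mul0mx //.
by apply/rowP=> k; rewrite [RHS]mxE; apply/eqP/H.
Qed.

Lemma weight_support (Q : 'M[F]_N) (D : I -> 'rV[F]_N) chi v k :
  (forall i, Xs i *m Q = Q *m diag_mx (D i)) -> weight_vector chi v ->
  (v *m Q) 0 k != 0 -> forall i, D i 0 k = chi i.
Proof.
move=> QE wv vk i.
have : v *m Q *m diag_mx (D i) = chi i *: (v *m Q) by rewrite -mulmxA -QE mulmxA wv scalemxAl.
by move/rowP/(_ k); rewrite mul_mx_diag mxE [RHS]mxE mulrC => /mulIf ->.
Qed.

(** The coordinate, in a simultaneous eigenbasis, of a basis vector that occurs in [v]. *)
Lemma weight_functional chi v : weight_vector chi v -> v != 0 ->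
  exists2 kap : 'cV[F]_N, (v *m kap) 0 0 != 0 & forall i, Xs i *m kap = chi i *: kap.
Proof.
move=> wv v0; have [Q [D [uQ QE]]] := weight_basis.
have [k vk] := coord_neq0 uQ v0; have Dk := weight_support QE wv vk.
exists (col k Q); first by rewrite colE mulmxA -colE mxE.
move=> i; rewrite colE mulmxA -!colE QE; by apply/colP=> j; rewrite mxE mul_mx_diag mxE [RHS]mxE [in RHS]mxE Dk mulrC.
Qed.

Lemma weights_bound (s : seq {ffun I -> F}) : uniq s ->
  (forall chi, chi \in s -> exists2 v, weight_vector chi v & v != 0) -> (size s <= N)%N.
Proof.
move=> us H; have [Q [D [uQ QE]]] := weight_basis.
pose wt (k : 'I_N) : {ffun I -> F} := [ffun i => D i 0 k].
apply: leq_trans (_ : size (codom wt) <= _)%N; last by rewrite size_codom card_ord.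
apply: uniq_leq_size => // chi /H[v wv v0]; apply/codomP.
have [k vk] := coord_neq0 uQ v0; exists k; apply/ffunP=> i.
by rewrite ffunE (weight_support QE wv vk).
Qed.

Definition is_line (chi : {ffun I -> F}) := forall v w,
  weight_vector chi v -> weight_vector chi w -> w != 0 -> exists c : F, v = c *: w.

(** Otherwise each of the weights would occur at least twice in an eigenbasis. *)
Lemma weights_line (s : seq {ffun I -> F}) : uniq s -> (N < 2 * size s)%N ->
  exists2 chi, chi \in s & is_line chi.
Proof.
move=> us lt; have [Q [D [uQ QE]]] := weight_basis.
pose wt (k : 'I_N) : {ffun I -> F} := [ffun i => D i 0 k].
have [chi chis small] : exists2 chi, chi \in s & (count (fun k => wt k == chi) (enum 'I_N) <= 1)%N.
  apply/hasP; apply: contraLR lt; rewrite -all_predC -leqNgt => /allP H.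
  apply: leq_trans (_ : size (enum 'I_N) <= _)%N; last by rewrite size_enum_ord.
  have : (size s * 2 <= \sum_(chi <- s) count (fun k => wt k == chi) (enum 'I_N))%N.
    rewrite -sum1_size big_distrl /= !big_seq; apply: leq_sum => chi /H /=.
    by rewrite mul1n -ltnNge.
  rewrite mulnC => /leq_trans; apply.
  elim: (enum 'I_N) => [|x t IH] /=; first by rewrite big1.
  rewrite big_split /= -[(size t).+1]add1n leq_add //.
  have [xs|xs] := boolP (wt x \in s).
    rewrite (bigD1_seq (wt x)) //= eqxx big1_seq // => y /andP[/negPf yx _].
    by rewrite eq_sym yx.
  by rewrite big1_seq // => y /andP[_ ys]; case: eqP => // E; rewrite E ys in xs.
exists chi => // v w wv ww w0.
have supp z : weight_vector chi z -> forall k, (z *m Q) 0 k != 0 -> wt k = chi.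
  by move=> wz k zk; apply/ffunP=> i; rewrite ffunE (weight_support QE wz zk).
have [k uk] := coord_neq0 uQ w0; have wk := supp w ww k uk.
have only k' : wt k' = chi -> k' = k.
  move=> wk'; apply/eqP/negPn/negP => nkk.
  move: small; rewrite leqNgt => /negP; apply.
  rewrite -size_filter; apply: (@uniq_leq_size _ [:: k; k']); first by rewrite /= inE eq_sym nkk.
  by move=> j; rewrite !inE mem_filter mem_enum andbT => /orP[]/eqP->; rewrite ?wk ?wk'.
exists ((v *m Q) 0 k / (w *m Q) 0 k).
apply: (can_inj (mulmxK uQ)).
rewrite -scalemxAl; apply/rowP=> j; rewrite [RHS]mxE.
have [->|njk] := eqVneq j k; first by rewrite divfK.
have z0 z : weight_vector chi z -> (z *m Q) 0 j = 0.
  by move=> wz; apply/eqP/negPn/negP => /(supp z wz)/only E; rewrite E eqxx in njk.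
by rewrite !z0 ?mulr0.
Qed.
End Weights.

(** * Small representations: squares of elementary matrices act trivially *)

(** The inequality 30 <= 36 at n = 5 starts the induction; the right-hand side grows by the factor 3. *)
Lemma many_weights_bound n N : (4 < n)%N -> (N < 2 ^ n - 2)%N -> (N < 3 ^ (n - 2) + 3 ^ (n - 3))%N.
Proof.
move=> n4 lt; apply: leq_trans lt _.
have -> : n = (n - 5 + 5)%N by lia.
elim: (n - 5)%N => [//|k IH].
have -> : (k.+1 + 5 - 2 = (k + 5 - 2).+1)%N by lia.
have -> : (k.+1 + 5 - 3 = (k + 5 - 3).+1)%N by lia.
rewrite addSn !expnS; lia.
Qed.

Section Squares.
Variables (F : numClosedFieldType) (n N' : nat).
Local Notation N := N'.+1.
Hypothesis n4 : (4 < n)%N.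
Hypothesis hN : (N < 2 ^ n - 2)%N.
Variable sg : 'M[int]_n -> 'M[F]_N.
Hypothesis sg1 : sg 1%:M = 1%:M.
Hypothesis sgM : forall g h, \det g = 1 -> \det h = 1 -> sg (g *m h) = sg g *m sg h.
Variable m : nat.
Hypothesis m0 : (0 < m)%N.
Hypothesis sgXm : forall i j, i != j -> sg (xe i j m%:R) = 1%:M.

Variable o : 'I_n.
(** The index [o] itself is allowed and contributes the identity, which avoids a smaller index
    type. *)
Definition colgrp (j : 'I_n) := if j == o then 1%:M else sg (xe j o 1).

Lemma colgrpX j : colgrp j ^+ m = 1.
Proof.
rewrite /colgrp; case: eqP => [_|/eqP njo]; first by rewrite -[1%:M]/(1 : 'M_N) expr1n.
by rewrite -(ph_xeX sg1 sgM) // mul1r sgXm.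
Qed.

Lemma colgrpC i j : colgrp i *m colgrp j = colgrp j *m colgrp i.
Proof.
rewrite /colgrp; case: eqP => [_|/eqP nio]; first by rewrite mulmx1 mul1mx.
case: eqP => [_|/eqP njo]; first by rewrite mulmx1 mul1mx.
by apply: (ph_comm sgM); rewrite // eq_sym.
Qed.

Definition is_weight (chi : {ffun 'I_n -> F}) := exists2 v, weight_vector colgrp chi v & v != 0.

Lemma is_weight_neq0 chi j : is_weight chi -> chi j != 0.
Proof.
case=> v wv v0; apply: contraNneq v0 => c0.
have : v *m colgrp j = 0 by rewrite wv c0 scale0r.
move/(congr1 (mulmx^~ (colgrp j ^+ m.-1))); rewrite mul0mx -mulmxA -[colgrp j *m _]/(colgrp j * _).
by rewrite -exprS prednK // colgrpX mulmx1 => ->.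
Qed.

(** As X_kl(a) X_lo = X_ko(a) X_lo X_kl(a), conjugation by
    X_kl(a) multiplies the eigenvalue at l by the a-th power of the one at k. *)
Lemma is_weight_move chi k l (a : nat) : k != l -> k != o -> l != o -> is_weight chi ->
  is_weight [ffun j => if j == l then chi l * chi k ^+ a else chi j].
Proof.
move=> nkl nko nlo [v wv v0]; exists (v *m sg (xe k l a%:R)); last first.
  have u : sg (xe k l a%:R) \in unitmx by apply: (ph_unit sg1 sgM); rewrite det_xe.
  by apply: contraNneq v0 => E; rewrite -[v](mulmxK u) E mul0mx.
have vX b j : j != o -> v *m sg (xe j o b%:R) = chi j ^+ b *: v.
  move=> njo; rewrite -[b%:R]mul1r (ph_xeX sg1 sgM) //; elim: b => [|b IH].
    by rewrite !expr0 scale1r mulmx1.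
  have := wv j; rewrite /colgrp (negPf njo) => E.
  by rewrite !exprS -[sg _ * _]/(sg _ *m _) mulmxA E -scalemxAl IH scalerA.
move=> j; rewrite ffunE /colgrp.
have [->|njo] := eqVneq j o.
  have := wv o; rewrite /colgrp eqxx mulmx1 eq_sym (negPf nlo) => E.
  by rewrite mulmx1 scalemxAl -E.
have wj : v *m sg (xe j o 1) = chi j *: v by have := wv j; rewrite /colgrp (negPf njo).
have [jl|njl] := eqVneq j l.
  rewrite jl -mulmxA (ph_steinberg sgM) // mulr1 !mulmxA vX //.
  by rewrite -!scalemxAl -jl wj -scalemxAl scalerA mulrC.
have nlj : l != j by rewrite eq_sym.
by rewrite -mulmxA (ph_comm sgM) // mulmxA wj scalemxAl.
Qed.

Section Many.
Variables (chi : {ffun 'I_n -> F}) (i : 'I_n).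
Hypothesis nio : i != o.
Hypothesis wchi : is_weight chi.
Hypothesis z2 : chi i ^+ 2 != 1.

Definition fill (e : 'I_n -> nat) := [ffun l => if (l == i) || (l == o) then chi l else chi l * chi i ^+ e l].

Lemma is_weight_fill e : is_weight (fill e).
Proof.
suff H (s : seq 'I_n) : uniq s ->
   is_weight [ffun l => if (l \in s) && (l != i) && (l != o) then chi l * chi i ^+ e l else chi l].
  have := H (enum 'I_n) (enum_uniq _); congr is_weight; apply/ffunP=> l.
  by rewrite !ffunE mem_enum /=; case: (l == i); case: (l == o).
elim: s => [_|k s IH /= /andP[ks us]].
  by case: wchi => v wv v0; exists v => // l; rewrite ffunE; apply: wv.
have {IH} := IH us; set chi' := finfun _ => w.
have [E|] := boolP ((k != i) && (k != o)); last first.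
  rewrite negb_and !negbK => E; case: w => v wv v0; exists v => // l; rewrite wv !ffunE inE.
  by case: (l =P k) => [->|_] //=; rewrite (negPf ks); case/orP: E => ->; rewrite ?andbF.
case/andP: E => nki nko.
have := @is_weight_move chi' i k (e k) _ nio nko w; rewrite eq_sym => /(_ nki).
congr is_weight; apply/ffunP=> l; rewrite !ffunE inE.
have [->|nlk] /= := eqVneq l k; last by [].
by rewrite (negPf ks) /= nki nko eqxx /= andbF.
Qed.

(** The powers of exponents 0, 1, 2 of [chi i] are distinct, since its square is not 1. *)
Lemma chi_i_pow (a b : 'I_3) c : c != 0 -> c * chi i ^+ a = c * chi i ^+ b -> a = b.
Proof.
have z0 := is_weight_neq0 i wchi.
have z1 : chi i != 1 by apply: contraNneq z2 => ->; rewrite expr1n.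
have key (x y : nat) : (x < y)%N -> (y < 3)%N -> chi i ^+ x != chi i ^+ y.
  move=> xy y3; apply/eqP=> E.
  have : chi i ^+ (y - x) = 1.
    by apply: (mulIf (expf_neq0 x z0)); rewrite mul1r -exprD subnK // ltnW.
  have /orP[/eqP->|/eqP->] : ((y - x == 1) || (y - x == 2))%N by lia.
    by rewrite expr1 => E1; rewrite E1 eqxx in z1.
  by move=> E2; move: z2; rewrite E2 eqxx.
move=> c0 /(mulfI c0) E; apply/val_inj/eqP; case: ltngtP => // lt.
  by have := key _ _ lt (ltn_ord b); rewrite E eqxx.
by have := key _ _ lt (ltn_ord a); rewrite E eqxx.
Qed.

(** Put z = chi(i). Multiplying the n - 2 other eigenvalues by 1, z or z^2 gives 3^(n-2)
    weights with value z at i. Among them, those with a value c <> 1 at a fixed j can be moved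
    once more, from j to i: this gives 3^(n-3) further weights, with value z c at i. *)
Lemma many_weights : (3 ^ (n - 2) + 3 ^ (n - 3) <= N)%N.
Proof.
have [j [njo nji _]] := fresh3 n4 o i i.
have z0 := is_weight_neq0 i wchi.
have z1 : chi i != 1 by apply: contraNneq z2 => ->; rewrite expr1n.
(* a power of z that makes the value at j different from 1 *)
have [k nk] : exists k : 'I_3, chi j * chi i ^+ k != 1.
  have [c1|] := eqVneq (chi j) 1; last by exists ord0; rewrite expr0 mulr1.
  by exists (inord 1); rewrite inordK // c1 mul1r expr1.
pose D1 := [set~ i] :\ o; pose D2 := D1 :\ j.
pose S1 := pffun_on (ord0 : 'I_3) D1 predT; pose S2 := pffun_on (ord0 : 'I_3) D2 predT.
pose w1 (e : {ffun 'I_n -> 'I_3}) := fill (fun l => e l).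
pose w2' (e : {ffun 'I_n -> 'I_3}) := fill (fun l => if l == j then k : nat else e l).
pose w2 e : {ffun 'I_n -> F} := [ffun l => if l == i then w2' e i * w2' e j ^+ 1 else w2' e l].
have cD1 : #|D1| = (n - 2)%N.
  have := cardsD1 o [set~ i]; rewrite cardsC1 card_ord !inE [o == i]eq_sym nio -/D1 /=.
  by lia.
have cD2 : #|D2| = (n - 3)%N.
  by have := cardsD1 j D1; rewrite cD1 !inE njo nji /= -/D2; lia.
have inj1 : {in S1 &, injective w1}.
  move=> e e' /pffun_onP[/subsetP s1 _] /pffun_onP[/subsetP s1' _] /ffunP E.
  apply/ffunP=> l; have := E l; rewrite !ffunE.
  have [/eqP li|nli] := boolP (l == i); [move=> _|have [/eqP lo|nlo] := boolP (l == o); [move=> _|]].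
  - have nD : l \notin D1 by rewrite !inE li eqxx andbF.
    have /negbNE/eqP-> : ~~ (e l != ord0) by apply: contra nD; apply: s1.
    by apply/esym/eqP/negbNE; apply: contra nD; apply: s1'.
  - have nD : l \notin D1 by rewrite !inE lo eqxx.
    have /negbNE/eqP-> : ~~ (e l != ord0) by apply: contra nD; apply: s1.
    by apply/esym/eqP/negbNE; apply: contra nD; apply: s1'.
  by apply: chi_i_pow; apply: is_weight_neq0.
have inj2 : {in S2 &, injective w2}.
  move=> e e' /pffun_onP[/subsetP s1 _] /pffun_onP[/subsetP s1' _] /ffunP E.
  apply/ffunP=> l.
  have [lD|nD] := boolP (l \in D2); last first.
    have /negbNE/eqP-> : ~~ (e l != ord0) by apply: contra nD; apply: s1.
    by apply/esym/eqP/negbNE; apply: contra nD; apply: s1'.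
  move: lD; rewrite !inE => /and3P[nlj nlo nli].
  have := E l; rewrite !ffunE (negPf nli) (negPf nlo) (negPf nlj) /=.
  by apply: chi_i_pow; apply: is_weight_neq0.
pose s := [seq w1 e | e in S1] ++ [seq w2 e | e in S2].
have us : uniq s.
  rewrite cat_uniq !map_inj_in_uniq ?enum_uniq //=; last 2 first.
  - by move=> x y; rewrite !mem_enum; apply: inj2.
  - by move=> x y; rewrite !mem_enum; apply: inj1.
  rewrite andbT; apply/hasPn => _ /mapP[e _ ->]; apply/mapP => -[e' _ /ffunP/(_ i)].
  rewrite !ffunE eqxx /= eqxx (negPf nji) (negPf njo) /= expr1 -[RHS]mulr1 => /(mulfI z0) E.
  by rewrite E eqxx in nk.
have := weights_bound m0 colgrpX colgrpC us _; rewrite size_cat !size_map -!cardE !card_pffun_on.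
rewrite cD1 cD2 (eq_card (B := [set: 'I_3])) ?cardsT ?card_ord; last by move=> x; rewrite !inE.
apply=> c; rewrite mem_cat => /orP[]/mapP[e _ ->].
  exact: (is_weight_fill (fun l => e l)).
apply: (@is_weight_move (w2' e) j i 1) => //.
exact: (is_weight_fill (fun l => if l == j then k : nat else e l)).
Qed.
End Many.

Lemma sg_square i : i != o -> sg (xe i o 1) *m sg (xe i o 1) = 1%:M.
Proof.
move=> nio; have [Q [D [uQ QE]]] := weight_basis m0 colgrpX colgrpC.
have H k : D i 0 k ^+ 2 = 1.
  apply/eqP/negPn/negP => z2.
  pose chi : {ffun 'I_n -> F} := [ffun j => D j 0 k].
  suff w : is_weight chi.
    have := @many_weights chi i nio w; rewrite ffunE => /(_ z2).
    by rewrite leqNgt many_weights_bound.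
  exists (row k (invmx Q)); last first.
    apply/eqP=> /(congr1 (mulmx^~ Q)); rewrite -row_mul mulVmx // mul0mx row1 => /rowP/(_ k).
    by rewrite !mxE !eqxx => /eqP; rewrite oner_eq0.
  move=> j; rewrite -row_mul.
  have -> : invmx Q *m colgrp j = diag_mx (D j) *m invmx Q.
    by rewrite -[colgrp j](mulmxK uQ) QE !mulmxA mulVmx // mul1mx.
  by apply/rowP=> l; rewrite mxE mul_diag_mx mxE [RHS]mxE [in RHS]mxE ffunE.
have -> : sg (xe i o 1) = colgrp i by rewrite /colgrp (negPf nio).
have XE : colgrp i = Q *m diag_mx (D i) *m invmx Q by rewrite -QE mulmxK.
rewrite XE -!mulmxA (mulmxA (invmx Q) Q) mulVmx // mul1mx (mulmxA (diag_mx _)).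
rewrite mulmx_diag (_ : diag_mx _ = 1%:M) ?mul1mx ?mulmxV //.
apply/matrixP=> r c; rewrite !mxE; case: eqP => [->|]; rewrite ?mulr0n // mulr1n.
by rewrite -expr2 H.
Qed.
End Squares.

(** * Linear algebra over the field with two elements, and reduction modulo 2 *)

Section F2.
Lemma intr_F2_eq0 (x : int) : (x%:~R == 0 :> 'F_2) = (2 %| x)%Z.
Proof. by rewrite -(dvdz_pcharf (pchar_Fp (isT : prime 2))). Qed.

Lemma F2_cases (x : 'F_2) : x = 0 \/ x = 1.
Proof. by case: x => [[|[|k]] H]; [left; apply/val_inj|right; apply/val_inj|]. Qed.

Lemma F2_addxx (x : 'F_2) : x + x = 0.
Proof. by case: (F2_cases x) => ->; apply/val_inj. Qed.

Lemma F2_mx_addxx p q (X : 'M['F_2]_(p, q)) : X + X = 0.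
Proof. by apply/matrixP=> i j; rewrite !mxE F2_addxx. Qed.

Lemma F2_oppmx p q (X : 'M['F_2]_(p, q)) : - X = X.
Proof. by apply/eqP; rewrite -subr_eq0 -opprD F2_mx_addxx oppr0. Qed.

(** By the Smith normal form, an integer lift of M is L D R with L, R invertible over the
    integers and D diagonal. As M is invertible the entries of D are odd, so D is the identity
    modulo 2 and L R is a lift. Its determinant is 1 or -1, and a sign is invisible modulo 2. *)
Lemma F2_lift n (M : 'M['F_2]_n) : M \in unitmx ->
  exists2 g : 'M[int]_n, \det g = 1 & map_mx intr g = M.
Proof.
move=> uM; pose g0 : 'M[int]_n := map_mx (fun x : 'F_2 => (x : nat)%:Z) M.
have g0E : map_mx intr g0 = M.
  apply/matrixP=> i j; rewrite !mxE; case: (F2_cases (M i j)) => ->; exact/val_inj.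
have [L uL [R uR [d _ dE]]] := int_Smith_normal_form g0.
set D := \matrix_(i, j) _ in dE.
have DE : map_mx intr D = 1%:M :> 'M['F_2]_n.
  have uD : map_mx intr D \in @unitmx 'F_2 n.
    have E : M = map_mx intr L *m map_mx intr D *m map_mx intr R by rewrite -!map_mxM -dE.
    by move: uM; rewrite E 2!unitmx_mul => /andP[/andP[_ uD] _]; exact: uD.
  apply/matrixP=> i j; rewrite !mxE; have [->|nij] := eqVneq i j; last first.
    by rewrite (_ : (i == j :> nat) = false) ?rmorph0 //; apply/negbTE.
  rewrite eqxx mulr1n; case: (F2_cases (d`_j)%:~R) => // d0.
  have := uD; rewrite unitmxE (expand_det_row _ j) big1 ?unitr0 // => k _.
  rewrite !mxE; case: (j =P k :> nat) => [jk|]; last by rewrite rmorph0 mul0r.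
  by rewrite mulr1n d0 mul0r.
pose h := L *m R.
have hE : map_mx intr h = M by rewrite -g0E dE !map_mxM DE mulmx1.
have : \det h = 1 \/ \det h = -1.
  have uh : h \in unitmx by rewrite unitmx_mul uL.
  have /orP[/eqP->|/eqP->] : (\det h == 1) || (\det h == -1) by rewrite unitmxE in uh.
    by left.
  by right.
case=> dh; first by exists h.
case: (pickP (@predT 'I_n)) => [o _|no]; last first.
  have h1 : h = 1%:M by apply/matrixP=> i; have := no i.
  by move: dh; rewrite h1 det1.
pose S : 'M[int]_n := diag_mx (\row_c (if c == o then -1 else 1)).
exists (h *m S).
  rewrite det_mulmx dh det_diag (bigD1 o) //= big1 => [|c /negPf co]; first by rewrite mxE eqxx.
  by rewrite mxE co.
rewrite map_mxM hE (_ : map_mx _ _ = 1%:M) ?mulmx1 //.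
apply/matrixP=> i j; rewrite !mxE; case: (i =P j) => _; last by rewrite mulr0n rmorph0.
by rewrite mulr1n; case: (_ == o); apply/val_inj.
Qed.

(** Complete both families of rows to bases. *)
Lemma unit_moving k n (U U' : 'M['F_2]_(k, n)) : row_free U -> row_free U' ->
  exists2 g, g \in unitmx & U *m g = U'.
Proof.
move=> fU fU'; have E : U *m (pinvmx U *m U') = U' by rewrite mulmxA mulmxVp // mul1mx.
have [|g ug gE] := @complete_unitmx _ _ _ U (pinvmx U *m U').
  by rewrite E (eqP fU) (eqP fU').
by exists g; rewrite // -gE E.
Qed.

Lemma unit_dual k n (U : 'M['F_2]_(k, n)) (t : 'cV_k) : row_free U -> exists l : 'cV_n, U *m l = t.
Proof. by move=> fU; exists (pinvmx U *m t); rewrite mulmxA mulmxVp // mul1mx. Qed.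

Definition stack2 n (a b : 'rV['F_2]_n) : 'M_(2, n) := \matrix_(i < 2) (if i == ord0 then a else b).
Definition stack3 n (a b c : 'rV['F_2]_n) : 'M_(3, n) :=
  \matrix_(i < 3) (if i == ord0 then a else if i == 1 :> nat then b else c).

Definition indep2 n (a b : 'rV['F_2]_n) := [&& a != 0, b != 0 & a != b].
Definition indep3 n (a b c : 'rV['F_2]_n) := [&& indep2 a b, c != 0, c != a, c != b & c != a + b].

Lemma row_freeP k n (U : 'M['F_2]_(k, n)) : (forall w : 'rV_k, w *m U = 0 -> w = 0) -> row_free U.
Proof.
move=> H; rewrite -kermx_eq0; apply/eqP/row_matrixP=> i; rewrite row0; apply: H.
by rewrite -row_mul mulmx_ker row0.
Qed.

Lemma stack2_mul n p (a b : 'rV_n) (M : 'M['F_2]_(n, p)) : stack2 a b *m M = stack2 (a *m M) (b *m M).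
Proof. by apply/row_matrixP=> i; rewrite row_mul !rowK; case: ifP. Qed.
Lemma stack3_mul n p (a b c : 'rV_n) (M : 'M['F_2]_(n, p)) :
  stack3 a b c *m M = stack3 (a *m M) (b *m M) (c *m M).
Proof. by apply/row_matrixP=> i; rewrite row_mul !rowK; do 2!case: ifP => //. Qed.

Lemma stack2_inj n (a b a' b' : 'rV['F_2]_n) : stack2 a b = stack2 a' b' -> a = a' /\ b = b'.
Proof.
move=> E; have := congr1 (row ord0) E; have := congr1 (row (Ordinal (isT : 1 < 2)%N)) E.
by rewrite !rowK.
Qed.
Lemma stack3_inj n (a b c a' b' c' : 'rV['F_2]_n) : stack3 a b c = stack3 a' b' c' ->
  [/\ a = a', b = b' & c = c'].
Proof.
move=> E; have := congr1 (row (Ordinal (isT : 2 < 3)%N)) E.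
have := congr1 (row ord0) E; have := congr1 (row (Ordinal (isT : 1 < 3)%N)) E.
by rewrite !rowK.
Qed.

Lemma indep2_free n (a b : 'rV['F_2]_n) : indep2 a b -> row_free (stack2 a b).
Proof.
move=> /and3P[a0 b0 ab]; apply: row_freeP => w.
rewrite mulmx_sum_row !big_ord_recl big_ord0 addr0 !rowK /= => E.
have w0 : w 0 ord0 = 0 /\ w 0 (lift ord0 ord0) = 0.
  move: E; case: (F2_cases (w 0 ord0)) => ->; case: (F2_cases (w 0 (lift ord0 ord0))) => -> //;
  rewrite ?scale0r ?scale1r ?add0r ?addr0 => /eqP.
  - by rewrite (negPf b0).
  - by rewrite (negPf a0).
  - by rewrite addr_eq0 F2_oppmx (negPf ab).
apply/rowP=> i; rewrite mxE; case: w0 => w0 w1.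
by case: (unliftP ord0 i) => [j ->|->] //; rewrite ord1.
Qed.

Lemma indep3_free n (a b c : 'rV['F_2]_n) : indep3 a b c -> row_free (stack3 a b c).
Proof.
move=> /and5P[/and3P[a0 b0 ab] c0 ca cb cab]; apply: row_freeP => w.
rewrite mulmx_sum_row !big_ord_recl big_ord0 addr0 !rowK /= => E.
set i1 := lift ord0 ord0 in E; set i2 := lift ord0 (lift ord0 ord0) in E.
have w0 : [/\ w 0 ord0 = 0, w 0 i1 = 0 & w 0 i2 = 0].
  move: E; case: (F2_cases (w 0 ord0)) => ->; case: (F2_cases (w 0 i1)) => ->;
  case: (F2_cases (w 0 i2)) => -> //; rewrite ?scale0r ?scale1r ?add0r ?addr0 => /eqP.
  - by rewrite (negPf c0).
  - by rewrite (negPf b0).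
  - by rewrite addr_eq0 F2_oppmx eq_sym (negPf cb).
  - by rewrite (negPf a0).
  - by rewrite addr_eq0 F2_oppmx eq_sym (negPf ca).
  - by rewrite addr_eq0 F2_oppmx (negPf ab).
  - by rewrite addrA addr_eq0 F2_oppmx eq_sym (negPf cab).
case: w0 => w0 w1 w2.
apply/rowP=> i; rewrite mxE.
case: (unliftP ord0 i) => [j ->|->] //; case: (unliftP ord0 j) => [k ->|->] //; by rewrite ord1.
Qed.

Lemma moving2 n (a b a' b' : 'rV['F_2]_n) : indep2 a b -> indep2 a' b' ->
  exists2 g, g \in unitmx & a *m g = a' /\ b *m g = b'.
Proof.
move=> /indep2_free f /indep2_free f'; have [g ug] := unit_moving f f'.
by rewrite stack2_mul => /stack2_inj E; exists g.
Qed.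

Lemma moving3 n (a b c a' b' c' : 'rV['F_2]_n) : indep3 a b c -> indep3 a' b' c' ->
  exists2 g, g \in unitmx & [/\ a *m g = a', b *m g = b' & c *m g = c'].
Proof.
move=> /indep3_free f /indep3_free f'; have [g ug] := unit_moving f f'.
by rewrite stack3_mul => /stack3_inj E; exists g.
Qed.

Lemma dual2 n (a b : 'rV['F_2]_n) (x y : 'F_2) : indep2 a b ->
  exists l : 'cV_n, (a *m l) 0 0 = x /\ (b *m l) 0 0 = y.
Proof.
move=> /indep2_free f; have [l] := unit_dual (col_mx x%:M y%:M : 'cV_(1 + 1)) f.
rewrite stack2_mul => E; exists l; split.
  have /matrixP/(_ (lshift 1 0) 0) := E; rewrite col_mxEu !mxE eqxx mulr1n => <-.
  by [].
have /matrixP/(_ (rshift 1 0) 0) := E; rewrite col_mxEd !mxE eqxx mulr1n => <-.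
by [].
Qed.

Lemma dual3 n (a b c : 'rV['F_2]_n) (x y z : 'F_2) : indep3 a b c ->
  exists l : 'cV_n, [/\ (a *m l) 0 0 = x, (b *m l) 0 0 = y & (c *m l) 0 0 = z].
Proof.
move=> /indep3_free f.
have [l] := unit_dual (\col_(i < 3) (if i == ord0 then x else if i == 1 :> nat then y else z)) f.
rewrite stack3_mul => /matrixP E; exists l; split.
- by have := E ord0 0; rewrite mxE [RHS]mxE.
- by have := E (Ordinal (isT : 1 < 3)%N) 0; rewrite mxE [RHS]mxE.
- by have := E (Ordinal (isT : 2 < 3)%N) 0; rewrite mxE [RHS]mxE.
Qed.
End F2.

Section Mod2.
Variables (F : numFieldType) (n N' : nat).
Local Notation N := N'.+1.
Variable sg : 'M[int]_n -> 'M[F]_N.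
Hypothesis sg1 : sg 1%:M = 1%:M.
Hypothesis sgM : forall g h, \det g = 1 -> \det h = 1 -> sg (g *m h) = sg g *m sg h.
Hypothesis sg2 : forall i j, i != j -> sg (xe i j 1) *m sg (xe i j 1) = 1%:M.

Lemma sg_even i j a : i != j -> (2 %| a)%Z -> sg (xe i j a) = 1%:M.
Proof.
move=> nij /dvdzP[b ->].
have nat_case (k : nat) : sg (xe i j (k%:Z * 2)) = 1%:M.
  rewrite mulrC -[k%:Z]natz (ph_xeX sg1 sgM) // -[2]/(1 + 1) (ph_xeM sgM) // sg2 //.
  by rewrite -[1%:M]/(1 : 'M_N) expr1n.
case: (intP b) => [|k|k]; [exact: (nat_case 0%N)|exact: nat_case|].
rewrite mulNr; have := ph_xeM sgM (k.+1%:Z * 2) (- (k.+1%:Z * 2)) nij.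
by rewrite subrr xe0 sg1 nat_case mul1mx => <-.
Qed.

Lemma sg_sgm i j : i != j -> sg (sgm i j) = 1%:M.
Proof.
move=> nij; have nji : j != i by rewrite eq_sym.
have E : sg (xe j i (-1)) = sg (xe j i 1).
  by rewrite -[-1](addrK 2) (_ : -1 + 2 = 1) // (ph_xeM sgM) // (@sg_even j i (- 2)) ?mulmx1.
rewrite sgm_word // !sgM ?det_mulmx ?det_xe ?mulr1 // E.
rewrite -!mulmxA (mulmxA (sg (xe i j 1)) (sg (xe i j 1))) sg2 // mul1mx.
by rewrite (mulmxA (sg (xe j i 1)) (sg (xe j i 1))) sg2 // mul1mx sg2.
Qed.

Lemma sg_congr g h : \det g = 1 -> \det h = 1 ->
  map_mx intr g = map_mx intr h :> 'M['F_2]_n -> sg g = sg h.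
Proof.
move=> dg dh E.
have triv : forall k, \det k = 1 -> (forall r c : 'I_n, (2 %| k r c - (r == c)%:R)%Z) -> sg k = 1%:M.
  move=> k dk ev; apply: (@sl_int_ind n n (fun k => sg k = 1%:M)) => //.
    move=> k' i j a nij ok dk' E'; rewrite sgM ?det_xe // E' mul1mx sg_even //.
    by move: ok; rewrite leqNgt ltn_ord.
  by move=> k' i j nij dk' E'; rewrite sgM ?det_sgm // E' mul1mx sg_sgm.
have ug : g \in unitmx by rewrite unitmxE dg unitr1.
have di : \det (invmx g) = 1 by rewrite det_inv dg invr1.
have : sg (invmx g *m h) = 1%:M.
  apply: triv; first by rewrite det_mulmx di dh mulr1.
  move=> r c; rewrite -intr_F2_eq0.
  have : map_mx intr (invmx g *m h) = 1%:M :> 'M['F_2]_n.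
    by rewrite map_mxM -E -map_mxM mulVmx // map_mx1.
  move/matrixP/(_ r c); rewrite mxE [X in _ = X -> _]mxE => E'.
  by rewrite mulrzBr E' rmorph_nat subrr.
move=> /(congr1 (mulmx (sg g))); rewrite mulmx1 -sgM ?det_mulmx ?di ?dh ?mulr1 //.
by rewrite mulKVmx // => ->.
Qed.

(** Matrices that are congruent to the identity modulo 2 are products of X_ij(a) with a even
    and of sign matrices, all of which are killed; and GL_n(F_2) is the image of SL_n(Z). *)
Lemma reduction : exists sb : 'M['F_2]_n -> 'M[F]_N,
  [/\ forall g, \det g = 1 -> sb (map_mx intr g) = sg g, sb 1%:M = 1%:M &
      forall x y, x \in unitmx -> y \in unitmx -> sb (x *m y) = sb x *m sb y].
Proof.
have [sb sbE] : exists sb : 'M['F_2]_n -> 'M[F]_N, forall x g, \det g = 1 -> map_mx intr g = x -> sb x = sg g.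
  apply: (@fin_all_exists _ _ (fun x T => forall g, \det g = 1 -> map_mx intr g = x -> T = sg g)) => x.
  have [[g [dg gx]]|none] := classic (exists g, \det g = 1 /\ map_mx intr g = x).
    by exists (sg g) => h dh hx; apply: sg_congr; rewrite ?gx.
  by exists 0 => g dg gx; case: none; exists g.
have sbg g : \det g = 1 -> sb (map_mx intr g) = sg g by move=> dg; apply: sbE.
exists sb; split=> // [|x y /F2_lift[g dg <-] /F2_lift[h dh <-]].
  by rewrite -(map_mx1 (@intmul 'F_2 1)) sbg ?det1.
by rewrite -map_mxM !sbg ?sgM // det_mulmx dg dh mulr1.
Qed.
End Mod2.

(** * Characters of the groups of transvections with a given direction *)

Section Transvections.
Variable n : nat.
Implicit Types (d y : 'rV['F_2]_n) (l : 'cV['F_2]_n).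

Definition pairing y l : 'F_2 := (y *m l) 0 0.
(** The column [l] acts as a linear form on rows: y is sent to y + y(l) d. When d(l) = 0 this is
    a transvection with direction [d]. *)
Definition transv d l : 'M['F_2]_n := 1%:M + l *m d.

Lemma pairingE y l : y *m l = (pairing y l)%:M.
Proof. exact: mx11_scalar. Qed.

Lemma pairingDl y y' l : pairing (y + y') l = pairing y l + pairing y' l.
Proof. by rewrite /pairing mulmxDl mxE. Qed.
Lemma pairingDr y l l' : pairing y (l + l') = pairing y l + pairing y l'.
Proof. by rewrite /pairing mulmxDr mxE. Qed.
Lemma pairing_mul y (g : 'M_n) l : pairing (y *m g) l = pairing y (g *m l).
Proof. by rewrite /pairing mulmxA. Qed.

Lemma mul_transv y d l : y *m transv d l = y + pairing y l *: d.
Proof. by rewrite mulmxDr mulmx1 mulmxA pairingE mul_scalar_mx. Qed.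

Lemma transvD d l l' : pairing d l' = 0 -> transv d l *m transv d l' = transv d (l + l').
Proof.
move=> dl; rewrite {2}/transv mulmxDr mulmx1 {2}/transv mulmxDl mul1mx -mulmxA (mulmxA d) pairingE dl.
by rewrite mul_scalar_mx scale0r mulmx0 addr0 /transv -addrA mulmxDl.
Qed.

Lemma transv0 d : transv d 0 = 1%:M.
Proof. by rewrite /transv mul0mx addr0. Qed.

Lemma transvK d l : pairing d l = 0 -> transv d l *m transv d l = 1%:M.
Proof. by move=> dl; rewrite transvD // F2_mx_addxx transv0. Qed.

Lemma transv_unit d l : pairing d l = 0 -> transv d l \in unitmx.
Proof. by move/transvK/mulmx1_unit => -[]. Qed.

Lemma transv_conj d l (g : 'M_n) : g *m transv (d *m g) l = transv d (g *m l) *m g.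
Proof. by rewrite /transv mulmxDr mulmx1 mulmxDl mul1mx !mulmxA. Qed.
End Transvections.

Section SmallRep.
Variables (F : numClosedFieldType) (n N' : nat).
Local Notation N := N'.+1.
Hypothesis n4 : (4 < n)%N.
Hypothesis hN : (N < 2 ^ n - 2)%N.
Variable sb : 'M['F_2]_n -> 'M[F]_N.
Hypothesis sb1 : sb 1%:M = 1%:M.
Hypothesis sbM : forall g h, g \in unitmx -> h \in unitmx -> sb (g *m h) = sb g *m sb h.

Definition sign2 (x : 'F_2) : F := if x == 0 then 1 else -1.
Lemma sign2D x y : sign2 (x + y) = sign2 x * sign2 y.
Proof.
by rewrite /sign2; case: (F2_cases x) => ->; case: (F2_cases y) => ->; rewrite ?addr0 ?F2_addxx ?add0r ?eqxx ?oner_eq0 ?mulr1 ?mul1r ?mulrNN ?mulr1.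
Qed.
Lemma sign2_0 : sign2 0 = 1. Proof. by rewrite /sign2 eqxx. Qed.
Lemma sign2_1 : sign2 1 = -1. Proof. by rewrite /sign2 oner_eq0. Qed.

Lemma sign2_inj x y : sign2 x = sign2 y -> x = y.
Proof.
rewrite /sign2; case: (F2_cases x) => ->; case: (F2_cases y) => -> //; rewrite ?eqxx ?oner_eq0 => /eqP.
- by rewrite -subr_eq0 opprK (pnatr_eq0 F 2).
- by rewrite eq_sym -subr_eq0 opprK (pnatr_eq0 F 2).
Qed.

Lemma sb_unit g : g \in unitmx -> sb g \in unitmx.
Proof.
move=> ug; have : sb g *m sb (invmx g) = 1%:M by rewrite -sbM ?unitmx_inv // mulmxV.
by case/mulmx1_unit.
Qed.

Lemma mul_sb_neq0 (v : 'rV_N) g : g \in unitmx -> v != 0 -> v *m sb g != 0.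
Proof.
move=> ug; apply: contraNneq => E; have us := sb_unit ug.
by rewrite -[v](mulmxK us) E mul0mx.
Qed.

(** The eigenvectors, in the representation [sb], of the group of transvections with direction
    [d], for the character l |-> (-1)^(a l). Only the class of [a] modulo [d] matters. *)
Definition eigv (d a : 'rV['F_2]_n) (v : 'rV[F]_N) :=
  forall l, pairing d l = 0 -> v *m sb (transv d l) = sign2 (pairing a l) *: v.

Lemma eigv_move d a v g : g \in unitmx -> eigv d a v -> eigv (d *m g) (a *m g) (v *m sb g).
Proof.
move=> ug E l; rewrite !pairing_mul => dl.
have ut : transv (d *m g) l \in unitmx by rewrite transv_unit // pairing_mul.
have ut' : transv d (g *m l) \in unitmx by rewrite transv_unit.
by rewrite -mulmxA -(sbM ug ut) transv_conj (sbM ut' ug) mulmxA (E _ dl) scalemxAl.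
Qed.

Section FixDirection.
Variable d : 'rV['F_2]_n.

(** Indexed by all columns, with the identity for those that do not annihilate [d]. *)
Definition trgrp (l : 'cV['F_2]_n) := if pairing d l == 0 then sb (transv d l) else 1%:M.

Lemma trgrpX l : trgrp l ^+ 2 = 1.
Proof.
rewrite /trgrp; case: eqP => [dl|_]; last by rewrite -[1%:M]/(1 : 'M_N) expr1n.
by rewrite expr2 -[_ * _]/(_ *m _) -sbM ?transv_unit // transvK // sb1.
Qed.

Lemma trgrpC l l' : trgrp l *m trgrp l' = trgrp l' *m trgrp l.
Proof.
rewrite /trgrp; case: eqP => [dl|_]; last by rewrite mulmx1 mul1mx.
case: eqP => [dl'|_]; last by rewrite mulmx1 mul1mx.
have [ul ul'] := (transv_unit dl, transv_unit dl').
by rewrite -(sbM ul ul') -(sbM ul' ul) !transvD // addrC.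
Qed.

Definition char_of (a : 'rV['F_2]_n) : {ffun 'cV['F_2]_n -> F} :=
  [ffun l => if pairing d l == 0 then sign2 (pairing a l) else 1].

Lemma weight_eigv a v : weight_vector trgrp (char_of a) v <-> eigv d a v.
Proof.
split=> H l => [dl|]; first by have := H l; rewrite /trgrp ffunE dl eqxx.
rewrite /trgrp ffunE; case: eqP => [dl|_]; first exact: H.
by rewrite mulmx1 scale1r.
Qed.

Lemma char_of_inj a a' : char_of a = char_of a' -> d != 0 -> a' = a \/ a' = a + d.
Proof.
move=> /ffunP E d0; apply: NNPP => /not_or_and[na nad].
have ind : indep2 d (a + a').
  rewrite /indep2 d0 /=; apply/andP; split.
    by apply/eqP=> /eqP; rewrite addr_eq0 F2_oppmx => /eqP aa; apply: na.
  apply/eqP=> dE; apply: nad; rewrite dE addrA F2_mx_addxx add0r.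
  by [].
have [l [dl al]] := dual2 0 1 ind.
have {}dl : pairing d l = 0 := dl; have {al} : pairing (a + a') l = 1 := al; rewrite pairingDl.
have := E l; rewrite !ffunE dl eqxx => /sign2_inj <-.
rewrite F2_addxx => /esym/eqP; by rewrite oner_eq0.
Qed.

Lemma eigv_functional a v : eigv d a v -> v != 0 ->
  exists2 kap : 'cV[F]_N, (v *m kap) 0 0 != 0 &
    forall l, pairing d l = 0 -> sb (transv d l) *m kap = sign2 (pairing a l) *: kap.
Proof.
move=> /weight_eigv w v0; have [kap k0 kE] := weight_functional (ltn0Sn 1) trgrpX trgrpC w v0.
by exists kap => // l dl; have := kE l; rewrite /trgrp ffunE dl eqxx.
Qed.

(** There are 2^(n-1) - 1 nontrivial characters, represented by the nonzero [a] with a(l0) = 0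
    for a fixed l0 with d(l0) = 1. Their number is more than half of the dimension, so one of the
    eigenspaces is at most a line. *)
Lemma eigv_line : d != 0 ->
  exists2 a, indep2 d a & forall v w, eigv d a v -> eigv d a w -> w != 0 -> exists c : F, v = c *: w.
Proof.
move=> d0; have [l0 dl0] : exists l0, pairing d l0 = 1.
  have /eqP/rowP/eqfunP := d0; rewrite negb_forall => /existsP[j].
  rewrite mxE => dj; exists (delta_mx j 0); rewrite /pairing -colE mxE.
  by case: (F2_cases (d 0 j)) dj => // ->; rewrite eqxx.
pose A1 := [set a : 'rV['F_2]_n | pairing a l0 == 0]; pose A0 := A1 :\ 0.
have cA1 : (2 * #|A1| = 2 ^ n)%N.
  have shift : [set a + d | a in A1] = ~: A1.
    apply/setP=> a; rewrite !inE; apply/imsetP/idP => [[b]|al].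
      rewrite inE => /eqP bl ->; by rewrite pairingDl bl dl0 add0r oner_eq0.
    exists (a + d); last by rewrite -addrA F2_mx_addxx addr0.
    by rewrite inE pairingDl dl0; case: (F2_cases (pairing a l0)) al => ->; rewrite ?eqxx ?F2_addxx.
  have := cardsC A1; rewrite -shift card_imset; last exact: addIr.
  by rewrite card_mx mul1n card_Fp // addnn mul2n.
have cA0 : (2 * #|A0| = 2 ^ n - 2)%N.
  have := cardsD1 0 A1; rewrite inE /pairing mul0mx mxE eqxx -/A0 => cA; rewrite -cA1 cA mulnDr muln1 addKn.
  by [].
have inj : {in A0 &, injective char_of}.
  move=> a a'; rewrite !inE => /andP[_ /eqP al] /andP[_ /eqP al'] /char_of_inj /(_ d0)[//|E].
  by move: al'; rewrite E pairingDl al dl0 add0r => /eqP; rewrite oner_eq0.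
have us : uniq [seq char_of a | a in A0].
  by rewrite map_inj_in_uniq ?enum_uniq // => x y; rewrite !mem_enum; apply: inj.
have [|chi /mapP[a aA ->] line] := weights_line (ltn0Sn 1) trgrpX trgrpC us.
  by rewrite size_map -cardE cA0.
exists a; last by move=> v w /weight_eigv wv /weight_eigv ww; apply: line.
move: aA; rewrite mem_enum !inE => /andP[a0 /eqP al]; rewrite /indep2 d0 a0 /=.
by apply/eqP=> E; move: dl0; rewrite E al => /esym/eqP; rewrite oner_eq0.
Qed.

(** In a simultaneous eigenbasis some vector is not fixed by the nontrivial transvection. Its
    eigenvalues are signs and define a character of the group of transvections, which extends to
    all columns along a projection and so comes from a row [a]. *)
Lemma eigv_exists l1 : pairing d l1 = 0 -> sb (transv d l1) != 1%:M -> d != 0 ->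
  exists a v, [/\ indep2 d a, v != 0 & eigv d a v].
Proof.
move=> dl1 nt d0; have [Q [D [uQ QE]]] := weight_basis (ltn0Sn 1) trgrpX trgrpC.
have XE l : trgrp l = Q *m diag_mx (D l) *m invmx Q by rewrite -QE mulmxK.
have [k Dk] : exists k, D l1 0 k != 1.
  apply: NNPP => H0; move/eqP: nt; apply.
  have H k : D l1 0 k == 1 by apply/negPn/negP=> H; apply: H0; exists k.
  have := XE l1; rewrite /trgrp dl1 eqxx => ->.
  rewrite (_ : diag_mx _ = 1%:M) ?mulmx1 ?mulmxV //.
  apply/matrixP=> r c; rewrite !mxE; case: eqP => [->|]; rewrite ?mulr0n // mulr1n.
  exact/eqP.
pose v := row k (invmx Q).
have vX l : v *m trgrp l = D l 0 k *: v.
  rewrite -row_mul XE !mulmxA mulVmx // mul1mx; apply/rowP=> j.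
  by rewrite mxE mul_diag_mx mxE [RHS]mxE [in RHS]mxE.
have v0 : v != 0.
  apply/eqP=> /(congr1 (mulmx^~ Q)); rewrite -row_mul mulVmx // mul0mx row1 => /rowP/(_ k).
  by rewrite !mxE !eqxx => /eqP; rewrite oner_eq0.
have injv (x y : F) : x *: v = y *: v -> x = y.
  move/eqP; rewrite -subr_eq0 -scalerBl scaler_eq0 (negPf v0) orbF subr_eq0.
  by move/eqP.
have Dpm l : D l 0 k = 1 \/ D l 0 k = -1.
  have : D l 0 k ^+ 2 = 1.
    apply: injv; rewrite expr2 scale1r -scalerA -vX scalemxAl -vX -mulmxA.
    by rewrite -[trgrp l *m _]/(_ * _) -expr2 trgrpX mulmx1.
  by move/eqP; rewrite sqrf_eq1 => /orP[/eqP|/eqP]; [left|right].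
have DM l l' : pairing d l = 0 -> pairing d l' = 0 -> D (l + l') 0 k = D l 0 k * D l' 0 k.
  move=> dl dl'; apply: injv; rewrite -vX -scalerA -vX scalemxAl -vX -mulmxA.
  congr (_ *m _); rewrite /trgrp dl dl' pairingDr dl dl' addr0 eqxx.
  by rewrite -(sbM (transv_unit dl) (transv_unit dl')) transvD.
have D0 : D 0 0 k = 1.
  apply: injv; rewrite -vX /trgrp /pairing mulmx0 mxE eqxx transv0 sb1 mulmx1 scale1r.
  by [].
(* the projection onto the kernel of [d] along [l0] extends the character to all columns *)
have [l0 dl0] : exists l0, pairing d l0 = 1.
  have /eqP/rowP/eqfunP := d0; rewrite negb_forall => /existsP[j].
  rewrite mxE => dj; exists (delta_mx j 0); rewrite /pairing -colE mxE.
  by case: (F2_cases (d 0 j)) dj => // ->; rewrite eqxx.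
pose pr (l : 'cV['F_2]_n) := l + pairing d l *: l0.
have dpr l : pairing d (pr l) = 0.
  by rewrite /pr pairingDr {2}/pairing -scalemxAr mxE -/(pairing _ _) dl0 mulr1 F2_addxx.
have prD l l' : pr (l + l') = pr l + pr l' by rewrite /pr pairingDr scalerDl addrACA.
pose phi l : 'F_2 := if D (pr l) 0 k == 1 then 0 else 1.
have sign2phi l : D (pr l) 0 k = sign2 (phi l).
  rewrite /phi; case: (Dpm (pr l)) => ->; first by rewrite eqxx sign2_0.
  by rewrite -subr_eq0 -opprD oppr_eq0 (pnatr_eq0 F 2) sign2_1.
have phiD l l' : phi (l + l') = phi l + phi l'.
  by apply: sign2_inj; rewrite sign2D -!sign2phi prD DM.
have phi0 : phi 0 = 0 by apply: (addrI (phi 0)); rewrite -phiD !addr0.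
pose a : 'rV['F_2]_n := \row_j phi (delta_mx j 0).
have aE l : pairing a l = phi l.
  rewrite {2}[l](matrix_sum_delta) /pairing mxE.
  rewrite (big_morph phi phiD phi0); apply: eq_bigr => j _; rewrite big_ord1 mxE.
  by case: (F2_cases (l j 0)) => ->; rewrite ?scale0r ?scale1r ?mulr0 ?mulr1 ?phi0.
have Ea : eigv d a v.
  move=> l dl; rewrite aE -sign2phi /pr dl scale0r addr0 -vX /trgrp dl eqxx.
  by [].
exists a, v; split=> //.
have al1 : pairing a l1 = 1.
  have : sign2 (pairing a l1) != 1.
    by rewrite aE -sign2phi /pr dl1 scale0r addr0.
  by case: (F2_cases (pairing a l1)) => -> //; rewrite sign2_0 eqxx.
rewrite /indep2 d0 /=; apply/andP; split; apply/eqP=> E.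
  by move: al1; rewrite E /pairing mul0mx mxE => /esym/eqP; rewrite oner_eq0.
by move: al1; rewrite -E dl1 => /esym/eqP; rewrite oner_eq0.
Qed.
End FixDirection.
End SmallRep.

(** * An equivariant family of eigenvectors *)

Section Cocycle.
Variables (F : numClosedFieldType) (n N' : nat).
Local Notation N := N'.+1.
Hypothesis n4 : (4 < n)%N.
Hypothesis hN : (N < 2 ^ n - 2)%N.
Variable sb : 'M['F_2]_n -> 'M[F]_N.
Hypothesis sb1 : sb 1%:M = 1%:M.
Hypothesis sbM : forall g h, g \in unitmx -> h \in unitmx -> sb (g *m h) = sb g *m sb h.
Variables (iz oz : 'I_n).
Hypothesis ioz : iz != oz.
Hypothesis nt : sb (xe iz oz 1) != 1%:M.

Lemma delta_neq0 (i : 'I_n) : delta_mx 0 i != 0 :> 'rV['F_2]_n.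
Proof. by apply/eqP=> /rowP/(_ i); rewrite !mxE !eqxx => /eqP; rewrite oner_eq0. Qed.

(** One nontrivial transvection gives one nontrivial eigenspace, and GL_n permutes transitively
    the pairs (d, a). *)
Lemma eigv_ex d a : indep2 d a -> exists2 v, v != 0 & eigv sb d a v.
Proof.
move=> ind.
have dl : pairing (delta_mx 0 oz) (delta_mx iz 0) = 0 :> 'F_2.
  by rewrite /pairing mul_delta_mx_cond eq_sym (negPf ioz) mulr0n mxE.
have tE : transv (delta_mx 0 oz) (delta_mx iz 0) = xe iz oz 1 :> 'M['F_2]_n.
  by rewrite /transv mul_delta_mx /xe scale1r.
have nt' : sb (transv (delta_mx 0 oz) (delta_mx iz 0)) != 1%:M by rewrite tE.
have [a' [v [ind' v0 Ev]]] := eigv_exists sb1 sbM dl nt' (delta_neq0 oz).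
have [g ug [<- <-]] := moving2 ind' ind.
exists (v *m sb g); first exact: mul_sb_neq0.
exact: (eigv_move sbM ug Ev).
Qed.

Lemma eigv_uniq d a v w : indep2 d a -> eigv sb d a v -> eigv sb d a w -> w != 0 ->
  exists c : F, v = c *: w.
Proof.
move=> ind Ev Ew w0; have d0 : d != 0 by case/and3P: ind.
have [a' ind' line] := eigv_line hN sb1 sbM d0.
have [g ug [dg ag]] := moving2 ind ind'.
have Evg : eigv sb d a' (v *m sb g) by rewrite -{1}dg -ag; exact: (eigv_move sbM ug Ev).
have Ewg : eigv sb d a' (w *m sb g) by rewrite -{1}dg -ag; exact: (eigv_move sbM ug Ew).
have [|c E] := line _ _ Evg Ewg; first exact: mul_sb_neq0.
exists c; have us := sb_unit sb1 sbM ug.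
by rewrite -[v](mulmxK us) E -scalemxAl mulmxK.
Qed.

(** Three distinct indices; the first two rows e_0, e_1 of the standard basis are the reference
    pair (d, a). *)
Definition j0 := Ordinal (ltn_trans (isT : 0 < 4)%N n4).
Definition j1 := Ordinal (ltn_trans (isT : 1 < 4)%N n4).
Definition j2 := Ordinal (ltn_trans (isT : 2 < 4)%N n4).
Definition stdrow (i : 'I_n) : 'rV['F_2]_n := delta_mx 0 i.

Lemma stdrow_neq i j : i != j -> stdrow i != stdrow j.
Proof.
move=> ij; apply/eqP=> /rowP/(_ i); rewrite !mxE !eqxx (negPf ij) => /eqP.
by rewrite oner_eq0.
Qed.

Lemma indep2_stdrow : indep2 (stdrow j0) (stdrow j1).
Proof. by rewrite /indep2 !delta_neq0 /=; apply: stdrow_neq. Qed.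

Lemma indep3_stdrow : indep3 (stdrow j0) (stdrow j1) (stdrow j2).
Proof.
rewrite /indep3 indep2_stdrow delta_neq0 !stdrow_neq //=.
apply/eqP=> /rowP/(_ j2); rewrite !mxE !eqxx /= => /eqP.
by rewrite addr0 oner_eq0.
Qed.

Lemma int_unit (g : 'M[int]_n) : \det g = 1 -> (map_mx intr g : 'M['F_2]_n) \in unitmx.
Proof. by move=> dg; rewrite unitmxE det_map_mx dg rmorph1 unitr1. Qed.

Lemma stdrow_xe (i k l : 'I_n) (a : int) : i != k -> stdrow i *m map_mx intr (xe k l a) = stdrow i.
Proof.
move=> ik; rewrite map_xe /xe mulmxDr mulmx1 -scalemxAr mul_delta_mx_cond (negPf ik) mulr0n.
by rewrite scaler0 addr0.
Qed.

(** The stabiliser multiplies the vectors of the line by scalars. It is generated by the X_ij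
    with i different from the first two indices, together with matrices that are trivial modulo 2,
    and each such X_ij is a commutator of two others, [xe i k a] and [xe k j 1]. Scalars commute,
    so X_ij acts by 1. *)
Lemma stab v g : eigv sb (stdrow j0) (stdrow j1) v -> v != 0 ->
  g \in unitmx -> stdrow j0 *m g = stdrow j0 -> stdrow j1 *m g = stdrow j1 -> v *m sb g = v.
Proof.
move=> Ev v0 /F2_lift[h dh <-] h0 h1.
have scal k : \det k = 1 -> stdrow j0 *m map_mx intr k = stdrow j0 -> stdrow j1 *m map_mx intr k = stdrow j1 ->
    exists2 c : F, c != 0 & v *m sb (map_mx intr k) = c *: v.
  move=> dk k0 k1; have uk := int_unit dk; have := eigv_move sbM uk Ev; rewrite k0 k1 => Evk.
  have [c E] := eigv_uniq indep2_stdrow Evk Ev v0; exists c => //.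
  apply: contraNneq (mul_sb_neq0 sb1 sbM uk v0) => c0; by rewrite E c0 scale0r.
have ximp (i : 'I_n) : (1 < i)%N -> j0 != i /\ j1 != i.
  by move=> i1; split; apply/eqP=> E; move: i1; rewrite -E.
have vxe (i j : 'I_n) (a : int) : i != j -> (1 < i)%N -> v *m sb (map_mx intr (xe i j a)) = v.
  move=> ij i1; have [n0 n1] := ximp _ i1.
  have [k] := @fresh_ord n [:: j0; j1; i; j] n4.
  rewrite !inE !negb_or => /and4P[k0 k1 ki kj].
  have ik : i != k by rewrite eq_sym.
  have k0' : j0 != k by rewrite eq_sym.
  have k1' : j1 != k by rewrite eq_sym.
  have [c1 c10 E1] : exists2 c : F, c != 0 & v *m sb (map_mx intr (xe i k a)) = c *: v.
    by apply: scal; rewrite ?det_xe ?stdrow_xe.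
  have [c2 c20 E2] : exists2 c : F, c != 0 & v *m sb (map_mx intr (xe k j 1)) = c *: v.
    by apply: scal; rewrite ?det_xe ?stdrow_xe.
  have [c3 _ E3] : exists2 c : F, c != 0 & v *m sb (map_mx intr (xe i j a)) = c *: v.
    by apply: scal; rewrite ?det_xe ?stdrow_xe.
  have := xe_steinberg a 1 ik kj ij; rewrite mulr1 => /(congr1 (map_mx (intr : int -> 'F_2))).
  rewrite !map_mxM => /(congr1 (fun M => v *m sb M)).
  have U1 : map_mx intr (xe i k a) \in @unitmx 'F_2 n by apply: int_unit; rewrite det_xe.
  have U2 : map_mx intr (xe k j 1) \in @unitmx 'F_2 n by apply: int_unit; rewrite det_xe.
  have U3 : map_mx intr (xe i j a) \in @unitmx 'F_2 n by apply: int_unit; rewrite det_xe.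
  have U32 : map_mx intr (xe i j a) *m map_mx intr (xe k j 1) \in @unitmx 'F_2 n.
    by rewrite unitmx_mul U3 U2.
  rewrite (sbM U1 U2) (sbM U32 U1) (sbM U3 U2) !mulmxA E1 E3 -!scalemxAl E2 -!scalemxAl E1.
  rewrite !scalerA mulrC => /eqP; rewrite -subr_eq0 -scalerBl scaler_eq0 (negPf v0) orbF.
  rewrite -[X in X - _]mul1r -mulrA -mulrBl mulf_eq0 mulf_eq0 (negPf c10) (negPf c20) !orbF.
  by rewrite subr_eq0 => /eqP <-; rewrite scale1r.
pose P (k : 'M[int]_n) := v *m sb (map_mx intr k) = v.
have step k k' : \det k = 1 -> \det k' = 1 -> P k -> P k' -> P (k *m k').
  move=> dk dk' Pk Pk'; rewrite /P map_mxM (sbM (int_unit dk) (int_unit dk')) mulmxA.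
  by rewrite Pk.
have even k : map_mx intr k = 1%:M :> 'M['F_2]_n -> P k by move=> E; rewrite /P E sb1 mulmx1.
apply: (@sl_int_ind n 2 P) => //.
- by apply: even; rewrite map_mx1.
- move=> k i j a ij /orP[i1|a2] dk Pk; apply: step; rewrite ?det_xe //; first exact: vxe.
  by apply: even; rewrite map_xe /=; move: a2; rewrite -intr_F2_eq0 => /eqP->; rewrite xe0.
- move=> k i j ij dk Pk; apply: step; rewrite ?det_sgm //; apply: even.
  apply/matrixP=> r c; rewrite !mxE; case: (r == c); last by rewrite mul0r rmorph0.
  by case: ifP => _; apply/val_inj.
move=> r c r2; rewrite -intr_F2_eq0 rmorphB /= subr_eq0 rmorph_nat.
have [->|->] : r = j0 \/ r = j1.
    by case: r r2 => [[|[|r]] H] //= _; [left|right]; apply/val_inj.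
  move/rowP/(_ c): h0; rewrite -rowE !mxE => ->.
  by rewrite eqxx /= [c == _]eq_sym.
move/rowP/(_ c): h1; rewrite -rowE !mxE => ->.
by rewrite eqxx /= [c == _]eq_sym.
Qed.

(** Transport of the reference vector. The vector is labelled by a and b = a + d, not by a and d,
    because this makes the symmetry between the two representatives of the character visible. *)
Lemma u_exists : exists u : 'rV['F_2]_n -> 'rV['F_2]_n -> 'rV[F]_N,
  [/\ forall a b, indep2 a b -> u a b != 0 /\ eigv sb (a + b) a (u a b) &
      forall a b g, g \in unitmx -> indep2 a b -> u a b *m sb g = u (a *m g) (b *m g)].
Proof.
have [v0 v00 Ev0] := eigv_ex indep2_stdrow.
have [u uE] : exists u : 'rV['F_2]_n * 'rV['F_2]_n -> 'rV[F]_N,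
    forall p g, g \in unitmx -> (stdrow j1 *m g, stdrow j1 *m g + stdrow j0 *m g) = p -> u p = v0 *m sb g.
  apply: (@fin_all_exists _ _ (fun p w => forall g, g \in unitmx ->
    (stdrow j1 *m g, stdrow j1 *m g + stdrow j0 *m g) = p -> w = v0 *m sb g)) => p.
  have [[g [ug gp]]|none] := classic (exists g, g \in unitmx /\ (stdrow j1 *m g, stdrow j1 *m g + stdrow j0 *m g) = p);
    last by exists 0 => g ug gp; case: none; exists g.
  exists (v0 *m sb g) => h uh; rewrite -gp => -[E1]; rewrite E1 => /addrI E0.
  have ui : invmx h \in unitmx by rewrite unitmx_inv.
  have ugh : g *m invmx h \in unitmx by rewrite unitmx_mul ug.
  rewrite -{2}(stab Ev0 v00 ugh) ?mulmxA -?E0 -?E1 ?mulmxK //.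
  by rewrite -mulmxA -(sbM ugh uh) mulmxKV.
have uE' g : g \in unitmx -> u (stdrow j1 *m g, stdrow j1 *m g + stdrow j0 *m g) = v0 *m sb g by move=> ug; apply: uE.
have get a b : indep2 a b -> exists2 g, g \in unitmx & a = stdrow j1 *m g /\ b = stdrow j1 *m g + stdrow j0 *m g.
  move=> ind; have ind' : indep2 (a + b) a.
    case/and3P: ind => a0 b0 ab; apply/and3P; split=> //.
      by rewrite addr_eq0 F2_oppmx.
    by rewrite -subr_eq0 addrAC subrr add0r.
  have [g ug [g0 g1]] := moving2 indep2_stdrow ind'; exists g; rewrite // g0 g1; split=> //.
  by rewrite addrA F2_mx_addxx add0r.
exists (fun a b => u (a, b)); split=> [a b /get[g ug [-> ->]]|a b h uh /get[g ug [-> ->]]].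
  rewrite uE' //; split; first exact: mul_sb_neq0.
  rewrite addrA F2_mx_addxx add0r; exact: (eigv_move sbM ug Ev0).
rewrite uE' // mulmxDl -!mulmxA uE' ?unitmx_mul ?ug //.
by rewrite (sbM ug uh).
Qed.
End Cocycle.

(** * The cocycle relation and the dimension bound *)

Section F2Comb.
Variable n : nat.
Implicit Types a b c d : 'rV['F_2]_n.

Lemma F2_addK a b : a + b + b = a. Proof. by rewrite -addrA F2_mx_addxx addr0. Qed.
Lemma F2_addKl a b : a + (a + b) = b. Proof. by rewrite addrA F2_mx_addxx add0r. Qed.
Lemma F2_eq_add a b c : (a == b + c) = (a + b == c).
Proof. by apply/eqP/eqP => [->|<-]; [rewrite (addrC b) F2_addK|rewrite addrC F2_addK]. Qed.

Lemma indep2_sym a b : indep2 a b = indep2 b a.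
Proof. by rewrite /indep2 (eq_sym a b) andbCA. Qed.
Lemma indep2_add a b : indep2 a b -> indep2 (a + b) a.
Proof.
case/and3P=> a0 b0 ab; apply/and3P; split=> //; first by rewrite addr_eq0 F2_oppmx.
by rewrite eq_sym F2_eq_add F2_mx_addxx eq_sym.
Qed.
Lemma indep3_iff a b c : indep3 a b c =
  [&& a != 0, b != 0, c != 0, a + b != 0, a + c != 0, b + c != 0 & a + b + c != 0].
Proof.
have E x y : (x + y == 0 :> 'rV['F_2]_n) = (x == y) by rewrite addr_eq0 F2_oppmx.
rewrite /indep3 /indep2 !E (eq_sym c a) (eq_sym c b) (eq_sym c (a + b)).
by case: (a == 0); case: (b == 0); case: (c == 0); case: (a == b); case: (a == c); case: (b == c).
Qed.
Lemma indep3_sym12 a b c : indep3 a b c -> indep3 b a c.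
Proof.
rewrite !indep3_iff (addrC b a) => /and5P[-> -> -> -> /and3P[-> -> ->]].
by [].
Qed.
Lemma indep3_sym23 a b c : indep3 a b c -> indep3 a c b.
Proof.
rewrite !indep3_iff (addrAC a c b) (addrC c b) => /and5P[-> -> -> -> /and3P[-> -> ->]].
by [].
Qed.
Lemma indep3_addr a b c : indep3 a b c -> indep3 a (a + b) c.
Proof.
rewrite !indep3_iff F2_addKl => /and5P[-> -> -> -> /and3P[-> -> ->]].
by [].
Qed.
Lemma indep3_2 a b c : indep3 a b c -> indep2 a b. Proof. by case/and5P. Qed.
Lemma indep3_2' a b c : indep3 a b c -> indep2 a c. Proof. by move/indep3_sym23/indep3_2. Qed.
Lemma indep3_2'' a b c : indep3 a b c -> indep2 b c. Proof. by move/indep3_sym12/indep3_2'. Qed.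
End F2Comb.

Section Cocycle.
Variables (F : numClosedFieldType) (n N' : nat).
Local Notation N := N'.+1.
Hypothesis n4 : (4 < n)%N.
Variable sb : 'M['F_2]_n -> 'M[F]_N.
Hypothesis sb1 : sb 1%:M = 1%:M.
Hypothesis sbM : forall g h, g \in unitmx -> h \in unitmx -> sb (g *m h) = sb g *m sb h.
Hypothesis eigv1 : forall d a v w, indep2 d a -> eigv sb d a v -> eigv sb d a w -> w != 0 ->
  exists c : F, v = c *: w.
Variable u : 'rV['F_2]_n -> 'rV['F_2]_n -> 'rV[F]_N.
Hypothesis u0 : forall a b, indep2 a b -> u a b != 0.
Hypothesis uE : forall a b, indep2 a b -> eigv sb (a + b) a (u a b).
Hypothesis uM : forall a b g, g \in unitmx -> indep2 a b -> u a b *m sb g = u (a *m g) (b *m g).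

Lemma opp_eq0 (v : 'rV[F]_N) : v = - v -> v = 0.
Proof.
move/eqP; rewrite -subr_eq0 opprK -mulr2n -scaler_nat scaler_eq0 pnatr_eq0 /=.
by move/eqP.
Qed.

(** A transvection with direction a + b that takes the value 1 on a exchanges a and b, and acts
    on u(a, b) by -1. *)
Lemma u_anti a b : indep2 a b -> u b a = - u a b.
Proof.
move=> ind; have [l [al bl]] := dual2 1 1 ind.
have {}al : pairing a l = 1 := al; have {}bl : pairing b l = 1 := bl.
have dl : pairing (a + b) l = 0 by rewrite pairingDl al bl F2_addxx.
have := uE ind dl; rewrite (uM (transv_unit dl) ind) !mul_transv al bl !scale1r F2_addKl.
by rewrite (addrC a) F2_addKl sign2_1 scaleN1r.
Qed.

Lemma u_transv d l x y : pairing d l = 0 -> indep2 x y ->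
  u x y *m sb (transv d l) = u (x + pairing x l *: d) (y + pairing y l *: d).
Proof. by move=> dl ind; rewrite (uM (transv_unit dl) ind) !mul_transv. Qed.

(** Put d = a + b. The left-hand side q is an eigenvector for direction d and the character of
    a + c, hence a multiple of u(a + c, b + c). The linear map that fixes d and exchanges a and c
    fixes this vector, but it maps q to -q by antisymmetry. *)
Lemma square_rel a b c : indep3 a b c ->
  u a c - u b c - u a (c + (a + b)) + u b (c + (a + b)) = 0.
Proof.
move=> ind; set d := a + b; set q := _ + _.
have i2d : indep2 a b := indep3_2 ind.
have inds : [/\ indep2 a c, indep2 b c, indep2 a (c + d) & indep2 b (c + d)].
  move: ind; rewrite indep3_iff => /and5P[a0 b0 c0 ab /and3P[ac bc abc]].
  have E x y : (x + y == 0 :> 'rV['F_2]_n) = (x == y) by rewrite addr_eq0 F2_oppmx.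
  have cd : c + d = a + b + c by rewrite addrC.
  have acd : a + (c + d) = b + c by rewrite cd -addrA F2_addKl.
  have bcd : b + (c + d) = a + c by rewrite cd -addrA addrCA F2_addKl.
  rewrite /indep2 -(E a c) -(E b c) -(E a (c + d)) -(E b (c + d)) acd bcd cd.
  by rewrite a0 b0 c0 ac bc abc.
case: inds => i1 i2 i3 i4.
have dac : indep2 d (a + c).
  move: ind; rewrite indep3_iff => /and5P[a0 b0 c0 ab /and3P[ac bc abc]].
  have E x y : (x + y == 0 :> 'rV['F_2]_n) = (x == y) by rewrite addr_eq0 F2_oppmx.
  have dac : d + (a + c) = b + c by rewrite /d addrACA F2_mx_addxx add0r.
  by rewrite /indep2 -(E d (a + c)) dac ab ac bc.
have Eq : eigv sb d (a + c) q.
  move=> l dl; rewrite /q !mulmxDl !mulNmx !u_transv // pairingDl.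
  have bl : pairing b l = pairing a l.
    have := dl; rewrite /d pairingDl; case: (F2_cases (pairing a l)) => ->; case: (F2_cases (pairing b l)) => ->;
    rewrite ?addr0 ?add0r // => /eqP; by rewrite oner_eq0.
  rewrite bl pairingDl dl addr0 /q.
  have da : a + d = b by rewrite /d F2_addKl.
  have db : b + d = a by rewrite /d addrC F2_addK.
  case: (F2_cases (pairing a l)) => ->; case: (F2_cases (pairing c l)) => ->;
    rewrite ?scale0r ?scale1r ?addr0 ?add0r ?F2_addxx ?sign2_0 ?sign2_1 ?scale1r ?scaleN1r ?da ?db ?F2_addK // ?addr0.
  - by apply/rowP=> j; rewrite !mxE; ring.
  - by apply/rowP=> j; rewrite !mxE; ring.
  - by apply/rowP=> j; rewrite !mxE; ring.
have [g ug [ga gb gc]] : exists2 g, g \in unitmx & [/\ a *m g = c, b *m g = c + d & c *m g = a].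
  have : indep3 c (c + d) a.
    have E : c + (c + d) + a = b by rewrite F2_addKl /d addrC F2_addKl.
    have E' : c + d + a = c + b by rewrite -addrA /d (addrC a) F2_addK.
    move: ind i3 i4; rewrite !indep3_iff E E' F2_addKl => /and5P[-> -> -> -> /and3P[ac bc abc]].
    rewrite (addrC c a) ac (addrC c b) bc /= => /and3P[_ -> _] _.
    by [].
  by move/(moving3 ind).
have gd : d *m g = d by rewrite /d mulmxDl ga gb F2_addKl.
have gq : q *m sb g = - q.
  rewrite /q !mulmxDl !mulNmx !uM // ga gb mulmxDl gc gd.
  have ad : a + d = b by rewrite /d F2_addKl.
  rewrite ad (u_anti i1) (u_anti i3) (u_anti i2) (u_anti i4).
  by apply/rowP=> j; rewrite !mxE; ring.
have dac' : indep2 (a + c) (a + c + d).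
  by rewrite indep2_sym; apply: indep2_add; rewrite indep2_sym.
have Eu : eigv sb d (a + c) (u (a + c) (a + c + d)).
  by have := uE dac'; rewrite F2_addKl.
have [k qk] := eigv1 dac Eq Eu (u0 dac').
have : q *m sb g = q.
  by rewrite qk -scalemxAl (uM ug dac') (mulmxDl (a + c) d) gd (mulmxDl a c) ga gc (addrC c).
by rewrite gq => /esym/opp_eq0.
Qed.

(** Both sides lie in the line of (a + b, a): transvections with direction a + b that take the
    value 1 on c preserve the left-hand side by [square_rel], those that take the value 1 on a
    exchange its terms. *)
Lemma theta_ex a b c : indep3 a b c -> exists th : F, u a c - u b c = th *: u a b.
Proof.
move=> ind; have i2 := indep3_2 ind.
have i2' : indep2 (a + b) a := indep2_add i2.
apply: (eigv1 i2' _ (uE i2) (u0 i2)).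
move=> l dl; rewrite mulmxDl mulNmx !u_transv ?(indep3_2' ind) ?(indep3_2'' ind) //.
have bl : pairing b l = pairing a l.
  have := dl; rewrite pairingDl; case: (F2_cases (pairing a l)) => ->; case: (F2_cases (pairing b l)) => ->;
  rewrite ?addr0 ?add0r // => /eqP; by rewrite oner_eq0.
have := square_rel ind; rewrite bl.
have da : a + (a + b) = b by rewrite F2_addKl.
have db : b + (a + b) = a by rewrite addrC F2_addK.
move=> /rowP sq.
case: (F2_cases (pairing a l)) => ->; case: (F2_cases (pairing c l)) => ->;
  rewrite ?scale0r ?scale1r ?addr0 ?da ?db ?sign2_0 ?sign2_1 ?scale1r ?scaleN1r ?opprB //;
  apply/rowP=> j; move: (sq j); rewrite !mxE => sqj.
- apply/eqP; rewrite -subr_eq0 -oppr_eq0 -sqj; apply/eqP; ring.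
- apply/eqP; rewrite -subr_eq0 -sqj; apply/eqP; ring.
Qed.

(** By transitivity on independent triples the factor th of [theta_ex] does not depend on the
    triple. If it were not 1, combining the relation with its permutation would give
    u(x, z) = (1 + th) u(y, z) for all independent triples; applied to a, b and a + b this forces
    th = 0, so that u(x, z) does not depend on x, against antisymmetry. *)
Lemma u_cocycle a b c : indep3 a b c -> u a c - u b c = u a b.
Proof.
move=> ind; have [th thE] := theta_ex ind.
have gen x y z : indep3 x y z -> u x z - u y z = th *: u x y.
  move=> ind'; have [g ug [<- <- <-]] := moving3 ind ind'.
  rewrite -!uM ?(indep3_2 ind) ?(indep3_2' ind) ?(indep3_2'' ind) //.
  by rewrite -mulmxBl thE scalemxAl.
have [th1|th1] := eqVneq th 1; first by rewrite thE th1 scale1r.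
(* otherwise changing one entry multiplies [u] by a fixed constant *)
have chg x y z : indep3 x y z -> u x z = (1 + th) *: u y z.
  move=> ixyz; have iyz := indep3_2'' ixyz; have ixz := indep3_2' ixyz; have ixy := indep3_2 ixyz.
  have E1 := gen _ _ _ ixyz.
  have E2 := gen _ _ _ (indep3_sym23 (indep3_sym12 (indep3_sym23 ixyz))).
  rewrite (u_anti ixz) (u_anti ixy) (u_anti iyz) in E2.
  have nz : 1 - th != 0 by rewrite subr_eq0 eq_sym.
  apply: (scalerI nz); apply/rowP=> j; move/rowP/(_ j): E1; move/rowP/(_ j): E2; rewrite !mxE => E2 E1.
  apply/eqP; rewrite -subr_eq0; apply/eqP.
  have -> : (1 - th) * u x z 0 j - (1 - th) * ((1 + th) * u y z 0 j) =
    (u x z 0 j - u y z 0 j - th * u x y 0 j) + th * (- u x z 0 j - - u x y 0 j - th * - u y z 0 j) by ring.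
  by rewrite E1 E2; ring.
have k1 : th = 0.
  have iabc := chg _ _ _ ind.
  have E2 := chg _ _ _ (indep3_addr (indep3_sym12 ind)).
  have E3 := chg _ _ _ (indep3_addr ind).
  rewrite (addrC b) -E3 in E2; rewrite E2 in iabc.
  have : th *: u a c = 0.
    by apply: (addrI (u a c)); rewrite addr0 {3}iabc scalerDl scale1r.
  by move/eqP; rewrite scaler_eq0 (negPf (u0 (indep3_2' ind))) orbF => /eqP.
have same x y z : indep3 x y z -> u x z = u y z by move/chg; rewrite k1 addr0 scale1r.
have S1 := same _ _ _ ind.
have S2 := same _ _ _ (indep3_sym23 (indep3_sym12 (indep3_sym23 ind))).
have S3 := same _ _ _ (indep3_sym12 (indep3_sym23 ind)).
rewrite (u_anti (indep3_2' ind)) (u_anti (indep3_2 ind)) in S2.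
rewrite (u_anti (indep3_2'' ind)) -S1 in S3.
case/eqP: (u0 (indep3_2' ind)); apply: opp_eq0.
by rewrite S3 (oppr_inj S2).
Qed.


(** Including the diagonal makes the cocycle relation hold for all triples. *)
Definition utot a b := if a == b then 0 else u a b.

Lemma utot_anti a b : a != 0 -> b != 0 -> utot b a = - utot a b.
Proof.
move=> a0 b0; rewrite /utot eq_sym; case: (eqVneq a b) => [|ab]; first by rewrite oppr0.
by apply: u_anti; rewrite /indep2 a0 b0.
Qed.

Lemma indep3_ex (a b : 'rV['F_2]_n) : indep2 a b -> exists c, indep3 a b c.
Proof.
move=> ind; have [g ug [<- <-]] := moving2 (indep2_stdrow n4) ind.
exists (stdrow (j2 n4) *m g); have := indep3_stdrow n4; rewrite !indep3_iff -!mulmxDl.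
have E (x : 'rV['F_2]_n) : (x *m g == 0) = (x == 0).
  by rewrite -[0 in LHS](mul0mx _ g) (inj_eq (can_inj (mulmxK ug))).
by rewrite !E.
Qed.

(** For a linearly dependent triple, c = a + b, go through a vector w that is independent of
    a and b. *)
Lemma utot_cocycle a b c : a != 0 -> b != 0 -> c != 0 -> utot a b + utot b c = utot a c.
Proof.
move=> a0 b0 c0; have [->|ab] := eqVneq a b; first by rewrite {1}/utot eqxx add0r.
have [->|bc] := eqVneq b c; first by rewrite {2}/utot eqxx addr0.
have [<-|ac] := eqVneq a c; first by rewrite (utot_anti a0 b0) subrr /utot eqxx.
have iab : indep2 a b by rewrite /indep2 a0 b0.
have ibc : indep2 b c by rewrite /indep2 b0 c0.
have iac : indep2 a c by rewrite /indep2 a0 c0.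
rewrite /utot (negPf ab) (negPf bc) (negPf ac).
have [cab|ncab] := eqVneq c (a + b); last first.
  have /u_cocycle <- : indep3 a b c.
    by rewrite /indep3 iab c0 ncab (eq_sym c a) ac (eq_sym c b) bc.
  by rewrite subrK.
have [w iw] := indep3_ex iab.
have E1 := u_cocycle iw.
have E2 : u a w - u c w = u a c by apply: u_cocycle; rewrite cab; apply: indep3_addr.
have E3 : u b w - u c w = u b c.
  by apply: u_cocycle; rewrite cab (addrC a); apply/indep3_addr/indep3_sym12.
by rewrite -E1 -E2 -E3 addrA subrK.
Qed.

(** Put d = a + b and test the relation for z = d against the eigenfunctional k of u(a, b). It
    vanishes on u(x, d) for x outside {a, b}, because a transvection with direction d that fixes x
    but not a acts on k by -1. It takes opposite nonzero values on u(a, d) and u(b, d), whose difference is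
    u(a, b). *)
Lemma relation_const (f : 'rV['F_2]_n -> F) :
  (forall z, z != 0 -> \sum_(x | x != 0) f x *: utot x z = 0) ->
  forall a b, indep2 a b -> f a = f b.
Proof.
move=> rel a b iab; have [a0 b0 ab] : [/\ a != 0, b != 0 & a != b] by case/and3P: iab.
pose d := a + b; have iad : indep2 a d by rewrite indep2_sym; apply: indep2_add.
have ibd : indep2 b d by rewrite indep2_sym /d addrC; apply: indep2_add; rewrite indep2_sym.
have d0 : d != 0 by case/and3P: iad.
have [kap kap0 kapE] := eigv_functional sb1 sbM (uE iab) (u0 iab).
pose k (v : 'rV[F]_N) : F := (v *m kap) 0 0.
have kD v w : k (v + w) = k v + k w by rewrite /k mulmxDl mxE.
have kZ c v : k (c *: v) = c * k v by rewrite /k -scalemxAl mxE.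
have kN v : k (- v) = - k v by rewrite /k mulNmx mxE.
have k0 : k 0 = 0 by rewrite /k mul0mx mxE.
have kT v l : pairing d l = 0 -> pairing a l = 1 -> k (v *m sb (transv d l)) = - k v.
  by move=> dl al; rewrite /k -mulmxA kapE // al sign2_1 scaleN1r mulmxN mxE.
have kx x : x != 0 -> x != a -> x != b -> k (utot x d) = 0.
  move=> x0 xa xb; rewrite /utot; case: eqP => [//|/eqP xd].
  have i3 : indep3 a b x by rewrite /indep3 iab x0 xa xb.
  have [l [al bl xl]] := dual3 1 1 0 i3.
  have {}al : pairing a l = 1 := al; have {}bl : pairing b l = 1 := bl; have {}xl : pairing x l = 0 := xl.
  have dl : pairing d l = 0 by rewrite pairingDl al bl F2_addxx.
  have ixd : indep2 x d by rewrite /indep2 x0 d0.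
  have := kT (u x d) l dl al; rewrite u_transv // xl dl !scale0r !addr0.
  move/eqP; rewrite -subr_eq0 opprK -mulr2n mulrn_eq0 /=.
  by move/eqP.
have [l [al bl]] := dual2 1 1 iab.
have {}al : pairing a l = 1 := al; have {}bl : pairing b l = 1 := bl.
have dl : pairing d l = 0 by rewrite pairingDl al bl F2_addxx.
have kb : k (u b d) = - k (u a d).
  rewrite -(kT (u a d) l dl al) u_transv // al dl scale0r scale1r addr0 /d.
  by rewrite F2_addKl.
have kab : k (u a b) = k (u a d) *+ 2.
  have := utot_cocycle a0 d0 b0; rewrite (utot_anti b0 d0) /utot (negPf ab).
  have [/negPf-> /negPf->] : a != d /\ b != d by case/and3P: iad; case/and3P: ibd.
  by move=> <-; rewrite kD kN kb opprK mulr2n.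
have kad : k (u a d) != 0.
  by apply: contraNneq kap0 => E; rewrite -/(k _) kab E mul0rn.
have := congr1 k (rel d d0); rewrite k0 (big_morph k kD k0).
rewrite (bigD1 a) //= (bigD1 b) /=; last by rewrite b0 eq_sym.
rewrite big1 ?addr0 => [|x /andP[/andP[x0 xa] xb]]; last by rewrite kZ kx ?mulr0.
rewrite !kZ /utot; have [/negPf-> /negPf->] : a != d /\ b != d by case/and3P: iad; case/and3P: ibd.
rewrite kb mulrN -mulrBl => /eqP; rewrite mulf_eq0 (negPf kad) orbF subr_eq0.
by move/eqP.
Qed.

(** A relation among the u(x, z), completed by the coefficient of x = z so that the sum of all
    coefficients is zero, holds for every z by the cocycle relation; so its coefficients are all
    equal, and their sum being zero they vanish. *)
Lemma dim_bound : (2 ^ n - 2 <= N)%N.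
Proof.
pose z := stdrow (j0 n4); have z0 : z != 0 := delta_neq0 _.
pose A := [set x : 'rV['F_2]_n | (x != 0) && (x != z)].
have cA : #|A| = (2 ^ n - 2)%N.
  have := cardsC [set (0 : 'rV['F_2]_n); z]; rewrite cards2 eq_sym z0 card_mx mul1n card_Fp //.
  rewrite (_ : ~: _ = A) => [<-|]; first by rewrite addKn.
  by apply/setP=> x; rewrite !inE negb_or.
pose M : 'M[F]_(#|A|, N) := \matrix_i utot (enum_val i) z.
suff fM : row_free M by rewrite -cA -(eqP fM) rank_leq_col.
rewrite -kermx_eq0; apply/eqP/row_matrixP=> i; rewrite row0.
have : row i (kermx M) *m M = 0 by rewrite -row_mul mulmx_ker row0.
move: (row i _) => w wM.
have [y0A|noA] := pickP (mem A); last first.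
  by apply/rowP=> j; have := noA (enum_val j); rewrite /= enum_valP.
move=> y0in.
pose g x : F := if x \in A then w 0 (enum_rank_in y0in x) else 0.
pose s := \sum_(x in A) g x.
(* the coefficient at [z] is chosen such that the sum of all coefficients is zero *)
pose f x : F := if x == z then - s else g x.
have zA : z \notin A by rewrite inE eqxx andbF.
have sumA (V : zmodType) (h : 'rV['F_2]_n -> V) :
    \sum_(x | x != 0) h x = h z + \sum_(x in A) h x.
  by rewrite (bigD1 z) //=; congr (_ + _); apply: eq_bigl => x; rewrite inE.
have fA x : x \in A -> f x = g x.
  by move=> xA; rewrite /f; case: eqP => // xz; rewrite xz (negPf zA) in xA.
have sum0 : \sum_(x | x != 0) f x = 0.
  rewrite sumA {1}/f eqxx (eq_bigr g) ?addNr // => x xA; exact: fA.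
have relz : \sum_(x | x != 0) f x *: utot x z = 0.
  have zz : utot z z = 0 by rewrite /utot eqxx.
  rewrite sumA zz scaler0 add0r.
  rewrite (eq_bigr (fun x => g x *: utot x z)) => [|x xA]; last by rewrite fA.
  rewrite big_enum_val /= -[RHS]wM mulmx_sum_row; apply: eq_bigr => j _.
  by rewrite rowK /g enum_valP enum_valK_in.
have rel y : y != 0 -> \sum_(x | x != 0) f x *: utot x y = 0.
  move=> y0; rewrite (eq_bigr (fun x => f x *: utot x z + f x *: utot z y)) => [|x x0].
    by rewrite big_split /= relz add0r -scaler_suml sum0 scale0r.
  by rewrite -scalerDr utot_cocycle.
have cst := relation_const rel.
have fz x : x != 0 -> f x = f z.
  by move=> x0; have [->//|xz] := eqVneq x z; apply: cst; rewrite /indep2 x0 z0.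
have f0 : f z = 0.
  have := sum0; rewrite (eq_bigr (fun=> f z)) // sumr_const => /eqP.
  rewrite mulrn_eq0 => /orP[/eqP c0|/eqP //].
  by have := card0_eq c0 z; rewrite !unfold_in z0.
apply/rowP=> j; rewrite mxE; have jA := enum_valP j.
have : f (enum_val j) = 0 by rewrite fz ?f0 //; move: jA; rewrite inE => /andP[].
by rewrite fA // /g jA enum_valK_in.
Qed.
End Cocycle.

(** A nontrivial representation would have dimension at least 2^n - 2. *)
Theorem small_rep_trivial (F : numClosedFieldType) (n N' : nat) (n4 : (4 < n)%N)
  (hN : (N'.+1 < 2 ^ n - 2)%N) (sb : 'M['F_2]_n -> 'M[F]_N'.+1) (sb1 : sb 1%:M = 1%:M)
  (sbM : forall g h, g \in unitmx -> h \in unitmx -> sb (g *m h) = sb g *m sb h) i o :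
  i != o -> sb (xe i o 1) = 1%:M.
Proof.
move=> io; apply/eqP; apply: NNPP => /negP nt.
have [u [u0E uM]] := u_exists n4 hN sb1 sbM io nt.
have u0 a b (ind : indep2 a b) : u a b != 0 by case: (u0E _ _ ind).
have uE a b (ind : indep2 a b) : eigv sb (a + b) a (u a b) by case: (u0E _ _ ind).
have := dim_bound n4 sb1 sbM (eigv_uniq hN sb1 sbM) u0 uE uM.
by rewrite leqNgt hN.
Qed.

(** * Small representations of SL_n(Z) are algebraic *)

Section Extension.
Variables (F : numClosedFieldType) (n N' : nat).
Local Notation N := N'.+1.
Hypothesis n4 : (4 < n)%N.
Hypothesis hN : (N < 2 ^ n - 2)%N.
Variable ph : 'M[int]_n -> 'M[F]_N.
Hypothesis ph1 : ph 1%:M = 1%:M.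
Hypothesis phM : forall g h, \det g = 1 -> \det h = 1 -> ph (g *m h) = ph g *m ph h.

(** The complementary factor sigma of [algebraic_part] is trivial, first on elementary matrices
    by reduction modulo 2, then on all of SL_n(Z). *)
Lemma polynomial_extension : exists Q : 'M[{mpoly F[n * n]}]_N,
  let alg (K : 'M[F]_n) := map_mx (evm idfun K) Q in
  [/\ alg 1%:M = 1%:M,
      forall g h, \det g = 1 -> \det h = 1 -> alg (g *m h) = alg g *m alg h &
      forall g, \det g = 1 -> ph g = alg (map_mx intr g)].
Proof.
have [L LE] := log_family n4 ph1 phM.
have nilL i j : i != j -> L i j ^+ N = 0 by move=> /LE[].
have expL i j a (ij : i != j) := (LE i j ij).2 a.
have [Q] := algebraic_part n4 ph1 phM nilL expL.
pose alg (K : 'M[F]_n) := map_mx (evm idfun K) Q.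
pose sigma g := ph g *m alg (map_mx intr (invmx g)).
move=> -[/= alg1 algM sigE].
move=> sigM0 sig1.
have sigM g h : \det g = 1 -> \det h = 1 -> sigma (g *m h) = sigma g *m sigma h := @sigM0 g h.
exists Q; split=> // g dg; rewrite -[LHS](sigE g dg) -[X in X *m _]/(sigma g).
suff -> : sigma g = 1%:M by rewrite mul1mx.
have s1 : sigma 1%:M = 1%:M by rewrite /sigma ph1 mul1mx invmx1 map_mx1; exact: alg1.
have sq := sg_square n4 hN s1 sigM (fact_gt0 N) sig1.
have [sb [sbE sb1 sbM]] := reduction s1 sigM (fun i j => sq j i).
have x1 i j : i != j -> sigma (xe i j 1) = 1%:M.
  move=> ij; rewrite -sbE ?det_xe // map_xe /= rmorph1.
  exact: (small_rep_trivial n4 hN sb1 sbM).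
have xk i j (k : nat) : i != j -> sigma (xe i j k%:R) = 1%:M.
  move=> ij; have := ph_xeX s1 sigM 1 k ij; rewrite mul1r => ->.
  by rewrite x1 // -[1%:M]/(1 : 'M_N) expr1n.
elim/sl_int_gen: g / dg => // g i j a ij dg IH.
rewrite sigM ?det_xe // IH mul1mx.
case: (intP a) => [|k|k]; rewrite ?xe0 // -natz; first exact: xk.
have := ph_xeM sigM (k.+1%:R) (- k.+1%:R) ij.
by rewrite subrr xe0 s1 xk // mul1mx => <-.
Qed.
End Extension.

Section AlgebraicOfPolynomial.
Variables (F : numClosedFieldType) (n N : nat) (Q : 'M[{mpoly F[n * n]}]_N).
Local Notation alg K := (map_mx (evm idfun K) Q).
Hypothesis alg1 : alg 1%:M = 1%:M.
Hypothesis algM : forall g h, \det g = 1 -> \det h = 1 -> alg (g *m h) = alg g *m alg h.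

Lemma alg_adj (g : 'M[F]_n) : \det g = 1 -> alg g *m alg (\adj g) = 1%:M.
Proof.
move=> dg; have da : \det (\adj g) = 1.
  have := congr1 determinant (mul_mx_adj g).
  by rewrite det_mulmx dg mul1r det_scalar expr1n.
by rewrite -algM // mul_mx_adj dg alg1.
Qed.

Lemma alg_unit (g : SL n F) : alg (sl_mx g) \in unitmx.
Proof. by have /mulmx1_unit[] := alg_adj (eqP (sl_det g)). Qed.

Definition alg_fun (g : SL n F) : GL N F := MkGL (alg_unit g).

Lemma alg_funM : {morph alg_fun : g h / (g * h)%g}.
Proof.
move=> g h; apply: val_inj => /=.
by rewrite algM // (eqP (sl_det _)).
Qed.

HB.instance Definition _ := isMultiplicative.Build (SL n F) (GL N F) alg_fun alg_funM.

Lemma meval_evm k (p : {mpoly F[k * k]}) (M : 'M[F]_k) : p.@[mxvec M 0] = evm idfun M p.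
Proof. by []. Qed.

Lemma evm_comp (g : 'M[F]_n) (S : 'M[{mpoly F[n * n]}]_N) (p : {mpoly F[N * N]}) :
  evm idfun g (evm (@mpolyC (n * n) F) S p) = evm idfun (map_mx (evm idfun g) S) p.
Proof. by apply: evm_map => c; rewrite /= evmC. Qed.

(** Pulling back a polynomial function amounts to substitution. The inverse of the determinant
    of alg(g) is the determinant of alg(adj g), a polynomial in the entries of g. *)
Lemma alg_morphism : is_variety_morphism alg_fun.
Proof.
move=> f [p [m fE]].
(* [Qa] evaluates at [g] to the image of the inverse of [g] *)
pose Qa : 'M[{mpoly F[n * n]}]_N := map_mx (evm (@mpolyC (n * n) F) (\adj (genmx F n))) Q.
exists (evm (@mpolyC (n * n) F) Q p * \det Qa ^+ m) => g.
rewrite /= fE /= !meval_evm rmorphM rmorphXn /= evm_comp; congr (_ * _).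
have -> : evm idfun g (\det Qa) = \det (alg (\adj (sl_mx g))).
  rewrite -det_map_mx; congr (\det _); apply/matrixP=> i j; rewrite !mxE.
  rewrite (evm_map (ib := idfun) _ _ (fun c => evmC _ _ c)).
  by rewrite map_mx_adj evm_gen.
rewrite -exprVn; congr (_ ^+ _); apply: (mulrI (_ : \det (alg (sl_mx g)) \is a GRing.unit)).
  by rewrite -unitmxE alg_unit.
rewrite divrr -?unitmxE ?alg_unit // -det_mulmx alg_adj ?det1 //.
exact/eqP/sl_det.
Qed.

Definition alg_rep := AlgRep alg_morphism.
End AlgebraicOfPolynomial.

Theorem small_rep_extends (F : numClosedFieldType) n N (hn : (4 < n)%N) (hN : (N < 2 ^ n - 2)%N)
  (phi : {multiplicative SL n int -> GL N F}) :
  exists phit : algebraic_representation F n N,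
    forall g : SL n int, phi g = phit (sl_of_int F g).
Proof.
case: N hN phi => [_ phi|N' hN phi].
  (* in dimension 0 any polynomial matrix will do *)
  have Q1 (K : 'M[F]_n) : map_mx (evm idfun K) (1%:M : 'M_0) = 1%:M.
    by apply/matrixP=> -[].
  have QM (g h : 'M[F]_n) : \det g = 1 -> \det h = 1 ->
      map_mx (evm idfun (g *m h)) (1%:M : 'M_0) =
      map_mx (evm idfun g) (1%:M : 'M_0) *m map_mx (evm idfun h) (1%:M : 'M_0).
    by move=> _ _; apply/matrixP=> -[].
  exists (alg_rep (Q1 _) QM) => g; apply: val_inj; apply/matrixP=> -[].
  by [].
pose ph (M : 'M[int]_n) : 'M[F]_N'.+1 := gl_mx (phi (insubd (1%g : SL n int) M)).
have phE (g : SL n int) : ph g = gl_mx (phi g) by rewrite /ph valKd.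
have slE (M : 'M[int]_n) : \det M = 1 -> exists g : SL n int, M = g.
  by move/eqP => dM; exists (MkSL dM).
have phM g h : \det g = 1 -> \det h = 1 -> ph (g *m h) = ph g *m ph h.
  move=> /slE[{}g ->] /slE[{}h ->].
  by rewrite -[sl_mx g *m _]/(sl_mx (g * h)%g) !phE gmulfM.
have ph1 : ph 1%:M = 1%:M.
  rewrite -[1%:M]/(sl_mx (1%g : SL n int)) phE.
  have -> : phi 1%g = 1%g by apply: (mulgI (phi 1%g)); rewrite -gmulfM !mulg1.
  by [].
have [Q /= [Q1 QM QE]] := polynomial_extension hn hN ph1 phM.
exists (alg_rep Q1 QM) => g; apply: val_inj => /=.
by rewrite -phE QE // (eqP (sl_det g)).
Qed.

Local Close Scope ring_scope.

Theorem corollary2p8 (R : realType) (n : nat) (hn : 5 <= n)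
    (N : nat) (hN : N < 2 ^ n - 2)
    (phi : {multiplicative SL n int -> GL N R[i]}) :
  exists phit : algebraic_representation R[i] n N,
    forall g : SL n int, phi g = phit (sl_of_int R[i] g).
Proof. exact: small_rep_extends. Qed.
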